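(* Let $\mathbf V,\mathbf Y,\mathcal M,g,\mathcal W$ satisfy the standing assumptions listed in the context, including the local consistency $\mathcal W[y,\tilde y]=\mathrm{dist}^2(y,\tilde y)+O(\mathrm{dist}^3(y,\tilde y))$. Let $m\in\mathbb N$, $\mathcal W\in C^m(\mathcal M\times\mathcal M;\mathbb R)$ and $g\in C^m(\mathcal M\times\mathbf V\times\mathbf V;\mathbb R)$. Let $y\in\mathring{\mathcal M}$ (the interior of $\mathcal M$) and $v,w,z\in\mathbf V$. Let $\mathrm R_y(v,w)z$ be the Riemann curvature tensor and let $\mathbf R^{\tau}_y(v,w)z$ and $\mathbf R^{\pm\tau}_y(v,w)z$ be its discrete approximations (with exponent $\beta$) built from one-sided and central covariant difference quotients, respectively. Then, for sufficiently small $\tau>0$: (i) if $m\ge4$ and $\beta\ge2$, then $\mathbf R^{\tau}_y(v,w)z=\mathrm R_y(v,w)z+O(\tau)$ with respect to the $\mathbf V$ norm; (ii) if $m\ge5$ and $\beta\ge\tfrac32$, then $\mathbf R^{\pm\tau}_y(v,w)z=\mathrm R_y(v,w)z+O(\tau^2)$ with respect to the $\mathbf V$ norm.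
   Context: Standing assumptions. $\mathbf V$ is a separable, reflexive Banach space compactly embedded in a Banach space $\mathbf Y$. $\mathcal M$ is the weak closure of an open path-connected subset of $\mathbf V$, potentially with a smooth boundary; the tangent space $T_y\mathcal M$ is identified with $\mathbf V$, so a vector field is a map $\mathcal M\to\mathbf V$. $g:\mathcal M\times\mathbf V\times\mathbf V\to\mathbb R$, $(y,v,w)\mapsto g_y(v,w)$, is a Riemannian metric which is uniformly bounded and coercive: $c^*\|v\|_{\mathbf V}^2\le g_y(v,v)\le C^*\|v\|_{\mathbf V}^2$ with constants $c^*,C^*>0$; moreover $g$ is $C^3(\mathbf Y\times\mathbf V\times\mathbf V;\mathbb R)$-smooth. $\mathrm{dist}(y_A,y_B)$ is the Riemannian distance, i.e. the square root of the minimum of $\int_0^1 g_{\mathbf y(t)}(\dot{\mathbf y}(t),\dot{\mathbf y}(t))\,dt$ over paths $\mathbf y:[0,1]\to\mathcal M$ with $\mathbf y(0)=y_A$, $\mathbf y(1)=y_B$. $\mathcal W:\mathcal M\times\mathcal M\to\mathbb R$ is a smooth functional (with the precise differentiability stated in the claim), extended by $\infty$ to $\mathbf Y\times\mathbf Y$, weakly lower semi-continuous, and locally consistent with the squared distance: $\mathcal W[y,\tilde y]=\mathrm{dist}^2(y,\tilde y)+O(\mathrm{dist}^3(y,\tilde y))$. It is not assumed symmetric. $\mathcal W_{,j}[\cdot,\cdot]\in\mathbf V'$ denotes the derivative of $\mathcal W$ with respect to its $j$th argument. Covariant derivative. The Christoffel operator $\Gamma_y:\mathbf V\times\mathbf V\to\mathbf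 V$ is defined by $2g_y(\Gamma_y(v,w),r)=(D_yg_y)(w)(v,r)-(D_yg_y)(r)(v,w)+(D_yg_y)(v)(w,r)$ for all $r\in\mathbf V$, where $(D_yg_y)(u)$ is the derivative of $y\mapsto g_y$ in direction $u$. For a vector field $\xi$, the covariant derivative $D_v\xi(y)\in\mathbf V$ at $y$ in direction $v\in\mathbf V$ is defined by $g_y(D_v\xi(y),r)=g_y\big(\tfrac{d}{dt}|_{t=0}\xi(y+tv),r\big)+g_y(\Gamma_y(\xi(y),v),r)$ for all $r\in\mathbf V$. For fixed $v\in\mathbf V$, $y\mapsto D_v\xi(y)$ is again a vector field. Inverse discrete parallel transport. For $y\in\mathring{\mathcal M}$ and sufficiently small $u,\zeta\in\mathbf V$ let $(c,p)$ be the locally unique pair of points (near $(y,y)$) solving, in $\mathbf V'$, $$\mathcal W_{,2}[p,c]+\mathcal W_{,1}[c,y+u]=0,\qquad \mathcal W_{,2}[y,c]+\mathcal W_{,1}[c,y+u+\zeta]=0,$$ and set $\mathbf P^{-1}_{y+u,y}\,\zeta:=p-y\in\mathbf V$. Covariant difference quotients of a vector field $\xi$ in direction $v\in\mathbf V$ with step size $\tau$: $$\mathbf D^{\tau}_v\xi(y):=\frac{\mathbf P^{-1}_{y+\tau v,y}\big(\tau \xi(y+\tau v)\big)-\tau \xi(y)}{\tau^2},\qquad \mathbf D^{\pm\tau}_v\xi(y):=\frac{\mathbf P^{-1}_{y+\tau v,y}\big(\tau \xi(y+\tau v)\big)+\mathbf P^{-1}_{y-\tau v,y}\big(-\tau \xi(y-\tau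 v)\big)}{2\tau^2}.$$ Curvature tensors. For $v,w,z\in\mathbf V$, extend the tangent vector $z$ to a smooth vector field on $\mathcal M$, again denoted $z$ (for instance the constant vector field), and use the parametrization $(t,s)\mapsto y+tv+sw$, so that derivatives in $t$ and $s$ are derivatives in the fixed directions $v$ and $w$. Then $$\mathrm R_y(v,w)z:=\big(D_vD_wz-D_wD_vz\big)(y),$$ $$\mathbf R^{\tau}_y(v,w)z:=\big(\mathbf D^{\tau}_v\mathbf D^{\tau^\beta}_wz-\mathbf D^{\tau}_w\mathbf D^{\tau^\beta}_vz\big)(y),\qquad \mathbf R^{\pm\tau}_y(v,w)z:=\big(\mathbf D^{\pm\tau}_v\mathbf D^{\pm\tau^\beta}_wz-\mathbf D^{\pm\tau}_w\mathbf D^{\pm\tau^\beta}_vz\big)(y),$$ where the inner difference quotients have step size $\tau^\beta$. The implicit constants in $O(\cdot)$ are independent of $\tau$. *)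

(* Defs.v *)
From HB Require Import structures.
From mathcomp Require Import all_boot all_order all_algebra.
From mathcomp Require Import all_classical all_reals all_analysis.

Set Implicit Arguments.
Unset Strict Implicit.
Unset Printing Implicit Defensive.

Import Order.TTheory GRing.Theory Num.Theory.
Import numFieldNormedType.Exports.

Local Open Scope classical_set_scope.
Local Open Scope ring_scope.

Record topdual (R : realType) (E : normedModType R) := Dual {
  topdual_fun :> {linear E -> R^o} ;
  topdual_continuous : continuous topdual_fun }.

(* E with the coarsest topology making every element of the dual continuous *)
Definition weak_space (R : realType) (E : normedModType R) :=
  initial_topology
    ((fun x phi => phi x) : E -> {ptws topdual E -> R^o}).

Definition weak_closure (R : realType) (E : normedModType R) (A : set E) :
  set E := @closure (weak_space E) A.

Definition separable_space (T : topologicalType) :=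
  exists2 S : set T, countable S & dense S.

(* Every bounded linear functional F on the dual (for the operator norm) is the
   evaluation at a point. *)
Definition reflexive_space (R : realType) (E : normedModType R) :=
  forall F : topdual E -> R,
    (forall (a : R) (f1 f2 f : topdual E),
       (forall x, f x = a * f1 x + f2 x) -> F f = a * F f1 + F f2) ->
    (exists C : R, forall (f : topdual E) (k : R), 0 <= k ->
       (forall x, `|f x| <= k * `|x|) -> `|F f| <= C * k) ->
  exists x : E, forall f : topdual E, F f = f x.

Definition compact_embedding (R : realType) (E F : normedModType R)
    (iota : {linear E -> F}) :=
  [/\ injective iota, continuous iota &
      precompact (iota @` [set x | `|x| <= 1])].

Definition path_connected (R : realType) (E : normedModType R) (A : set E) :=
  forall a b, A a -> A b -> exists gam : R -> E,
    [/\ {within `[0, 1], continuous gam}, gam 0 = a, gam 1 = b &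
        forall t, t \in `[0, 1] -> A (gam t)].

(* A bounded k-linear map, its arguments being given as a list of length k. *)
Definition bounded_multilinear (R : realType) (E F : normedModType R)
    (k : nat) (T : seq E -> F) :=
  (forall (s1 s2 : seq E) (a : R) (u v : E), (size s1 + size s2).+1 = k ->
     T (s1 ++ (a *: u + v) :: s2) = a *: T (s1 ++ u :: s2) + T (s1 ++ v :: s2))
  /\ exists C : R, forall s : seq E, size s = k ->
       `|T s| <= C * \prod_(h <- s) `|h|.

(* f is of class C^m on A: D x, restricted to lists of length k, is the k-th
   Frechet derivative of f at x, seen as a k-linear map through
   L(E, L(E, ... F)) = L^k(E; F); limits are taken in the operator norm and
   relatively to A, so that for A open this is the usual notion and otherwise
   the derivatives extend up to the boundary. *)
Definition Cn_on (R : realType) (E F : normedModType R) (m : nat) (A : set E)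
    (f : E -> F) :=
  exists D : E -> seq E -> F,
  [/\ forall x, A x -> D x [::] = f x,
      forall x k, A x -> (k <= m)%N -> bounded_multilinear k (D x),
      forall x k, A x -> (k < m)%N -> forall e : R, 0 < e ->
        \forall x' \near x, A x' -> forall s : seq E, size s = k ->
          `|D x' s - D x s - D x ((x' - x) :: s)|
            <= e * `|x' - x| * \prod_(h <- s) `|h| &
      forall x, A x -> forall e : R, 0 < e ->
        \forall x' \near x, A x' -> forall s : seq E, size s = m ->
          `|D x' s - D x s| <= e * \prod_(h <- s) `|h| ].

Definition smooth_on (R : realType) (E F : normedModType R) (A : set E)
    (f : E -> F) := forall k : nat, Cn_on k A f.

(* In what follows the metric is a function on Y, and g_y stands for
   g (iota y). *)
Definition riemannian_metric (R : realType) (V Y : normedModType R)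
    (iota : V -> Y) (M : set V) (g : Y -> V -> V -> R^o) :=
  [/\ forall y, M y -> forall v w, g (iota y) v w = g (iota y) w v,
      forall y, M y -> forall (a : R) u v w,
        g (iota y) (a *: u + v) w = a * g (iota y) u w + g (iota y) v w &
      exists c C : R, [/\ 0 < c, 0 < C & forall y v, M y ->
        c * `|v| ^+ 2 <= g (iota y) v v <= C * `|v| ^+ 2]].

(* gam is a path in the Sobolev space W^{1,2}((0,1); V) with weak derivative
   dgam. As V is separable, strong measurability of dgam amounts to weak
   measurability. *)
Definition sobolev_path (R : realType) (V : normedModType R)
    (gam dgam : R -> V) :=
  [/\ forall phi : topdual V,
        measurable_fun (`[0, 1] : set R) (fun t : R => phi (dgam t) : R),
      (\int[@lebesgue_measure R]_(t in `[0%R, 1%R]) (`|dgam t| ^+ 2)%:E < +oo)%E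
    & forall (phi : topdual V) (t : R), t \in `[0, 1] ->
        phi (gam t) = phi (gam 0) +
          \int[@lebesgue_measure R]_(s in `[0, t]) (phi (dgam s) : R)].

Definition path_energies (R : realType) (V Y : normedModType R)
    (iota : V -> Y) (M : set V) (g : Y -> V -> V -> R^o) (yA yB : V) :
    set (\bar R) :=
  [set e | exists gam dgam : R -> V,
    [/\ sobolev_path gam dgam, forall t, t \in `[0, 1] -> M (gam t),
        gam 0 = yA, gam 1 = yB &
        e = (\int[@lebesgue_measure R]_(t in `[0%R, 1%R])
               (g (iota (gam t)) (dgam t) (dgam t))%:E)%E]].

(* +oo if yA and yB are not joined by a path of finite energy in M *)
Definition rdist (R : realType) (V Y : normedModType R)
    (iota : V -> Y) (M : set V) (g : Y -> V -> V -> R^o) (yA yB : V) : \bar R :=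
  sqrte (ereal_inf (path_energies iota M g yA yB)).

(* W y y' = dist^2(y, y') + O(dist^3(y, y')), locally on M. *)
Definition locally_consistent (R : realType) (V Y : normedModType R)
    (iota : V -> Y) (M : set V) (g : Y -> V -> V -> R^o) (W : V -> V -> R^o) :=
  forall y0, M y0 -> exists C delta : R, [/\ 0 < C, 0 < delta &
    forall y y', M y -> M y' -> `|y - y0| < delta -> `|y' - y0| < delta ->
      (`| (W y y')%:E - rdist iota M g y y' ^+ 2 |
         <= C%:E * rdist iota M g y y' ^+ 3)%E].

(* The extension of W by +oo: iota being injective, the infimum is over a
   singleton or over the empty set. *)
Definition extend_by_infty (R : realType) (V Y : normedModType R)
    (iota : V -> Y) (M : set V) (W : V -> V -> R^o) (q : Y * Y) : \bar R :=
  ereal_inf [set e | exists y y' : V,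
    [/\ M y, M y', (iota y, iota y') = q & e = (W y y')%:E]].

Definition weakly_lsc (R : realType) (E : normedModType R) (f : E -> \bar R) :=
  @lower_semicontinuous (weak_space E) R f.

Definition is_christoffel (R : realType) (V Y : normedModType R)
    (iota : V -> Y) (g : Y -> V -> V -> R^o) (y v w x : V) :=
  forall r : V, 2 * g (iota y) x r =
    'D_w (fun q => g (iota q) v r) y - 'D_r (fun q => g (iota q) v w) y
    + 'D_v (fun q => g (iota q) w r) y.

Definition christoffel (R : realType) (V Y : normedModType R)
    (iota : V -> Y) (g : Y -> V -> V -> R^o) (y v w : V) : V :=
  xget 0 [set x | is_christoffel iota g y v w x].

Definition covariant (R : realType) (V Y : normedModType R)
    (iota : V -> Y) (g : Y -> V -> V -> R^o) (v : V) (xi : V -> V) (y : V) : V :=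
  xget 0 [set x | forall r : V,
    g (iota y) x r = g (iota y) ('D_v xi y) r
                     + g (iota y) (christoffel iota g y (xi y) v) r].

Definition curvature (R : realType) (V Y : normedModType R)
    (iota : V -> Y) (g : Y -> V -> V -> R^o) (y v w : V) (Z : V -> V) : V :=
  covariant iota g v (covariant iota g w Z) y
  - covariant iota g w (covariant iota g v Z) y.

(* The pairs (c, p) at distance less than r from (y, y) which solve the
   system defining the inverse discrete parallel transport. *)
Definition transport_pairs (R : realType) (V : normedModType R) (M : set V)
    (W : V -> V -> R^o) (r : R) (y u zeta : V) : set (V * V) :=
  [set cp : V * V | let c := cp.1 in let p := cp.2 in
    [/\ M c /\ `|c - y| < r, M p /\ `|p - y| < r,
        forall psi : V,
          'd (fun q => W p q) c psi + 'd (fun q => W q (y + u)) c psi = 0 &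
        forall psi : V,
          'd (fun q => W y q) c psi + 'd (fun q => W q (y + u + zeta)) c psi
          = 0]].

(* P^{-1}_{y+u,y} zeta, where r is the radius in which the pair (c, p) is
   required to exist and to be unique; the value is 0 - y if this fails. *)
Definition inv_transport (R : realType) (V : normedModType R) (M : set V)
    (W : V -> V -> R^o) (r : R) (y u zeta : V) : V :=
  (xget 0 [set cp | transport_pairs M W r y u zeta = [set cp]]).2 - y.

Definition dcov (R : realType) (V : normedModType R) (M : set V)
    (W : V -> V -> R^o) (r tau : R) (v : V) (xi : V -> V) (y : V) : V :=
  (tau ^+ 2)^-1 *:
    (inv_transport M W r y (tau *: v) (tau *: xi (y + tau *: v)) - tau *: xi y).

Definition dcov_central (R : realType) (V : normedModType R) (M : set V)
    (W : V -> V -> R^o) (r tau : R) (v : V) (xi : V -> V) (y : V) : V :=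
  (2 * tau ^+ 2)^-1 *:
    (inv_transport M W r y (tau *: v) (tau *: xi (y + tau *: v))
     + inv_transport M W r y (- (tau *: v)) (- (tau *: xi (y - tau *: v)))).

Definition dcurvature (R : realType) (V : normedModType R) (M : set V)
    (W : V -> V -> R^o) (r beta tau : R) (y v w : V) (Z : V -> V) : V :=
  dcov M W r tau v (dcov M W r (tau `^ beta) w Z) y
  - dcov M W r tau w (dcov M W r (tau `^ beta) v Z) y.

Definition dcurvature_central (R : realType) (V : normedModType R) (M : set V)
    (W : V -> V -> R^o) (r beta tau : R) (y v w : V) (Z : V -> V) : V :=
  dcov_central M W r tau v (dcov_central M W r (tau `^ beta) w Z) y
  - dcov_central M W r tau w (dcov_central M W r (tau `^ beta) v Z) y.

(* Main.v *)
(* Consistency of W with dist^2 forces W(x, x) = 0, DW(x, x) = 0 and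
   D^2 W(x, x)(al, be) = 2 g_x(al_1 - al_2, be_1 - be_2) near the diagonal, and
   differentiating the last identity along the diagonal gives the third
   derivatives of W which enter the second order of the two discrete
   Euler-Lagrange equations; they combine to the form defining the Christoffel
   operator. As g is coercive, a Newton iteration solves these equations
   uniquely and uniformly in the base point x, and for u = tau v and
   zeta = tau z1 + tau^2 z2 + O(tau^3) it yields
     p - x = tau z1 + tau^2 (z2 + Gamma_x(z1, v)) + O(tau^3),
   with a remainder tau^3 N + O(tau^4), N independent of tau, when m >= 5; the
   cubic terms for tau and - tau then cancel.  Hence the difference quotients of
   a field xi along v are D_v xi + O(tau), resp. D_v xi + O(tau^2), even if xi
   is only known up to an error tau^2, resp. tau^3, and the error tau^beta,
   resp. tau^(2 beta), of the inner quotient is of that size.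

   Only scalar Taylor expansions are needed: vectors are tested against the
   coercive form g_x, Riesz' theorem turning expansions of linear forms into
   expansions of vectors. *)

Require Import Defs.
From HB Require Import structures.
From mathcomp Require Import all_boot all_order all_algebra.
From mathcomp Require Import all_classical all_reals all_analysis.
From mathcomp Require Import measurable_realfun.
From mathcomp Require Import ring lra zify.
Import Order.TTheory GRing.Theory Num.Theory.
Import numFieldNormedType.Exports.
Set Implicit Arguments.
Unset Strict Implicit.
Unset Printing Implicit Defensive.
Local Open Scope classical_set_scope.
Local Open Scope ring_scope.

(** * Multilinear derivatives *)

(** The expansions are read off from residuals. Polynomials in tau are inserted in the two discrete
    equations, with coefficients chosen through Riesz' theorem so that the residuals are cubic, and
    stability of the equations, uniform in the base point, turns a residual into the distance to the
    solution. The solution itself is never differentiated in tau or in x. In the central case N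
    depends only on x and on the coefficients of the polynomials, so it is the same for tau and -
    tau, whereas the two perturbations d may differ; they enter the expansion linearly and are
    summed separately. The comparison of dist^2(a, b) with g_a(b - a, b - a) bounds the infimum over
    paths from above by a straight segment and from below by testing each path against linear
    functionals g_a(w, .). *)

Lemma is_derive_frechet (R : realType) (E F : normedModType R)
    (f : E -> F) (x h : E) (L : E -> F) (t : R) :
  (forall e : R, 0 < e -> \forall x' \near x + t *: h,
     `|f x' - f (x + t *: h) - L (x' - (x + t *: h))|
       <= e * `|x' - (x + t *: h)|) ->
  (forall a : R, L (a *: h) = a *: L h) ->
  is_derive t 1 (fun s : R => f (x + s *: h)) (L h).
Proof.
move=> Lf LZ.
suff H : (fun s : R => s^-1 *: (((fun s : R => f (x + s *: h)) \o shift t)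
     (s *: 1) - f (x + t *: h))) @ 0^' --> L h.
  by apply: DeriveDef; [apply: cvgP H|apply: cvg_lim H].
apply/cvgrPdist_le => /= e e0.
have e1 : 0 < e / (`|h| + 1) by rewrite divr_gt0// ltr_wpDl.
have /nbhs_ballP[d /= d0 Hd] := Lf _ e1.
near=> s.
have s0 : s != 0 by near: s; exact: nbhs_dnbhs_neq.
have Es : x + (s%:A + t) *: h = x + t *: h + s *: h.
  by rewrite [s%:A]mulr1 scalerDl addrA addrAC.
have /Hd : ball (x + t *: h) d (x + (s%:A + t) *: h).
  rewrite Es -ball_normE /= opprD addNKr normrN normrZ.
  rewrite (@le_lt_trans _ _ (`|s| * (`|h| + 1)))//.
    by rewrite ler_wpM2l// lerDl.
  rewrite -ltr_pdivlMr ?ltr_wpDl//.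
  near: s; apply: dnbhs0_lt; by rewrite divr_gt0 ?ltr_wpDl.
rewrite Es (addrC _ (s *: h)) addrK LZ => H.
rewrite distrC -[L h](scalerK s0) -scalerBr normrZ normfV.
rewrite ler_pdivrMl ?normr_gt0//.
rewrite (addrC (s *: h)) /= in H *.
rewrite -/(shift _ _) /= [X in f X](_ : _ = x + t *: h + s *: h); last first.
  by rewrite -Es.
apply: le_trans H _; rewrite normrZ mulrCA ler_wpM2l// mulrAC ler_pdivrMr ?ltr_wpDl//.
by rewrite ler_wpM2l ?lerDl // ltW.
Unshelve. all: by end_near. Qed.

Lemma mean_value_le (R : realType) (f df : R -> R) (C : R) :
  (forall t : R, 0 <= t <= 1 -> is_derive t 1 f (df t)) ->
  (forall t : R, 0 <= t <= 1 -> `|df t| <= C) ->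
  `|f 1 - f 0| <= C.
Proof.
move=> fd dfC.
have [|||c cI ->] := @MVT R f df 0 1.
- by [].
- by move=> t tI; apply: fd; rewrite !ltW ?(itvP tI).
- apply: derivable_within_continuous => t tI.
  by apply: ex_derive; apply: fd; rewrite !(itvP tI).
by rewrite subr0 mulr1 dfC// !ltW ?(itvP cI).
Qed.

Lemma is_derive_poly (R : realType) (k : nat) (c : nat -> R) (t : R) :
  is_derive t 1 (fun t : R => \sum_(j < k) c j * t ^+ j)
    (\sum_(j < k) c j * (j%:R * t ^+ j.-1)).
Proof.
rewrite (_ : (fun _ => _) = \sum_(j < k) (fun t : R => c j * t ^+ j)).
  apply: is_derive_sum => j; rewrite (_ : (fun _ => _) = c j \*: ((id : R -> R) ^+ j)).
    by apply: is_derive_eq; rewrite /= [_%:A]mulr1.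
  by apply/funext => u; rewrite exprfctE.
by apply/funext => u; rewrite fct_sumE.
Qed.

Definition nprod (R : realType) (E : normedModType R) (s : seq E) : R :=
  \prod_(h <- s) `|h|.

Lemma nprod_ge0 (R : realType) (E : normedModType R) (s : seq E) :
  0 <= nprod s.
Proof. exact: prodr_ge0. Qed.

Lemma nprod_cons (R : realType) (E : normedModType R) (h : E) s :
  nprod (h :: s) = `|h| * nprod s.
Proof. by rewrite /nprod big_cons. Qed.

Lemma nprod0 (R : realType) (E : normedModType R) : nprod ([::] : seq E) = 1.
Proof. by rewrite /nprod big_nil. Qed.

(* D x s is the derivative of order size s of a scalar function at x, applied to
   the vectors of s; it need only be differentiable along lines. *)
Record jet (R : realType) (E : normedModType R) (n : nat) (x0 : E)
    (rho K : R) (D : E -> seq E -> R) : Prop := Jet {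
  jet_linear : forall x (s1 s2 : seq E) (a : R) (u v : E),
    `|x - x0| < rho -> (size s1 + size s2 < n)%N ->
    D x (s1 ++ (a *: u + v) :: s2)
      = a * D x (s1 ++ u :: s2) + D x (s1 ++ v :: s2);
  jet_bound : forall x s, `|x - x0| < rho -> (size s <= n)%N ->
    `|D x s| <= K * nprod s;
  jet_derive : forall x h s (t : R), `|x + t *: h - x0| < rho ->
    (size s < n)%N ->
    is_derive t 1 (fun t : R => D (x + t *: h) s : R) (D (x + t *: h) (h :: s))
}.

Section jet_theory.
Variables (R : realType) (E : normedModType R) (n : nat) (x0 : E).
Variables (rho K : R) (D : E -> seq E -> R).
Hypothesis JD : jet n x0 rho K D.
Implicit Types (x h : E) (s : seq E).

Lemma jetD x s1 s2 u v : `|x - x0| < rho -> (size s1 + size s2 < n)%N ->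
  D x (s1 ++ (u + v) :: s2) = D x (s1 ++ u :: s2) + D x (s1 ++ v :: s2).
Proof.
by move=> xr sn; have := jet_linear JD 1 u v xr sn; rewrite scale1r mul1r.
Qed.

Lemma jet0 x s1 s2 : `|x - x0| < rho -> (size s1 + size s2 < n)%N ->
  D x (s1 ++ 0 :: s2) = 0.
Proof.
move=> xr sn; have := jetD 0 0 xr sn; rewrite addr0 => /eqP.
by rewrite -subr_eq subrr => /eqP <-.
Qed.

Lemma jetZ x s1 s2 a u : `|x - x0| < rho -> (size s1 + size s2 < n)%N ->
  D x (s1 ++ (a *: u) :: s2) = a * D x (s1 ++ u :: s2).
Proof.
by move=> xr sn; have := jet_linear JD a u 0 xr sn; rewrite jet0// !addr0.
Qed.

Lemma jet_nseqZ x s1 s2 a u k : `|x - x0| < rho ->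
    (size s1 + k + size s2 <= n)%N ->
  D x (s1 ++ nseq k (a *: u) ++ s2) = a ^+ k * D x (s1 ++ nseq k u ++ s2).
Proof.
move=> xr; elim: k s1 => [|k IH] s1 sn /=; first by rewrite expr0 mul1r.
rewrite jetZ//; last first.
  by rewrite size_cat size_nseq; move: sn; rewrite addnS addSn addnA.
rewrite -(cat_rcons u s1 (nseq k (a *: u) ++ s2)) IH; last by rewrite size_rcons addSnnS.
by rewrite cat_rcons exprS mulrA.
Qed.

Lemma jet_segment x h (t : R) : 0 <= t <= 1 -> `|x - x0| < rho ->
  `|x + h - x0| < rho -> `|x + t *: h - x0| < rho.
Proof.
move=> /andP[t0 t1] xr xhr.
have -> : x + t *: h - x0 = (1 - t) *: (x - x0) + t *: (x + h - x0).
  by rewrite addrAC [x + h - x0]addrAC [t *: (_ + _)]scalerDr addrA -scalerDl subrK scale1r.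
apply: (le_lt_trans (ler_normD _ _)); rewrite !normrZ.
rewrite (ger0_norm t0) ger0_norm ?subr_ge0//.
have [->|tn0] := eqVneq t 0; first by rewrite mul0r addr0 subr0 mul1r.
have t0' : 0 < t by rewrite lt0r tn0.
rewrite (_ : rho = (1 - t) * rho + t * rho); last by ring.
by apply: ler_ltD; [rewrite ler_wpM2l ?subr_ge0// ltW|rewrite ltr_pM2l].
Qed.

(** Induction on [k]: along the segment, the remainder of order [k.+1] of [D _ s] has as its
    derivative in t the remainder of order [k] of [D _ (h :: s)] for the increment t h. The mean
    value inequality then gives the constant K in place of K / k!. *)
Lemma jet_taylor k x h s : (size s + k <= n)%N ->
  `|x - x0| < rho -> `|x + h - x0| < rho ->
  `|D (x + h) s - \sum_(j < k) (j`!%:R)^-1 * D x (nseq j h ++ s)|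
    <= K * `|h| ^+ k * nprod s.
Proof.
elim: k x h s => [|k IH] x h s sn xr xhr.
  by rewrite big_ord0 subr0 expr0 mulr1; apply: (jet_bound JD); rewrite -1?(addn0 (size s)).
pose f (t : R) : R := D (x + t *: h) s -
  \sum_(j < k.+1) (j`!%:R)^-1 * D x (nseq j h ++ s) * t ^+ j.
pose df (t : R) : R := D (x + t *: h) (h :: s) -
  \sum_(j < k) (j`!%:R)^-1 * D x (nseq j (t *: h) ++ h :: s).
have sn1 : (size s < n)%N by apply: leq_trans sn; rewrite addnS leq_addr.
have -> : D (x + h) s - \sum_(j < k.+1) (j`!%:R)^-1 * D x (nseq j h ++ s)
    = f 1 - f 0.
  have -> : f 0 = 0.
    rewrite /f scale0r addr0 big_ord_recl /= expr0 mulr1 fact0 invr1 mul1r.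
    by rewrite big1 ?addr0 ?subrr// => j _; rewrite /bump /= exprS mul0r mulr0.
  rewrite subr0 /f scale1r; congr (_ - _).
  by apply: eq_bigr => j _; rewrite expr1n mulr1.
apply: (@mean_value_le _ f df) => t t01.
  have xtr := jet_segment t01 xr xhr.
  apply: is_deriveB; first exact: (jet_derive JD).
  have -> : \sum_(j < k) (j`!%:R)^-1 * D x (nseq j (t *: h) ++ h :: s)
      = \sum_(j < k.+1) (j`!%:R)^-1 * D x (nseq j h ++ s) * (j%:R * t ^+ j.-1).
    rewrite [RHS]big_ord_recl /= mul0r mulr0 add0r; apply: eq_bigr => j _ /=.
    rewrite /bump /= add1n add0n factS natrM invfM.
    have := @jet_nseqZ x [::] (h :: s) t h j xr; rewrite /= add0n => ->; last first.
      by have := ltn_ord j; move: sn; clear; lia.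
    rewrite (_ : nseq j h ++ h :: s = h :: nseq j h ++ s); last first.
      by elim: (nat_of_ord j) => //= i ->.
    have : j.+1%:R != 0 :> R by rewrite pnatr_eq0.
    have : (j`!)%:R != 0 :> R by rewrite pnatr_eq0 -lt0n fact_gt0.
    by move=> ? ?; field; apply/andP.
  exact: (is_derive_poly k.+1 (fun j => (j`!%:R)^-1 * D x (nseq j h ++ s))).
have xtr := jet_segment t01 xr xhr.
apply: (le_trans (IH _ _ _ _ _ _)) => //=; first by rewrite addSnnS.
rewrite nprod_cons mulrA ler_wpM2r ?nprod_ge0//.
have K0 : 0 <= K.
  by have := jet_bound JD xr (leq0n n : size ([::] : seq E) <= n)%N; rewrite nprod0 mulr1; apply: le_trans.
rewrite exprSr mulrA ler_wpM2r// ler_wpM2l// lerXn2r ?nnegrE//.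
rewrite normrZ ler_piMl//; case/andP: t01 => t0 t1.
by rewrite ger0_norm.
Qed.

Lemma jet_taylor1 x h s : (size s < n)%N ->
  `|x - x0| < rho -> `|x + h - x0| < rho ->
  `|D (x + h) s - D x s| <= K * `|h| * nprod s.
Proof.
rewrite -addn1 => sn xr xhr; have := jet_taylor sn xr xhr.
by rewrite big_ord_recl big_ord0 /= fact0 invr1 mul1r addr0 expr1.
Qed.

Lemma jet_taylor2 x h s : (size s + 2 <= n)%N ->
  `|x - x0| < rho -> `|x + h - x0| < rho ->
  `|D (x + h) s - D x s - D x (h :: s)| <= K * `|h| ^+ 2 * nprod s.
Proof.
move=> sn xr xhr; have := jet_taylor sn xr xhr.
by rewrite !big_ord_recl big_ord0 /= fact0 invr1 !mul1r addr0 opprD addrA.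
Qed.

Lemma jet_taylor3 x h s : (size s + 3 <= n)%N ->
  `|x - x0| < rho -> `|x + h - x0| < rho ->
  `|D (x + h) s - D x s - D x (h :: s) - 2^-1 * D x [:: h, h & s]|
    <= K * `|h| ^+ 3 * nprod s.
Proof.
move=> sn xr xhr; have := jet_taylor sn xr xhr.
by rewrite !big_ord_recl big_ord0 /= fact0 invr1 !mul1r addr0 !opprD !addrA.
Qed.

Lemma jet_taylor4 x h s : (size s + 4 <= n)%N ->
  `|x - x0| < rho -> `|x + h - x0| < rho ->
  `|D (x + h) s - D x s - D x (h :: s) - 2^-1 * D x [:: h, h & s]
    - 6^-1 * D x [:: h, h, h & s]| <= K * `|h| ^+ 4 * nprod s.
Proof.
move=> sn xr xhr; have := jet_taylor sn xr xhr.
by rewrite !big_ord_recl big_ord0 /= fact0 invr1 !mul1r addr0 !opprD !addrA.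
Qed.

(** The derivative is frozen at [x]: Taylor at [b] costs K |a - b|^2 <= 2 K r |a - b|, and moving
    the derivative from [b] to [x] costs another K r |a - b|. With r small, this makes the Newton
    iteration for the discrete equations contract. *)
Lemma jet_linearization x a b s r : (size s + 2 <= n)%N ->
  `|x - x0| < rho -> `|a - x0| < rho -> `|b - x0| < rho ->
  `|a - x| <= r -> `|b - x| <= r -> 0 <= K ->
  `|D a s - D b s - D x ((a - b) :: s)| <= 3 * K * r * `|a - b| * nprod s.
Proof.
move=> sn xr ar br ax bx K0.
have E1 := @jet_taylor2 b (a - b) s sn br; rewrite subrKC in E1.
have E2 : `|D b ((a - b) :: s) - D x ((a - b) :: s)|
    <= K * r * `|a - b| * nprod s.
  have := @jet_taylor1 x (b - x) ((a - b) :: s).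
  rewrite subrKC nprod_cons mulrA => /(_ _ xr br) H.
  apply: le_trans (H _) _; first by rewrite -addn2.
  by rewrite !ler_wpM2r ?nprod_ge0// ler_wpM2l.
have {}E1 := E1 ar.
have ab : `|a - b| <= 2 * r.
  rewrite -(subrK x a) -addrA (le_trans (ler_normD _ _))// mulr2n mulrDl mul1r.
  by rewrite lerD// distrC.
rewrite -[D a s - D b s](subrK (D b ((a - b) :: s))) -addrA.
apply: (le_trans (ler_normD _ _)); apply: (le_trans (lerD E1 E2)).
rewrite -mulrDl ler_wpM2r ?nprod_ge0// expr2 mulrA -mulrDl ler_wpM2r//.
by rewrite -mulrDr -mulrA mulrCA ler_wpM2l//; lra.
Qed.

(** The increment in h is expanded at [x + k] and at [x]; the linear terms differ by [D x
    [:: k, h & s]] up to O(|h| |k|^2), the quadratic ones by O(|k| |h|^2). *)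
Lemma jet_second_difference x h k s : (size s + 3 <= n)%N ->
  `|x - x0| < rho -> `|x + h - x0| < rho -> `|x + k - x0| < rho ->
  `|x + k + h - x0| < rho -> 0 <= K ->
  `|D (x + k + h) s - D (x + k) s - D (x + h) s + D x s - D x [:: k, h & s]|
    <= 4 * K * (`|h| + `|k|) ^+ 3 * nprod s.
Proof.
move=> sn xr xh xk xkh K0.
have E1 := jet_taylor3 sn xk xkh.
have E2 := @jet_taylor2 x k (h :: s) _ xr xk.
have E3 := @jet_taylor1 x k [:: h, h & s] _ xr xk.
have E4 := jet_taylor3 sn xr xh.
have {}E2 := E2 ltac:(by move: sn; rewrite /=; lia).
have {}E3 := E3 ltac:(by move: sn; rewrite /=; lia).
rewrite !nprod_cons in E2 E3.
have P0 := nprod_ge0 s; set P := nprod s in E1 E2 E3 E4 P0 *.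
have KP : 0 <= K * P by rewrite mulr_ge0.
set nh := `|h| in E1 E2 E3 E4 *; set nk := `|k| in E1 E2 E3 E4 *.
have h0 : 0 <= nh by rewrite /nh.
have k0 : 0 <= nk by rewrite /nk.
move: E1 E2 E3 E4; rewrite !ler_norml => /andP[? ?] /andP[? ?] /andP[? ?] /andP[? ?].
have : K * nh ^+ 3 * P + K * nk ^+ 2 * (nh * P) + K * nk * (nh * (nh * P)) +
   K * nh ^+ 3 * P <= 4 * K * (nh + nk) ^+ 3 * P.
  rewrite -subr_ge0 [X in 0 <= X](_ : _ = K * P * (2 * nh ^+ 3 + 4 * nk ^+ 3
    + 11 * (nh ^+ 2 * nk) + 11 * (nh * nk ^+ 2))); last by ring.
  by rewrite mulr_ge0// !addr_ge0// ?mulr_ge0 ?exprn_ge0.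
have : 0 <= K * nk * (nh * (nh * P)).
  by rewrite !mulr_ge0.
by move=> ? ?; apply/andP; split; lra.
Qed.

(** Serves in place of limits: an identity between derivatives is proved up to O(t) after scaling
    the directions by t, and is then exact. *)
Lemma eq0_of_le_linear (c C d : R) : 0 < d ->
  (forall t : R, 0 < t < d -> `|c| <= C * t) -> c = 0.
Proof.
move=> d0 H; apply/eqP; rewrite -normr_eq0 eq_le normr_ge0 andbT.
rewrite leNgt; apply/negP => c0.
pose t := Num.min (d / 2) (`|c| / (2 * (`|C| + 1))).
have C1 : 0 < `|C| + 1 by rewrite ltr_wpDl.
have t0 : 0 < t by rewrite lt_min !divr_gt0// mulr_gt0.
have td : t < d by rewrite gt_min ltr_pdivrMr// ltr_pMr// ltr1n.
have : `|c| <= `|C| * t.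
  by rewrite (le_trans (H t _)) ?t0 ?td// ler_wpM2r ?ler_norm// ltW.
have tc : t <= `|c| / (2 * (`|C| + 1)) by rewrite ge_min lexx orbT.
move: tc; rewrite ler_pdivlMr ?mulr_gt0// => tc.
have := normr_ge0 C; nra.
Qed.

Lemma jet_room x h k : `|x - x0| < rho -> exists2 d : R, 0 < d &
  forall t : R, 0 < t < d -> [/\ `|x + t *: h - x0| < rho,
    `|x + t *: k - x0| < rho & `|x + t *: k + t *: h - x0| < rho].
Proof.
move=> xr; pose M := `|h| + `|k| + 1.
have M0 : 0 < M by rewrite ltr_wpDl// addr_ge0.
exists ((rho - `|x - x0|) / M); first by rewrite divr_gt0 ?subr_gt0.
move=> t /andP[t0]; rewrite ltr_pdivlMr// => tM.
have small e : `|e| <= M -> `|x + t *: e - x0| < rho.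
  move=> eM; rewrite addrAC (le_lt_trans (ler_normD _ _))//.
  rewrite normrZ gtr0_norm// -ltrBrDl (le_lt_trans _ tM)//.
  by rewrite ler_wpM2l// ltW.
split; [apply: small|apply: small|]; rewrite /M.
- by rewrite -addrA lerDl addr_ge0.
- by rewrite addrAC lerDr addr_ge0.
rewrite -(addrA x) -scalerDr; apply: small.
by rewrite /M addrC (le_trans (ler_normD _ _))// lerDl.
Qed.

(** The second difference is symmetric in its two increments, so for t h and t k the two candidates
    differ by O(t^3), while bilinearity makes their difference t^2 times a constant. *)
Lemma jet_sym x h k s : (size s + 3 <= n)%N -> `|x - x0| < rho -> 0 <= K ->
  D x [:: h, k & s] = D x [:: k, h & s].
Proof.
move=> sn xr K0; apply/eqP; rewrite -subr_eq0; apply/eqP.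
have [d d0 dP] := jet_room h k xr.
apply: (@eq0_of_le_linear _ (8 * K * (`|h| + `|k|) ^+ 3 * nprod s) d) => // t td.
have [t0 _] := andP td; have [xh xk xkh] := dP _ td.
have E1 := jet_second_difference sn xr xh xk xkh K0.
have E2 := @jet_second_difference x (t *: k) (t *: h) s sn xr xk xh _ K0.
rewrite [x + t *: h + _]addrAC in E2; have {}E2 := E2 xkh.
have Z a b : D x [:: t *: a, t *: b & s] = t ^+ 2 * D x [:: a, b & s].
  have -> := @jetZ x [::] [:: t *: b & s] t a xr; last by rewrite /=; lia.
  have -> := @jetZ x [:: a] s t b xr; last by rewrite /=; lia.
  by rewrite mulrA.
move: E1 E2; rewrite !Z !normrZ (gtr0_norm t0) -!mulrDr [`|k| + _]addrC.
rewrite exprMn.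
set A := D (x + _ + _) s; set B1 := D _ s; set B2 := D _ s; set B3 := D x s.
set P := nprod s; set q := (_ + _) ^+ 3 => E1 E2.
rewrite -(ler_pM2l (exprn_gt0 2 t0)) -{1}(gtr0_norm (exprn_gt0 2 t0)) -normrM.
move: E1 E2; rewrite !ler_norml => /andP[? ?] /andP[? ?].
by apply/andP; split; lra.
Qed.

(** [jet_sym] exchanges the first two slots only. The exchange of the next two is obtained by
    applying it at [x] and at [x + t *: h] and taking the difference quotient in direction h. *)
Lemma jet_symS x h k l s : (size s + 4 <= n)%N -> `|x - x0| < rho -> 0 <= K ->
  D x [:: h, k, l & s] = D x [:: h, l, k & s].
Proof.
move=> sn xr K0; apply/eqP; rewrite -subr_eq0; apply/eqP.
have [d d0 dP] := jet_room h 0 xr.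
apply: (@eq0_of_le_linear _ (2 * K * `|h| ^+ 2 * nprod [:: k, l & s]) d) => // t td.
have [t0 _] := andP td; have [xh _ _] := dP _ td.
have E1 := @jet_taylor2 x (t *: h) [:: k, l & s] _ xr xh.
have E2 := @jet_taylor2 x (t *: h) [:: l, k & s] _ xr xh.
have {}E1 := E1 ltac:(by move: sn; rewrite /=; lia).
have {}E2 := E2 ltac:(by move: sn; rewrite /=; lia).
have Z b s' : (size s' < n)%N -> D x [:: t *: b & s'] = t * D x (b :: s').
  by move=> s'n; apply: (@jetZ x [::] s' t b).
have S3 : (size s + 3 <= n)%N by lia.
rewrite (jet_sym l k S3 xr K0) (jet_sym l k S3 xh K0) in E2.
rewrite -(ler_pM2l t0) -{1}(gtr0_norm t0) -normrM.
move: E1 E2; rewrite !Z /=; try lia.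
rewrite !nprod_cons normrZ (gtr0_norm t0) [`|l| * (`|k| * _)]mulrCA exprMn.
rewrite !ler_norml => /andP[? ?] /andP[? ?].
by apply/andP; split; lra.
Qed.
End jet_theory.

(** * Taylor expansions along curves known up to cubic order *)

Section jet_curves.
Variables (R : realType) (E : normedModType R) (n : nat) (x0 : E).
Variables (rho K : R) (D : E -> seq E -> R).
Hypothesis JD : jet n x0 rho K D.
Implicit Types (x h : E) (s : seq E).

Lemma jet_le1 x a s (al : R) : 0 <= K -> `|x - x0| < rho ->
  (size s < n)%N -> `|a| <= al -> `|D x (a :: s)| <= K * al * nprod s.
Proof.
move=> K0 xr sn aal; apply: (le_trans (jet_bound JD xr _)) => //.
by rewrite nprod_cons mulrA ler_wpM2r ?nprod_ge0// ler_wpM2l.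
Qed.

Lemma jet_le2 x a b s (al be : R) : 0 <= K -> `|x - x0| < rho ->
  (size s + 2 <= n)%N -> `|a| <= al -> `|b| <= be ->
  `|D x [:: a, b & s]| <= K * (al * be) * nprod s.
Proof.
move=> K0 xr sn aal bbe; apply: (le_trans (jet_bound JD xr _)) => //=.
  by move: sn; rewrite addn2.
rewrite !nprod_cons !mulrA ler_wpM2r ?nprod_ge0//.
by rewrite -!mulrA ler_wpM2l// ler_pM.
Qed.

Lemma jet_le3 x a b c s (al be ga : R) : 0 <= K -> `|x - x0| < rho ->
  (size s + 3 <= n)%N -> `|a| <= al -> `|b| <= be -> `|c| <= ga ->
  `|D x [:: a, b, c & s]| <= K * (al * be * ga) * nprod s.
Proof.
move=> K0 xr sn aal bbe cga; apply: (le_trans (jet_bound JD xr _)) => //=.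
  by move: sn; rewrite addn3.
rewrite !nprod_cons !mulrA ler_wpM2r ?nprod_ge0//.
by rewrite -!mulrA ler_wpM2l// ler_pM ?mulr_ge0// ler_pM.
Qed.

Lemma jet_head x a u v s : `|x - x0| < rho -> (size s < n)%N ->
  D x ((a *: u + v) :: s) = a * D x (u :: s) + D x (v :: s).
Proof. by move=> xr sn; apply: (jet_linear JD (s1 := [::])). Qed.

Lemma jet_head2 x a u v b s : `|x - x0| < rho -> (size s + 2 <= n)%N ->
  D x [:: b, a *: u + v & s] = a * D x [:: b, u & s] + D x [:: b, v & s].
Proof.
by move=> xr sn; apply: (jet_linear JD (s1 := [:: b])) => //=; move: sn; lia.
Qed.

Lemma jet_head3 x a u v b c s : `|x - x0| < rho -> (size s + 3 <= n)%N ->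
  D x [:: b, c, a *: u + v & s]
    = a * D x [:: b, c, u & s] + D x [:: b, c, v & s].
Proof.
by move=> xr sn; apply: (jet_linear JD (s1 := [:: b; c])) => //=; move: sn; lia.
Qed.

Lemma jet_sq x a u v s : `|x - x0| < rho -> (size s + 2 <= n)%N ->
  D x [:: a *: u + v, a *: u + v & s] = a ^+ 2 * D x [:: u, u & s]
    + a * (D x [:: u, v & s] + D x [:: v, u & s]) + D x [:: v, v & s].
Proof.
move=> xr sn; rewrite jet_head//; last by move: sn; rewrite /=; lia.
by rewrite !jet_head2//; ring.
Qed.

Lemma jet_cube x a u v s : `|x - x0| < rho -> (size s + 3 <= n)%N ->
  D x [:: a *: u + v, a *: u + v, a *: u + v & s] = a ^+ 3 * D x [:: u, u, u & s]
    + a ^+ 2 * (D x [:: u, u, v & s] + D x [:: u, v, u & s] + D x [:: v, u, u & s])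
    + a * (D x [:: u, v, v & s] + D x [:: v, u, v & s] + D x [:: v, v, u & s])
    + D x [:: v, v, v & s].
Proof.
move=> xr sn; have s2 b : (size (b :: s) + 2 <= n)%N by move: sn; rewrite /=; lia.
rewrite jet_head//; last by move: sn; rewrite /=; lia.
by rewrite !jet_head2// !jet_head3//; ring.
Qed.

Variables (x h1 h2 d : E) (s : seq E) (B tau : R).
Hypotheses (K0 : 0 <= K) (xr : `|x - x0| < rho) (B1 : 1 <= B).
Hypotheses (h1B : `|h1| <= B) (h2B : `|h2| <= B) (tau1 : `|tau| <= 1).
Hypothesis dB : `|d| <= B * `|tau| ^+ 3.
Let h := tau *: h1 + (tau ^+ 2 *: h2 + d).
Hypothesis xhr : `|x + h - x0| < rho.

Let e := tau ^+ 2 *: h2 + d.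
Let t := `|tau|.
Let P := nprod s.
Let t0 : 0 <= t. Proof. by rewrite /t. Qed.
Let P0 : 0 <= P. Proof. exact: nprod_ge0. Qed.
Let KP0 : 0 <= K * P. Proof. by rewrite mulr_ge0. Qed.
Let B0 : 0 <= B. Proof. by move: B1; lra. Qed.
Let tauX k : `|tau ^+ k| = t ^+ k. Proof. by rewrite normrX. Qed.
Let t32 : t ^+ 3 <= t ^+ 2.
Proof. by rewrite exprS ler_piMl// exprn_ge0. Qed.
Let t43 : t ^+ 4 <= t ^+ 3.
Proof. by rewrite (exprS _ 3) ler_piMl// exprn_ge0. Qed.
Let t21 : t ^+ 2 <= t.
Proof. by rewrite expr2 ler_piMl. Qed.

Let eB : `|e| <= 2 * B * t ^+ 2.
Proof.
apply: (le_trans (ler_normD _ _)); rewrite normrZ tauX.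
have := ler_wpM2l (exprn_ge0 2 t0) h2B; have := dB; have := ler_wpM2l B0 t32.
rewrite -/t; lra.
Qed.

Let hB : `|h| <= 3 * B * t.
Proof.
apply: (le_trans (ler_normD _ _)); rewrite normrZ -/t.
have := ler_wpM2l t0 h1B; have := eB; have := ler_wpM2l B0 t21.
rewrite /e; lra.
Qed.

(** The curve is x + tau h1 + tau^2 h2 + d with d of cubic size, so d contributes to the error only.
    tau may be negative, hence the powers of t = |tau| in the bound. *)
Lemma jet_curve3 : (size s + 3 <= n)%N ->
  `|D (x + h) s - (D x s + tau * D x (h1 :: s)
      + tau ^+ 2 * (D x (h2 :: s) + 2^-1 * D x [:: h1, h1 & s]))|
    <= 32 * K * B ^+ 3 * t ^+ 3 * nprod s.
Proof.
move=> sn; have := jet_taylor3 JD sn xr xhr.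
have s1 : (size s < n)%N by move: sn; clear; lia.
have s2 : (size s + 2 <= n)%N by move: sn; clear; lia.
have s2' v : (size (v :: s) < n)%N by rewrite /=; move: sn; clear; lia.
have H1 : D x (h :: s) = tau * D x (h1 :: s)
    + (tau ^+ 2 * D x (h2 :: s) + D x (d :: s)) by rewrite /h !jet_head.
have H2 : D x [:: h, h & s] = tau ^+ 2 * D x [:: h1, h1 & s]
    + tau * (D x [:: h1, e & s] + D x [:: e, h1 & s]) + D x [:: e, e & s].
  by rewrite /h jet_sq.
rewrite H1 H2 -/P => E1.
have E2 := jet_le1 K0 xr s1 dB; rewrite -/t -/P in E2.
have E3 := jet_le2 K0 xr s2 h1B eB; rewrite -/P in E3.
have E4 := jet_le2 K0 xr s2 eB h1B; rewrite -/P in E4.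
have E5 := jet_le2 K0 xr s2 eB eB; rewrite -/P in E5.
have E6 : `|tau * D x [:: h1, e & s]| <= K * P * (2 * B ^+ 2 * t ^+ 3).
  rewrite normrM -/t (le_trans (ler_wpM2l t0 E3))//.
  by rewrite le_eqVlt; apply/orP; left; apply/eqP; ring.
have E7 : `|tau * D x [:: e, h1 & s]| <= K * P * (2 * B ^+ 2 * t ^+ 3).
  rewrite normrM -/t (le_trans (ler_wpM2l t0 E4))//.
  by rewrite le_eqVlt; apply/orP; left; apply/eqP; ring.
have E8 : `|D x [:: e, e & s]| <= K * P * (4 * B ^+ 2 * t ^+ 3).
  apply: (le_trans E5); rewrite [leLHS](_ : _ = K * P * (4 * B ^+ 2 * t ^+ 4)); last by ring.
  by rewrite ler_wpM2l// ler_wpM2l// mulr_ge0// exprn_ge0.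
have E9 : K * `|h| ^+ 3 * P <= K * P * (27 * B ^+ 3 * t ^+ 3).
  rewrite mulrAC ler_wpM2l// [leRHS](_ : _ = (3 * B * t) ^+ 3); last by ring.
  by rewrite lerXn2r ?nnegrE ?mulr_ge0.
have b23 : K * P * (B ^+ 2 * t ^+ 3) <= K * P * (B ^+ 3 * t ^+ 3).
  by rewrite ler_wpM2l// ler_wpM2r ?exprn_ge0// [leRHS]exprS ler_peMl ?exprn_ge0.
have b13 : K * P * (B * t ^+ 3) <= K * P * (B ^+ 2 * t ^+ 3).
  by rewrite ler_wpM2l// ler_wpM2r ?exprn_ge0// expr2 ler_peMl.
(* 27 comes from the Taylor remainder with |h| <= 3 B t, 1 from d, 2 from the mixed quadratic terms
   and 2 from the quadratic term in e alone. *)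
rewrite [leRHS](_ : _ = 32 * (K * P * (B ^+ 3 * t ^+ 3))); last by ring.
have {}E1 := le_trans E1 E9.
move: E1 E2 E6 E7 E8; rewrite !ler_norml.
by move=> /andP[? ?] /andP[? ?] /andP[? ?] /andP[? ?] /andP[? ?]; apply/andP; split; lra.
Qed.

(** At this order [D x (d :: s)] is of the same size as the cubic coefficient and has to be kept: d
    later carries the unknown error of a solution or of a field value. *)
Lemma jet_curve4 : (size s + 4 <= n)%N ->
  `|D (x + h) s - (D x s + tau * D x (h1 :: s)
      + tau ^+ 2 * (D x (h2 :: s) + 2^-1 * D x [:: h1, h1 & s]) + D x (d :: s)
      + tau ^+ 3 * (2^-1 * (D x [:: h1, h2 & s] + D x [:: h2, h1 & s])
                    + 6^-1 * D x [:: h1, h1, h1 & s]))|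
    <= 90 * K * B ^+ 4 * t ^+ 4 * nprod s.
Proof.
move=> sn; have := jet_taylor4 JD sn xr xhr.
have s1 : (size s < n)%N by move: sn; clear; lia.
have s2 : (size s + 2 <= n)%N by move: sn; clear; lia.
have s3 : (size s + 3 <= n)%N by move: sn; clear; lia.
have s2' v : (size (v :: s) < n)%N by rewrite /=; move: sn; clear; lia.
have s3' v w : (size [:: v, w & s] < n)%N by rewrite /=; move: sn; clear; lia.
have s4' v : (size (v :: s) + 2 <= n)%N by rewrite /=; move: sn; clear; lia.
have H1 : D x (h :: s) = tau * D x (h1 :: s)
    + (tau ^+ 2 * D x (h2 :: s) + D x (d :: s)) by rewrite /h !jet_head.
have H2 : D x [:: h, h & s] = tau ^+ 2 * D x [:: h1, h1 & s]
    + tau * (tau ^+ 2 * D x [:: h1, h2 & s] + D x [:: h1, d & s]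
       + (tau ^+ 2 * D x [:: h2, h1 & s] + D x [:: d, h1 & s]))
    + D x [:: e, e & s].
  by rewrite /h jet_sq// jet_head2// [D x [:: _ + _, h1 & s]]jet_head.
have H3 : D x [:: h, h, h & s] = tau ^+ 3 * D x [:: h1, h1, h1 & s]
    + tau ^+ 2 * (D x [:: h1, h1, e & s] + D x [:: h1, e, h1 & s] + D x [:: e, h1, h1 & s])
    + tau * (D x [:: h1, e, e & s] + D x [:: e, h1, e & s] + D x [:: e, e, h1 & s])
    + D x [:: e, e, e & s] by rewrite /h jet_cube.
rewrite H1 H2 H3 -/P => E1.

have bt (u : R) (k : nat) (c : R) : `|u| <= c -> `|tau ^+ k * u| <= t ^+ k * c.
  by move=> uc; rewrite normrM tauX ler_wpM2l// exprn_ge0.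
have F1 := bt _ 1%N _ (jet_le2 K0 xr s2 h1B dB).
have F2 := bt _ 1%N _ (jet_le2 K0 xr s2 dB h1B).
have F3 := jet_le2 K0 xr s2 eB eB.
have F4 := bt _ 2%N _ (jet_le3 K0 xr s3 h1B h1B eB).
have F5 := bt _ 2%N _ (jet_le3 K0 xr s3 h1B eB h1B).
have F6 := bt _ 2%N _ (jet_le3 K0 xr s3 eB h1B h1B).
have F7 := bt _ 1%N _ (jet_le3 K0 xr s3 h1B eB eB).
have F8 := bt _ 1%N _ (jet_le3 K0 xr s3 eB h1B eB).
have F9 := bt _ 1%N _ (jet_le3 K0 xr s3 eB eB h1B).
have F10 := jet_le3 K0 xr s3 eB eB eB.
rewrite -/P -/t !expr1 in F1 F2 F3 F4 F5 F6 F7 F8 F9 F10.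
have t54 : t ^+ 5 <= t ^+ 4 by rewrite (exprS _ 4) ler_piMl// exprn_ge0.
have t65 : t ^+ 6 <= t ^+ 5 by rewrite (exprS _ 5) ler_piMl// exprn_ge0.
have B23 : B ^+ 2 <= B ^+ 3 by rewrite [leRHS]exprS ler_peMl ?exprn_ge0.
have B34 : B ^+ 3 <= B ^+ 4 by rewrite [leRHS]exprS ler_peMl ?exprn_ge0.
have E9 : K * `|h| ^+ 4 * P <= 81 * (K * P * (B ^+ 4 * t ^+ 4)).
  rewrite mulrAC [leRHS](_ : _ = K * P * (3 * B * t) ^+ 4); last by ring.
  by rewrite ler_wpM2l// lerXn2r ?nnegrE ?mulr_ge0.
pose Q := K * P * (B ^+ 4 * t ^+ 4).
have q (i j : nat) : B ^+ i <= B ^+ 4 -> t ^+ j <= t ^+ 4 ->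
    K * P * (B ^+ i * t ^+ j) <= Q.
  by move=> Bi tj; rewrite ler_wpM2l// ler_pM ?exprn_ge0.
have q24 := q 2%N 4%N (le_trans B23 B34) (lexx _).
have q34 := q 3%N 4%N B34 (lexx _).
have q35 := q 3%N 5%N B34 t54.
have q36 := q 3%N 6%N B34 (le_trans t65 t54).
have G1 : t * (K * (B * (B * t ^+ 3)) * P) <= Q by apply: le_trans q24; lra.
have G2 : t * (K * (B * t ^+ 3 * B) * P) <= Q by apply: le_trans q24; lra.
have G3 : K * (2 * B * t ^+ 2 * (2 * B * t ^+ 2)) * P <= 4 * Q.
  rewrite [leLHS](_ : _ = 4 * (K * P * (B ^+ 2 * t ^+ 4))); last by ring.
  by rewrite ler_wpM2l.
have G4 : t ^+ 2 * (K * (B * B * (2 * B * t ^+ 2)) * P) <= 2 * Q.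
  rewrite [leLHS](_ : _ = 2 * (K * P * (B ^+ 3 * t ^+ 4))); last by ring.
  by rewrite ler_wpM2l.
have G5 : t ^+ 2 * (K * (B * (2 * B * t ^+ 2) * B) * P) <= 2 * Q.
  by apply: le_trans G4; lra.
have G6 : t ^+ 2 * (K * (2 * B * t ^+ 2 * B * B) * P) <= 2 * Q.
  by apply: le_trans G4; lra.
have G7 : t * (K * (B * (2 * B * t ^+ 2) * (2 * B * t ^+ 2)) * P) <= 4 * Q.
  rewrite [leLHS](_ : _ = 4 * (K * P * (B ^+ 3 * t ^+ 5))); last by ring.
  by rewrite ler_wpM2l.
have G8 : t * (K * (2 * B * t ^+ 2 * B * (2 * B * t ^+ 2)) * P) <= 4 * Q.
  by apply: le_trans G7; lra.
have G9 : t * (K * (2 * B * t ^+ 2 * (2 * B * t ^+ 2) * B) * P) <= 4 * Q.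
  by apply: le_trans G7; lra.
have G10 : K * (2 * B * t ^+ 2 * (2 * B * t ^+ 2) * (2 * B * t ^+ 2)) * P
    <= 8 * Q.
  rewrite [leLHS](_ : _ = 8 * (K * P * (B ^+ 3 * t ^+ 6))); last by ring.
  by rewrite ler_wpM2l.
(* 81 of the 90 is the Taylor remainder; the mixed terms, with the weights 1/2 and 1/6, add less
   than 9. *)
rewrite [leRHS](_ : _ = 90 * Q); last by rewrite /Q -/P; ring.
have {}E1 := le_trans E1 E9; rewrite -/Q in E1.
have {F1 G1} := le_trans F1 G1; have {F2 G2} := le_trans F2 G2.
have {F3 G3} := le_trans F3 G3; have {F4 G4} := le_trans F4 G4.
have {F5 G5} := le_trans F5 G5; have {F6 G6} := le_trans F6 G6.
have {F7 G7} := le_trans F7 G7; have {F8 G8} := le_trans F8 G8.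
have {F9 G9} := le_trans F9 G9; have {F10 G10} := le_trans F10 G10.
clear -E1; move: E1; rewrite !ler_norml.
do 11 move=> /andP[? ?].
by apply/andP; split; lra.
Qed.
End jet_curves.

(** * From Frechet derivatives to scalar jets *)

Record frechet_jet (R : realType) (E F : normedModType R) (n : nat) (x0 : E)
    (rho K : R) (D : E -> seq E -> F) : Prop := FrechetJet {
  fjet_linear : forall x (s1 s2 : seq E) (a : R) (u v : E),
    `|x - x0| < rho -> (size s1 + size s2 < n)%N ->
    D x (s1 ++ (a *: u + v) :: s2)
      = a *: D x (s1 ++ u :: s2) + D x (s1 ++ v :: s2);
  fjet_bound : forall x s, `|x - x0| < rho -> (size s <= n)%N ->
    `|D x s| <= K * nprod s;
  fjet_diff : forall x s, `|x - x0| < rho -> (size s < n)%N ->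
    forall e : R, 0 < e -> \forall x' \near x,
      `|D x' s - D x s - D x ((x' - x) :: s)| <= e * `|x' - x| }.

Section frechet_jet_theory.
Variables (R : realType) (E F : normedModType R).

Lemma near_norm_lt (x0 : E) (rho : R) (x : E) : `|x - x0| < rho ->
  \forall x' \near x, `|x' - x0| < rho.
Proof.
move=> xr; apply/nbhs_ballP; exists (rho - `|x - x0|); rewrite /= ?subr_gt0//.
move=> x'; rewrite -ball_normE /= ltrBrDl => H.
by rewrite -(subrK x x') -addrA addrC (le_lt_trans (ler_normD _ _))// (distrC x').
Qed.

(** At an interior point the derivatives relative to A are ordinary ones on a ball. The uniform
    bound K comes from differentiability of [D] at x0 below the top order, and from continuity of
    [D] at the top order, where no further derivative is at hand. *)
Lemma Cn_on_frechet_jet (m : nat) (A : set E) (f : E -> F) (x0 : E) :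
  Cn_on m A f -> A° x0 -> exists (D : E -> seq E -> F) (rho K : R),
  [/\ 0 < rho, 0 <= K, forall x, `|x - x0| < rho -> A x,
      forall x, `|x - x0| < rho -> D x [::] = f x &
      frechet_jet m x0 rho K D].
Proof.
move=> [D [D0 Dlin Ddiff Dcont]] Ax0.
have Ax : A x0 by exact: interior_subset.
have [d0 /= d0_gt0 d0A] : exists2 d : R, 0 < d & forall x, `|x - x0| < d -> A x.
  move/nbhs_ballP: Ax0 => [d /= d0 dA]; exists d => // x xd.
  by apply: dA; rewrite -ball_normE /= distrC.
have nearA : \forall x \near x0, A x.
  have /near_norm_lt : `|x0 - x0| < d0 by rewrite subrr normr0.
  by apply: filterS => x; exact: d0A.
have bnd k : (k <= m)%N -> exists2 C : R, 0 <= C &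
    forall s : seq E, size s = k -> `|D x0 s| <= C * nprod s.
  move=> km; have [_ [C HC]] := Dlin x0 k Ax km; exists `|C| => // s sk.
  by rewrite (le_trans (HC s sk))// ler_wpM2r ?nprod_ge0// ler_norm.
have loc k : (k <= m)%N -> exists2 C : R, 0 <= C & \forall x \near x0,
    forall s : seq E, size s = k -> `|D x s| <= C * nprod s.
  rewrite leq_eqVlt => /orP[/eqP km|km].
    have km' : (k <= m)%N by rewrite km.
    have [C C0 HC] := bnd k km'.
    exists (C + 1); first by rewrite addr_ge0.
    have := Dcont x0 Ax 1 ltr01; rewrite -km => H.
    near=> x => s sk.
    have /(_ _ s sk) : A x -> forall s : seq E, size s = k ->
      `|D x s - D x0 s| <= 1 * \prod_(h <- s) `|h| by near: x.
    rewrite mul1r -/(nprod s) => Hs.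
    rewrite -(subrK (D x0 s) (D x s)) (le_trans (ler_normD _ _))// mulrDl mul1r.
    rewrite addrC lerD ?HC ?Hs//; near: x; exact: nearA.
  have [C C0 HC] := bnd k (ltnW km); have [C' C'0 HC'] := bnd k.+1 km.
  exists (C + C' + 1); first by rewrite !addr_ge0.
  have H := Ddiff x0 k Ax km 1 ltr01.
  have x1 : \forall x \near x0, `|x - x0| < 1 by apply: near_norm_lt; rewrite subrr normr0.
  near=> x => s sk.
  have /(_ _ s sk) : A x -> forall s : seq E, size s = k ->
    `|D x s - D x0 s - D x0 ((x - x0) :: s)| <= 1 * `|x - x0| * \prod_(h <- s) `|h| by near: x.
  have Axx : A x by near: x.
  move=> /(_ Axx); rewrite mul1r -/(nprod s) => Hs.
  have xx1 : `|x - x0| < 1 by near: x.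
  have H1 := HC s sk.
  have H2 : `|D x0 ((x - x0) :: s)| <= C' * nprod s.
    rewrite (le_trans (HC' _ _))//= ?sk// nprod_cons ler_wpM2l//.
    by rewrite ler_piMl ?nprod_ge0// ltW.
  have H3 : `|D x s - D x0 s - D x0 ((x - x0) :: s)| <= nprod s.
    by rewrite (le_trans Hs)// ler_piMl ?nprod_ge0// ltW.
  rewrite -(subrK (D x0 s) (D x s)) -(subrK (D x0 ((x - x0) :: s)) (D x s - _)).
  rewrite !mulrDl mul1r addrC [leRHS]addrC [C * _ + _]addrC addrA.
  rewrite [X in _ <= X](_ : _ = C * nprod s + (nprod s + C' * nprod s)); last by ring.
  rewrite (le_trans (ler_normD _ _))// lerD// (le_trans (ler_normD _ _))// lerD//.
have [K K0 HK] : exists2 K : R, 0 <= K & \forall x \near x0,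
    forall s : seq E, (size s <= m)%N -> `|D x s| <= K * nprod s.
  suff H j : (j <= m)%N -> exists2 K : R, 0 <= K & \forall x \near x0,
    forall s : seq E, (size s <= j)%N -> `|D x s| <= K * nprod s by exact: H.
  elim: j => [|j IH] jm.
    have [C C0 HC] := loc 0%N jm; exists C => //.
    by apply: filterS HC => x H s; rewrite leqn0 => /eqP; exact: H.
  have [K K0 HK] := IH (ltnW jm); have [C C0 HC] := loc j.+1 jm.
  exists (K + C); first by rewrite addr_ge0.
  apply: filterS2 HK HC => x H1 H2 s; rewrite leq_eqVlt => /orP[/eqP|] sj.
    by rewrite (le_trans (H2 s sj))// ler_wpM2r ?nprod_ge0// lerDr.
  by rewrite (le_trans (H1 s sj))// ler_wpM2r ?nprod_ge0// lerDl.
move/nbhs_ballP: HK => [r /= r0 rK].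
have HK x : `|x - x0| < r -> forall s : seq E, (size s <= m)%N -> `|D x s| <= K * nprod s.
  by move=> xr; apply: rK; rewrite -ball_normE /= distrC.
exists D, (Num.min d0 r), K; split => //; first by rewrite lt_min d0_gt0.
- by move=> x; rewrite lt_min => /andP[/d0A].
- by move=> x; rewrite lt_min => /andP[/d0A /D0].
split.
- move=> x s1 s2 a u v; rewrite lt_min => /andP[/d0A xA _] sm.
  by have [H _] := Dlin x _ xA sm; exact: H.
- by move=> x s; rewrite lt_min => /andP[_ xr] sm; exact: HK.
move=> x s xr sm e e0.
have xA : A x by apply: d0A; move: xr; rewrite lt_min => /andP[].
have e1 : 0 < e / (nprod s + 1) by rewrite divr_gt0// ltr_wpDl// nprod_ge0.
have H := Ddiff x _ xA sm _ e1; near=> x'.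
have Ax' : A x'.
  apply: d0A; near: x'; apply: near_norm_lt.
  by move: xr; rewrite lt_min => /andP[].
have /(_ Ax' s erefl) : A x' -> forall s' : seq E, size s' = size s ->
  `|D x' s' - D x s' - D x ((x' - x) :: s')| <= e / (nprod s + 1) * `|x' - x| * \prod_(h <- s') `|h|.
  by near: x'.
move=> H'; apply: (le_trans H'); rewrite -/(nprod s) mulrAC ler_wpM2r//.
rewrite mulrAC ler_pdivrMr ?ltr_wpDl ?nprod_ge0//.
by rewrite ler_wpM2l ?lerDl// ltW.
Unshelve. all: by end_near. Qed.

(** Composition with a bounded linear form brings vector-valued derivatives under the scalar Taylor
    estimates; [l] will be the identity of R or testing against the metric. *)
Lemma jet_of_frechet (n : nat) (x0 : E) (rho K c : R) (D : E -> seq E -> F)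
    (l : F -> R) :
  frechet_jet n x0 rho K D -> 0 <= c ->
  (forall a u v, l (a *: u + v) = a * l u + l v) ->
  (forall u, `|l u| <= c * `|u|) ->
  jet n x0 rho (K * c) (fun x s => l (D x s)).
Proof.
move=> JD c0 ll lc.
have l0 : l 0 = 0.
  have := ll 1 0 0; rewrite scale1r mul1r addr0 => /eqP.
  by rewrite -subr_eq subrr => /eqP <-.
have lB u v : l (u - v) = l u - l v.
  by rewrite addrC -scaleN1r ll mulN1r addrC.
split.
- by move=> x s1 s2 a u v xr sn; rewrite (fjet_linear JD)// ll.
- move=> x s xr sn; rewrite (le_trans (lc _))// mulrAC mulrC.
  by rewrite ler_wpM2r// (fjet_bound JD).
move=> x h s t xr sn.
apply: (@is_derive_frechet R E R^o (fun x => l (D x s)) x h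
  (fun k => l (D (x + t *: h) (k :: s))) t); last first.
  move=> a /=; have := fjet_linear JD (s1 := [::]) (s2 := s) a h 0 xr sn.
  rewrite /= addr0 => ->.
  have := fjet_linear JD (s1 := [::]) (s2 := s) 1 0 0 xr sn.
  rewrite /= scaler0 addr0 scale1r => /eqP; rewrite -subr_eq subrr => /eqP <-.
  by rewrite ll l0 addr0.
move=> e e0; have c1 : 0 < c + 1 by rewrite ltr_wpDl.
have := fjet_diff JD xr sn (divr_gt0 e0 c1).
apply: filterS => x' H; rewrite -!lB (le_trans (lc _))//.
rewrite (le_trans (ler_wpM2l c0 H))// mulrA ler_wpM2r// mulrA ler_pdivrMr//.
by rewrite mulrC ler_wpM2l ?lerDl// ltW.
Qed.
End frechet_jet_theory.

(** * Coercive forms *)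

Record metric_form (R : realType) (V : normedModType R) (c C : R)
    (G : V -> V -> R) : Prop := MetricForm {
  mform_c0 : 0 < c;
  mform_C0 : 0 < C;
  mform_sym : forall u v, G u v = G v u;
  mform_lin : forall a u v w, G (a *: u + v) w = a * G u w + G v w;
  mform_coer : forall v, c * `|v| ^+ 2 <= G v v;
  mform_bound : forall v, G v v <= C * `|v| ^+ 2 }.

Section mform_theory.
Variables (R : realType) (V : completeNormedModType R) (c C : R).
Variables (G : V -> V -> R).
Hypothesis FG : metric_form c C G.

Lemma mformDl u v w : G (u + v) w = G u w + G v w.
Proof. by have := mform_lin FG 1 u v w; rewrite scale1r mul1r. Qed.

Lemma mform0l w : G 0 w = 0.
Proof.
have := mformDl 0 0 w; rewrite addr0 => /eqP.
by rewrite -subr_eq subrr => /eqP <-.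
Qed.

Lemma mformZl a u w : G (a *: u) w = a * G u w.
Proof. by have := mform_lin FG a u 0 w; rewrite addr0 mform0l addr0. Qed.

Lemma mformBl u v w : G (u - v) w = G u w - G v w.
Proof. by rewrite mformDl -scaleN1r mformZl mulN1r. Qed.

Lemma mformDr u v w : G w (u + v) = G w u + G w v.
Proof. by rewrite !(mform_sym FG w) mformDl. Qed.

Lemma mformZr a u w : G w (a *: u) = a * G w u.
Proof. by rewrite !(mform_sym FG w) mformZl. Qed.

Lemma mformBr u v w : G w (u - v) = G w u - G w v.
Proof. by rewrite !(mform_sym FG w) mformBl. Qed.

Lemma mform_ge0 v : 0 <= G v v.
Proof.
by rewrite (le_trans _ (mform_coer FG v))// mulr_ge0 ?exprn_ge0// ltW ?(mform_c0 FG).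
Qed.

Lemma mform_eq0 v : G v v <= 0 -> v = 0.
Proof.
move=> v0; have := le_trans (mform_coer FG v) v0.
rewrite pmulr_rle0 ?(mform_c0 FG)// => v2; apply/normr0_eq0/eqP.
by rewrite -sqrf_eq0 eq_le v2 sqr_ge0.
Qed.

Lemma mform_CS u v : G u v ^+ 2 <= G u u * G v v.
Proof.
have [v0|v0] := leP (G v v) 0.
  rewrite (mform_eq0 v0) (mform_sym FG u) !mform0l expr0n mulr0 //.
have := mform_ge0 (G v v *: u - G u v *: v).
rewrite mformBl !mformBr !mformZl !mformZr (mform_sym FG v u).
rewrite [X in 0 <= X](_ : _ = G v v * (G u u * G v v - G u v ^+ 2)); last by ring.
by rewrite pmulr_rge0// subr_ge0.
Qed.

Lemma mform_le_norm u v : `|G u v| <= C * `|u| * `|v|.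
Proof.
have C0 := ltW (mform_C0 FG).
rewrite -(@ler_pXn2r _ 2)// ?nnegrE ?mulr_ge0// real_normK ?num_real//.
rewrite (le_trans (mform_CS u v))//.
rewrite [leRHS](_ : _ = (C * `|u| ^+ 2) * (C * `|v| ^+ 2)); last by ring.
by rewrite ler_pM ?mform_ge0// (mform_bound FG).
Qed.

(** Coercivity with [r = x]. This is how estimates of linear forms become estimates of vectors, at
    the price of a factor 1 / c. *)
Lemma mform_norm_le x eta : 0 <= eta -> (forall r, `|G x r| <= eta * `|r|) ->
  `|x| <= eta / c.
Proof.
move=> eta0 H; rewrite ler_pdivlMr ?(mform_c0 FG)//.
have [->|x0] := eqVneq x 0; first by rewrite normr0 mul0r.
have := le_trans (mform_coer FG x) (le_trans (ler_norm _) (H x)).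
by rewrite expr2 mulrA ler_pM2r ?normr_gt0// mulrC.
Qed.

Lemma mform_inj x x' : (forall r, G x r = G x' r) -> x = x'.
Proof.
move=> H; apply/eqP; rewrite -subr_eq0; apply/eqP; apply: mform_eq0.
by rewrite mformBl H subrr.
Qed.

(** Direct method: the representative is the limit of a minimising sequence of [J], which converges
    because G is equivalent to the squared norm and V is complete. *)
Lemma mform_riesz (l : V -> R) (eta : R) :
  (forall a u v, l (a *: u + v) = a * l u + l v) ->
  (forall r, `|l r| <= eta * `|r|) -> exists x, forall r, G x r = l r.
Proof.
move=> ll lb.
have c0 := mform_c0 FG; have C0 := mform_C0 FG.
have lD u v : l (u + v) = l u + l v by have := ll 1 u v; rewrite scale1r mul1r.
have l0 : l 0 = 0.
  by have := lD 0 0; rewrite addr0 => /eqP; rewrite -subr_eq subrr => /eqP <-.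
have lZ a u : l (a *: u) = a * l u by have := ll a u 0; rewrite addr0 l0 addr0.
pose J x := G x x - 2 * l x.
pose S := [set J x | x in [set: V]].
(* Completing the square in c |x|^2 - 2 eta |x|. *)
have Slb : lbound S (- (eta ^+ 2 / c)).
  move=> _ [x _ <-]; rewrite -(ler_pM2l c0) mulrN mulrCA divff ?gt_eqF// mulr1 /J.
  have H1 := ler_wpM2l (ltW c0) (mform_coer FG x).
  have H2 := ler_wpM2l (ltW c0) (le_trans (ler_norm _) (lb x)).
  have H3 : 0 <= (eta - c * `|x|) ^+ 2 by rewrite sqr_ge0.
  by move: H1 H2 H3; clear; lra.
have Sinf : has_inf S.
  by split; [exists (J 0); exists 0|exists (- (eta ^+ 2 / c))].
pose m := inf S.
have Jm x : m <= J x by apply: ge_inf; [exact: Sinf.2|exists x].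
have /choice[u uP] : forall n : nat, exists x, J x < m + n.+1%:R^-1.
  move=> n; have n0 : 0 < n.+1%:R^-1 :> R by rewrite invr_gt0.
  by have [_ [x _ <-] H] := inf_adherent n0 Sinf; exists x.
(* By the parallelogram identity, minimising sequences of J are Cauchy. *)
have para x x' : c * `|x - x'| ^+ 2 <= 2 * (J x - m) + 2 * (J x' - m).
  apply: (le_trans (mform_coer FG _)).
  have := Jm (2^-1 *: (x + x')).
  rewrite /J lZ lD mformZl mformZr mformBl !mformBr !mformDl !mformDr.
  by rewrite (mform_sym FG x' x); clear; lra.
have ucvg : cvgn u.
  apply/cauchy_cvgP/cauchy_ballP => e; move: (e : R) => {}e e0; near_simpl.
  have e1 : 0 < c * e ^+ 2 / 4 by rewrite divr_gt0// mulr_gt0// exprn_gt0.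
  have small : \forall n \near \oo, n.+1%:R^-1 < c * e ^+ 2 / 4 :> R.
    exact: near_infty_natSinv_lt (PosNum e1).
  have [N _ HN] := small.
  exists ([set n | (N <= n)%N], [set n | (N <= n)%N]); first by split; exists N.
  move=> [a b] [/= /HN Na /HN Nb]; rewrite -ball_normE /=.
  rewrite -(@ltr_pXn2r _ 2)// ?nnegrE// ?ltW// -(ltr_pM2l c0).
  apply: (le_lt_trans (para _ _)).
  have gen (A B i j k q : R) : A < q / 4 -> B < q / 4 -> i < k + A -> j < k + B ->
    2 * (i - k) + 2 * (j - k) < q by clear; lra.
  exact: gen Na Nb (uP a) (uP b).
pose x := limn u; exists x => r.
(* First-order condition at the limit: J (u n + t r) >= m is compared with J (u n) < m + 1 / (n +
   1), and n is sent to infinity with t fixed. Both signs of t, then t small, force G x r = l r. *)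
have key t : - (2 * t * (G x r - l r)) <= t ^+ 2 * G r r.
  apply/ler_addgt0Pr => e; move: (e : R) => {}e e0.
  pose q := 2 * `|t| * C * `|r| + 1.
  have q0 : 0 < q by rewrite ltr_wpDl// !mulr_ge0// ltW.
  have : \forall n \near \oo, `|x - u n| < e / 2 / q.
    by apply: cvgr_dist_lt; rewrite ?divr_gt0.
  have e2 : 0 < e / 2 by rewrite divr_gt0.
  have small : \forall n \near \oo, n.+1%:R^-1 < e / 2 :> R.
    exact: near_infty_natSinv_lt (PosNum e2).
  move=> H; near \oo => n.
  have H1 : `|x - u n| < e / 2 / q by near: n.
  have H2 : n.+1%:R^-1 < e / 2 by near: n.
  have H3 := Jm (u n + t *: r); have H4 := uP n.
  move: H3 H4; rewrite /J lD lZ mformDl !mformDr !mformZl !mformZr (mform_sym FG r).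
  have H5 : `|2 * t * G (x - u n) r| <= e / 2.
    rewrite !normrM (ger0_norm (ler0n _ 2)) (le_trans (ler_wpM2l _ (mform_le_norm _ _)))//.
    rewrite [leLHS](_ : _ = (2 * `|t| * C * `|r|) * `|x - u n|); last by ring.
    rewrite (le_trans (ler_wpM2l _ (ltW H1)))//; first by rewrite !mulr_ge0// ltW.
    by rewrite mulrA ler_pdivrMr// mulrC ler_wpM2l// ?ltW// /q ltrDl.
  have gen (uu ur rr xr lu lr k A : R) :
      k <= uu + t * ur + t * (ur + t * rr) - 2 * (lu + t * lr) ->
      uu - 2 * lu < k + A -> A < e / 2 -> - (e / 2) <= 2 * t * (xr - ur) ->
      - (2 * t * (xr - lr)) <= t ^+ 2 * rr + e by clear; lra.
  move: H5; rewrite mformBl ler_norml => /andP[H5 _] H3 H4.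
  by apply: gen _ H4 H2 H5; rewrite ?mulrDr ?addrA in H3 *.
apply/eqP; rewrite -subr_eq0; apply/eqP.
apply: (@eq0_of_le_linear _ _ (G r r) 1) => // t /andP[t0 t1].
have := key t; have := key (- t); rewrite sqrrN => k1 k2.
have Grr := mform_ge0 r.
have tG : 0 <= t ^+ 2 * G r r by rewrite mulr_ge0 ?exprn_ge0// ltW.
have gen (d g : R) : - (2 * t * d) <= t ^+ 2 * g -> - (2 * - t * d) <= t ^+ 2 * g ->
    0 <= t ^+ 2 * g -> t * (- d) <= t * (g * t) /\ t * d <= t * (g * t).
  by clear; move=> ? ? ?; split; lra.
have [{}k1 {}k2] := gen _ _ k2 k1 tG.
rewrite ler_pM2l// in k1; rewrite ler_pM2l// in k2.
by rewrite ler_norml lerNl k1.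
Unshelve. all: by end_near. Qed.

(* Newton iteration with the derivative frozen to kappa * G. *)
Lemma mform_solve (F : V -> V -> R) (x : V) (r eta kappa ga : R) :
  0 < r -> 0 < kappa -> 0 <= eta ->
  (forall p a u v, `|p - x| <= r -> F p (a *: u + v) = a * F p u + F p v) ->
  (forall p h, `|p - x| <= r -> `|F p h| <= ga * `|h|) ->
  (forall p p' h, `|p - x| <= r -> `|p' - x| <= r ->
     `|F p h - F p' h - kappa * G (p - p') h|
       <= kappa * c / 2 * `|p - p'| * `|h|) ->
  (forall h, `|F x h| <= eta * `|h|) -> eta <= kappa * c * r / 2 ->
  exists2 p, `|p - x| <= r & forall h, F p h = 0.
Proof.
move=> r0 k0 eta0 Flin Fb Fc Fx etar; have c0 := mform_c0 FG.
pose U : set V := [set p | `|p - x| <= r].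
have Ux : U x by rewrite /U /= subrr normr0 ltW.
(* [T p] is the Riesz representative of F p / kappa. F is controlled on the ball [U] only; outside
   it the value of [T] is arbitrary. *)
have /choice[T TP] : forall p, exists q, U p -> forall h, G q h = F p h / kappa.
  move=> p; have [Up|nUp] := pselect (U p); last by exists 0.
  have [|h|q qP] := @mform_riesz (fun h => F p h / kappa) (ga / kappa).
  - by move=> a u v; rewrite Flin// mulrDl mulrA.
  - by rewrite normrM normfV (gtr0_norm k0) mulrAC ler_wpM2r ?Fb// invr_ge0 ltW.
  by exists q.
(* The tolerance kappa c / 2 in the linearization hypothesis yields the contraction factor 1/2, and
   eta <= kappa c r / 2 lets the centre move by at most r / 2, so that [f] maps the ball into
   itself. *)
pose f p := p - T p.
have lip p p' : U p -> U p' -> `|f p - f p'| <= 2^-1 * `|p - p'|.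
  move=> Up Up'; have := @mform_norm_le (f p - f p') (c / 2 * `|p - p'|).
  rewrite (_ : _ / c = 2^-1 * `|p - p'|); last by field; rewrite gt_eqF.
  apply; first by rewrite mulr_ge0// divr_ge0// ltW.
  move=> h; rewrite -(ler_pM2l k0) -{1}(gtr0_norm k0) -normrM.
  rewrite [leRHS](_ : _ = kappa * c / 2 * `|p - p'| * `|h|); last by ring.
  apply: le_trans (Fc p p' h Up Up'); rewrite -normrN le_eqVlt; apply/orP; left.
  apply/eqP; congr (`|_|); rewrite /f !mformBl !TP//; field.
  by rewrite gt_eqF.
have fU p : U p -> U (f p).
  move=> Up; rewrite /U /= -(subrK (f x) (f p)) -addrA.
  apply: (le_trans (ler_normD _ _)).
  have H1 := lip _ _ Up Ux.
  have H2 : `|f x - x| <= eta / kappa / c.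
    rewrite /f addrAC subrr add0r normrN; apply: mform_norm_le.
      by rewrite divr_ge0// ltW.
    move=> h; rewrite TP// normrM normfV (gtr0_norm k0) mulrAC ler_wpM2r//.
    by rewrite invr_ge0 ltW.
  have H3 : eta / kappa / c <= r / 2.
    by rewrite !ler_pdivrMr// (le_trans etar)// le_eqVlt; apply/orP; left; apply/eqP; ring.
  have H4 : 2^-1 * `|p - x| <= 2^-1 * r by rewrite ler_wpM2l.
  have := le_trans H1 H4; have := le_trans H2 H3; clear; lra.
pose f' : {fun U >-> U} := mkfun_fun fU.
have [|||p Up pf] := @banach_fixed_point R V U f'.
- exists (2^-1)%:nng; split => /=; first by rewrite invf_lt1// ltr1n.
  by move=> [p p'] [/= Up Up']; apply: lip.
- rewrite (_ : U = closed_ball x r); first exact: closed_ball_closed.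
  by rewrite closed_ballE// /closed_ball_; apply/seteqP; split => q; rewrite /U /= distrC.
- by exists x.
exists p => // h; have := TP p Up h.
have : T p = 0 by have := pf; rewrite /f' /= /f => /eqP; rewrite -subr_eq0 opprB addrC subrK => /eqP.
move=> ->; rewrite mform0l => /esym/eqP; rewrite mulf_eq0 invr_eq0 (gt_eqF k0) orbF.
by move/eqP.
Qed.
End mform_theory.

(** * Riemannian distance *)

(** The integral of a nonnegative function is a supremum over the simple functions below it, hence
    monotone without measurability. It is applied to energy densities t |-> g (gam t) (dgam t) (dgam
    t), for which no measurability is established. *)
Lemma ge0_le_integral_lower (d : measure_display) (T : measurableType d)
    (R : realType) (mu : {measure set T -> \bar R}) (D : set T)
    (f h : T -> \bar R) :
  (forall x, D x -> (0 <= f x)%E) -> (forall x, D x -> (f x <= h x)%E) ->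
  (\int[mu]_(x in D) f x <= \int[mu]_(x in D) h x)%E.
Proof.
move=> f0 fh; rewrite integral_mkcond [leRHS]integral_mkcond.
rewrite !ge0_integralTE; first last.
- by move=> x; rewrite patchE; case: ifPn => // /set_mem /f0.
- by move=> x; rewrite patchE; case: ifPn => // /set_mem Dx; rewrite (le_trans (f0 x Dx)) ?fh.
apply: le_ereal_sup => _ [s sf <-]; exists s => // x.
apply: (le_trans (sf x)); rewrite !patchE; case: ifPn => // /set_mem.
exact: fh.
Qed.

Section energy.
Variable R : realType.
Local Notation mu := (@lebesgue_measure R).

(** Cauchy-Schwarz in the form 2 I phi - I^2 <= phi^2, I being the integral of phi, integrated over
    an interval of length t0 <= 1. The density h enters through the pointwise bound phi^2 <= B h, so
    measurability is asked of phi alone. *)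
Lemma Rintegral_sqr_le_energy (phi h : R -> R) (B e t0 : R) :
  0 < B -> 0 <= t0 <= 1 ->
  measurable_fun (`[0, 1] : set R) phi ->
  (forall t : R, t \in `[0, 1] -> phi t ^+ 2 <= B * h t) ->
  (\int[mu]_(t in `[0%R, 1%R]) (h t)%:E <= e%:E)%E ->
  (\int[mu]_(s in `[0, t0]) phi s) ^+ 2 <= B * e.
Proof.
move=> B0 /andP[t00 t01] mphi phih he.
have sub : (`[0, t0] : set R) `<=` `[0, 1].
  by move=> s /=; rewrite !in_itv /= => /andP[-> /le_trans ->].
have m1 : measurable (`[0, 1] : set R) by [].
have mt : measurable (`[0, t0] : set R) by [].
pose psi t := phi t ^+ 2 / B.
have psi0 t : 0 <= psi t by rewrite divr_ge0 ?sqr_ge0// ltW.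
have mpsi : measurable_fun (`[0, 1] : set R) psi.
  by apply: measurable_funM => //; apply: measurable_funX.
have ipsi_le : (\int[mu]_(t in `[0%R, 1%R]) (psi t)%:E <= e%:E)%E.
  apply: le_trans he; apply: ge0_le_integral_lower => t tI; rewrite lee_fin//.
  by rewrite ler_pdivrMr// mulrC phih.
have ipsi : mu.-integrable `[0, 1] (EFin \o psi).
  apply/integrableP; split; first exact/measurable_EFinP.
  under eq_integral do rewrite /= ger0_norm//.
  by rewrite (le_lt_trans ipsi_le)// ltry.
have ipsit : mu.-integrable `[0, t0] (EFin \o psi) by apply: integrableS ipsi.
have isq : mu.-integrable `[0, t0] (EFin \o (fun t => phi t ^+ 2)).
  apply: (@eq_integrable _ _ _ mu _ _ (EFin \o (fun t => B * psi t))) => //.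
    by move=> t _; rewrite /psi /= mulrC divfK// gt_eqF.
  exact: (@integrableZl _ _ _ mu _ _ B _ ipsit).
pose T0 : set R := [set` `[0, t0]].
have finmu : (mu T0 < +oo)%E.
  by rewrite /T0 lebesgue_measure_itv /=; case: ifP => _; rewrite ?ltry// -EFinD ltry.
have icst (r : R) : mu.-integrable `[0, t0] (EFin \o cst r).
  apply/integrableP; split; first exact/measurable_EFinP.
  rewrite (eq_integral (cst `|r|%:E)) => [|t _]; last by rewrite abse_EFin.
  by rewrite integral_cst// lte_mul_pinfty// lee_fin.
have iphi : mu.-integrable `[0, t0] (EFin \o phi).
  have ig : mu.-integrable `[0, t0]
      ((EFin \o cst 1%R) \+ (EFin \o (fun t => (phi t ^+ 2)%R)))%E.
    by apply: integrableD.
  apply: le_integrable ig => //.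
    by apply/measurable_EFinP; apply: measurable_funS mphi.
  move=> t _; rewrite /= lee_fin.
  rewrite [leRHS]ger0_norm ?addr_ge0 ?sqr_ge0// -real_normK ?num_real//.
  by have := normr_ge0 (phi t); nra.
set I := Rintegral _ _ _.
have iI : mu.-integrable `[0, t0] (EFin \o (fun t => 2 * I * phi t)).
  exact: (@integrableZl _ _ _ mu _ _ (2 * I) _ iphi).
have H : \int[mu]_(t in `[0, t0]) (2 * I * phi t - I ^+ 2)
    <= \int[mu]_(t in `[0, t0]) (phi t ^+ 2).
  apply: le_Rintegral => //.
    have : mu.-integrable `[0, t0] (fun t => (EFin \o (fun t => (2 * I * phi t)%R)) t
        - (EFin \o cst (I ^+ 2)%R) t)%E by apply: integrableB.
    by apply: eq_integrable.
  have gen (a i : R) : 2 * i * a - i ^+ 2 <= a ^+ 2.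
    by have := sqr_ge0 (a - i); clear; lra.
  by move=> t _; exact: gen.
move: H; rewrite RintegralB//; last exact: icst.
rewrite RintegralZl// Rintegral_cst// => H1.
have muT0 : fine (mu T0) = t0.
  rewrite /T0 lebesgue_measure_itv /=.
  by case: ifPn => /=; rewrite lte_fin ?subr0// -leNgt => t0'; apply/le_anti; rewrite t00 t0'.
have {}H1 : 2 * I * I - I ^+ 2 * fine (mu T0)
    <= \int[mu]_(t in `[0, t0]) (phi t ^+ 2) by exact: H1.
rewrite muT0 in H1.
have H2 : \int[mu]_(t in `[0, t0]) (phi t ^+ 2) <= B * e.
  have -> : \int[mu]_(t in `[0, t0]) (phi t ^+ 2) = B * \int[mu]_(t in `[0, t0]) psi t.
    rewrite -RintegralZl//; apply: eq_Rintegral => t _.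
    by rewrite /psi mulrC divfK// gt_eqF.
  apply: (ler_wpM2l (ltW B0)); rewrite -lee_fin /Rintegral fineK; last exact: integrable_fin_num.
  apply: le_trans ipsi_le; apply: ge0_subset_integral => //.
    exact/measurable_EFinP.
  by move=> t _; rewrite lee_fin.
apply: le_trans H2; apply: le_trans H1.
have := sqr_ge0 I; nra.
Qed.
End energy.

Lemma exists_topdual (R : realType) (V : normedModType R) (l : V -> R) (k : R) :
  (forall a u v, l (a *: u + v) = a * l u + l v) ->
  (forall r, `|l r| <= k * `|r|) -> exists phi : topdual V, forall x, phi x = l x.
Proof.
move=> ll lk.
pose f : V -> R^o := l.
have fl : linear f by move=> a u v; exact: ll.
pose F : {linear V -> R^o} := HB.pack_for {linear V -> R^o} f
  (GRing.isLinear.Build R V R^o *:%R f fl).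
have Fc : continuous F.
  apply: bounded_linear_continuous; apply/linear_boundedP.
  have : \forall r \near +oo, k <= r by apply: nbhs_pinfty_ge; rewrite num_real.
  by apply: filterS => r kr x; rewrite (le_trans (lk x))// ler_wpM2r.
by exists (Dual Fc).
Qed.

Section local_distance.
Variables (R : realType) (V : completeNormedModType R) (Y : normedModType R).
Variables (iota : V -> Y) (M : set V) (g : Y -> V -> V -> R^o).
Variables (c C L rho : R) (x0 : V).
Hypothesis gform : forall x, M x -> metric_form c C (g (iota x)).
Hypothesis Mball : forall x, `|x - x0| < rho -> M x.
Hypothesis gL : forall a b u, `|a - x0| < rho -> `|b - x0| < rho ->
  `|g (iota a) u u - g (iota b) u u| <= L * `|a - b| * `|u| ^+ 2.
Hypotheses (rho0 : 0 < rho) (L0 : 0 <= L) (c0 : 0 < c) (C0 : 0 < C).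

(** The weak formulation of Sobolev paths gives access to a path through functionals, here g_a(w,
    .). The choice w = gam t0 - a will confine a path to a small ball, and w = b - a will bound its
    energy from below. *)
Lemma path_functional_le a gam dgam (e B t0 : R) w :
  M a -> gam 0 = a -> sobolev_path gam dgam -> 0 <= t0 <= 1 -> 0 < B ->
  (forall t : R, t \in `[0, 1] -> g (iota a) w (dgam t) ^+ 2
     <= B * g (iota (gam t)) (dgam t) (dgam t)) ->
  (\int[@lebesgue_measure R]_(t in `[0%R, 1%R])
     (g (iota (gam t)) (dgam t) (dgam t))%:E <= e%:E)%E ->
  g (iota a) w (gam t0 - a) ^+ 2 <= B * e.
Proof.
move=> Ma ga [mphi _ phiE] t01 B0 Hw He.
have [phi phiP] := @exists_topdual R V (g (iota a) w) (C * `|w|)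
  (fun a' u v => ltac:(by rewrite (mformDr (gform Ma)) (mformZr (gform Ma))))
  (fun r => mform_le_norm (gform Ma) w r).
have E : g (iota a) w (gam t0 - a) =
   \int[@lebesgue_measure R]_(s in `[0, t0]) (phi (dgam s) : R).
  rewrite (mformBr (gform Ma)) -!phiP -ga phiE ?in_itv//= addrC addKr //.
rewrite E.
apply: (@Rintegral_sqr_le_energy R (fun s => phi (dgam s))
  (fun t => g (iota (gam t)) (dgam t) (dgam t)) B e t0) => //.
by move=> t t1; rewrite phiP; exact: Hw.
Qed.

Let kap := C / c.
Let kap0 : 0 < kap. Proof. by rewrite divr_gt0. Qed.

Lemma path_energy_lower a b gam dgam (e : R) :
  `|a - x0| < rho / (1 + 2 * kap) -> `|b - x0| < rho / (1 + 2 * kap) ->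
  sobolev_path gam dgam -> (forall t, t \in `[0, 1] -> M (gam t)) ->
  gam 0 = a -> gam 1 = b ->
  (\int[@lebesgue_measure R]_(t in `[0%R, 1%R])
     (g (iota (gam t)) (dgam t) (dgam t))%:E <= e%:E)%E ->
  g (iota a) (b - a) (b - a) - C * L * kap / c * `|b - a| ^+ 3 <= e.
Proof.
move=> ar br sob Mgam ga gb He.
have [c0' C0' k0'] : [/\ 0 <= c, 0 <= C & 0 <= kap] by split; exact: ltW.
have k1 : 0 < 1 + 2 * kap by rewrite addr_gt0// mulr_gt0.
have rr : rho / (1 + 2 * kap) <= rho.
  rewrite ler_pdivrMr//; apply: ler_peMr; first exact: ltW.
  by rewrite lerDl; apply: mulr_ge0 => //; exact: ltW.
have Ma : M a by apply: Mball; rewrite (lt_le_trans ar).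
have Fa := gform Ma.
set d := b - a; set N := g (iota a) d d.
have N0 : 0 <= N by exact: mform_ge0 Fa _.
have NC : N <= C * `|d| ^+ 2 by exact: mform_bound Fa _.
have e0 : 0 <= e.
  rewrite -lee_fin; apply: le_trans He; apply: integral_ge0 => t tI.
  by rewrite lee_fin (mform_ge0 (gform (Mgam _ tI))).
have K0 : 0 <= C * L * kap / c by rewrite !(divr_ge0, mulr_ge0).
have d30 : 0 <= C * L * kap / c * `|d| ^+ 3.
  exact: mulr_ge0 K0 (exprn_ge0 _ (normr_ge0 _)).
have [eN|eN] := leP N e; first by apply: le_trans eN; rewrite gerBl.
(* A path of energy less than N stays within kap * `|d| of a, where the metric is
   at least (1 - th) * g_a. *)
have near_a t : 0 <= t <= 1 -> `|gam t - a| <= kap * `|d|.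
  move=> t01; set w := gam t - a.
  have [->|w0] := eqVneq w 0; first by rewrite normr0 mulr_ge0.
  have Gw : 0 < g (iota a) w w.
    rewrite (lt_le_trans _ (mform_coer Fa w))// mulr_gt0// exprn_gt0//.
    by rewrite normr_gt0.
  have H := @path_functional_le a gam dgam e (g (iota a) w w * kap) t w Ma ga sob t01.
  have {}H : g (iota a) w w ^+ 2 <= g (iota a) w w * kap * e.
    apply: H => //; first by rewrite mulr_gt0.
    move=> s s01; apply: (le_trans (mform_CS Fa _ _)).
    rewrite -mulrA; apply: (ler_wpM2l (ltW Gw)); apply: (le_trans (mform_bound Fa _)).
    rewrite /kap mulrAC -mulrA; apply: (ler_wpM2l C0').
    by rewrite ler_pdivlMr// mulrC (mform_coer (gform (Mgam _ s01))).
  rewrite expr2 -mulrA ler_pM2l// in H.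
  have H2 : c * `|w| ^+ 2 <= c * (kap * `|d|) ^+ 2.
    apply: le_trans (mform_coer Fa w) _; apply: le_trans H _.
    apply: (@le_trans _ _ (kap * (C * `|d| ^+ 2))).
      by rewrite ler_pM2l// ltW// (lt_le_trans eN).
    rewrite le_eqVlt; apply/orP; left; apply/eqP; rewrite /kap; field.
    by rewrite gt_eqF.
  have kd0 : 0 <= kap * `|d| by apply: (mulr_ge0 k0').
  by rewrite ler_pM2l// in H2; rewrite -(@ler_pXn2r _ 2)// ?nnegrE ?normr_ge0.
have gam_ball t : 0 <= t <= 1 -> `|gam t - x0| < rho.
  move=> /near_a H; rewrite -(subrK a (gam t)) -addrA.
  apply: (le_lt_trans (ler_normD _ _)); apply: (le_lt_trans (lerD H (lexx _))).
  (* The distance to x0 is below kap * 2 R + R, which equals rho for R = rho / (1 + 2 kap): this is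
     the origin of the radius. *)
  have dd : `|d| < 2 * (rho / (1 + 2 * kap)).
    rewrite /d -(subrK x0 b) -addrA (le_lt_trans (ler_normD _ _))//.
    by rewrite (distrC x0) mulr2n mulrDl mul1r ltrD.
  apply: (@lt_le_trans _ _ (kap * (2 * (rho / (1 + 2 * kap))) + rho / (1 + 2 * kap))).
    by rewrite ltrD// ltr_pM2l.
  rewrite le_eqVlt; apply/orP; left; apply/eqP; field.
  by rewrite gt_eqF.
(* Relative oscillation of the metric along the path: L |gam t - a| <= L kap |d|, measured against
   the coercivity constant c. For th >= 1 the claimed lower bound is nonpositive. *)
pose th := L * kap * `|d| / c.
have KE : C * L * kap / c * `|d| ^+ 3 = C * `|d| ^+ 2 * th.
  by rewrite /th; field; rewrite gt_eqF.
have th0 : 0 <= th by rewrite /th !(divr_ge0, mulr_ge0).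
rewrite KE.
have Nth : N * th <= C * `|d| ^+ 2 * th by rewrite ler_wpM2r.
have [th1|th1] := leP 1 th.
  rewrite (le_trans _ e0)// subr_le0 (le_trans _ Nth)// ler_peMr//.
suff H : N * (1 - th) <= e by move: H Nth; lra.
have [N00|Npos] := leP N 0.
  by rewrite (le_trans _ e0)// pmulr_lle0// subr_gt0.
have th1' : 0 < 1 - th by rewrite subr_gt0.
have H := @path_functional_le a gam dgam e (N / (1 - th)) 1 d Ma ga sob.
have {}H : N ^+ 2 <= N / (1 - th) * e.
  rewrite gb in H; apply: H => //; first by rewrite ler01 lexx.
    by rewrite divr_gt0.
  move=> s s01; rewrite (le_trans (mform_CS Fa _ _))// -mulrA ler_wpM2l//.
  rewrite mulrC ler_pdivlMr// mulrBr mulr1.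
  have s01' : 0 <= s <= 1 by move: s01; rewrite in_itv.
  have H := gL (dgam s) (gam_ball s s01') (lt_le_trans ar rr).
  have H1 : L * `|gam s - a| * `|dgam s| ^+ 2 <= L * (kap * `|d|) * `|dgam s| ^+ 2.
    by rewrite ler_wpM2r ?exprn_ge0// ler_wpM2l// near_a.
  have H2 : L * (kap * `|d|) * `|dgam s| ^+ 2 <= th * g (iota a) (dgam s) (dgam s).
    rewrite (_ : L * (kap * `|d|) * _ = th * (c * `|dgam s| ^+ 2)); last first.
      by rewrite /th; field; rewrite gt_eqF.
    by rewrite ler_wpM2l// (mform_coer Fa).
  move: H H1 H2; rewrite ler_norml => /andP[H _]; move: H; lra.
move: H; rewrite expr2 -mulrA ler_pM2l// mulrC ler_pdivlMr//.
Qed.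

(** The straight segment is the competitor; the metric changes along it by at most L |b - a|, which
    gives the cubic excess. *)
Lemma segment_energy a b : `|a - x0| < rho -> `|b - x0| < rho ->
  exists2 e : \bar R, path_energies iota M g a b e &
  (e <= (g (iota a) (b - a) (b - a) + L * `|b - a| ^+ 3)%:E)%E.
Proof.
move=> ar br; set d := b - a.
have m1 : lebesgue_measure ([set` `[0%R, 1%R]] : set R) = 1%E.
  by rewrite lebesgue_measure_itv /= lte_fin ltr01 oppr0 adde0.
have seg t : 0 <= t <= 1 -> `|a + t *: d - x0| < rho.
  move=> /andP[t0 t1].
  have -> : a + t *: d - x0 = (1 - t) *: (a - x0) + t *: (b - x0).
    rewrite (_ : b - x0 = (a - x0) + d); last by rewrite /d addrAC subrKC.
    by rewrite [t *: (a - x0 + d)]scalerDr addrA -scalerDl subrK scale1r addrAC.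
  apply: (le_lt_trans (ler_normD _ _)); rewrite !normrZ (ger0_norm t0).
  rewrite ger0_norm ?subr_ge0//.
  have [->|tn0] := eqVneq t 0; first by rewrite mul0r addr0 subr0 mul1r.
  have t0' : 0 < t by rewrite lt0r tn0.
  rewrite (_ : rho = (1 - t) * rho + t * rho); last by ring.
  by apply: ler_ltD; [rewrite ler_wpM2l ?subr_ge0// ltW|rewrite ltr_pM2l].
exists (\int[@lebesgue_measure R]_(t in `[0%R, 1%R])
    (g (iota (a + t *: d)) d d)%:E)%E.
  exists (fun t => a + t *: d), (fun=> d); split => //.
  - split.
    + by move=> phi; exact: measurable_cst.
    + rewrite (eq_integral (cst (`|d| ^+ 2)%:E))//.
      rewrite integral_cst//.
      by rewrite [X in (_ * X)%E](_ : _ = 1%E) ?mule1 ?ltry//; exact: m1.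
    + move=> phi t; rewrite in_itv /= => /andP[t0 t1].
      rewrite scale0r addr0 raddfD /= linearZ /=; congr (_ + _).
      rewrite Rintegral_cst// mulrC.
      have -> : fine (lebesgue_measure ([set` `[0%R, t]] : set R)) = t.
        rewrite lebesgue_measure_itv /=.
        by case: ifPn => /=; rewrite lte_fin ?subr0// -leNgt => t0'; apply/le_anti; rewrite t0 t0'.
      by [].
  - by move=> t; rewrite in_itv /= => t01; apply: Mball; exact: seg.
  - by rewrite scale0r addr0.
  - by rewrite scale1r /d subrKC.
apply: (@le_trans _ _ (\int[@lebesgue_measure R]_(t in `[0%R, 1%R])
    (cst (g (iota a) d d + L * `|d| ^+ 3)%:E) t)%E); last first.
  rewrite integral_cst//.
  by rewrite [X in (_ * X)%E](_ : _ = 1%E) ?mule1//; exact: m1.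
apply: ge0_le_integral_lower => t; rewrite /= in_itv /= => t01; rewrite lee_fin.
  by apply: mform_ge0 (gform _) _; apply: Mball; exact: seg.
have := gL d (seg t t01) ar; rewrite ler_norml => /andP[_].
rewrite lerBlDl => H; apply: (le_trans H); rewrite lerD2l.
rewrite addrAC subrr add0r normrZ [leRHS](_ : _ = L * (1 * `|d|) * `|d| ^+ 2); last by ring.
case/andP: t01 => t0 t1.
by rewrite ler_wpM2r ?exprn_ge0// ler_wpM2l// ler_wpM2r// ger0_norm.
Qed.

(** The two energy bounds make the infimum finite; it is exposed as a real e, so that later
    estimates leave the extended reals. *)
Lemma rdist_local : exists K r : R, [/\ 0 <= K, 0 < r, r <= rho &
  forall a b, `|a - x0| < r -> `|b - x0| < r -> exists2 e : R,
    0 <= e /\ rdist iota M g a b = (Num.sqrt e)%:E &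
    `|e - g (iota a) (b - a) (b - a)| <= K * `|b - a| ^+ 3].
Proof.
have k1 : 0 < 1 + 2 * kap by rewrite addr_gt0// mulr_gt0.
have rr : rho / (1 + 2 * kap) <= rho.
  rewrite ler_pdivrMr//; apply: ler_peMr; first exact: ltW.
  by rewrite lerDl; apply: mulr_ge0 => //; exact: ltW.
pose K1 := C * L * kap / c.
have K10 : 0 <= K1.
  exact: divr_ge0 (mulr_ge0 (mulr_ge0 (ltW C0) L0) (ltW kap0)) (ltW c0).
exists (K1 + L), (rho / (1 + 2 * kap)); split => //.
- by rewrite addr_ge0.
- by rewrite divr_gt0.
move=> a b ar br.
set E := ereal_inf (path_energies iota M g a b).
have low : ((g (iota a) (b - a) (b - a) - K1 * `|b - a| ^+ 3)%:E <= E)%E.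
  apply: le_ereal_inf_tmp => _ [gam [dgam [sob Mgam ga gb ->]]].
  case Ee : (\int[lebesgue_measure]_(t in `[0%R, 1%R]) _)%E => [e| |].
  - rewrite lee_fin; apply: path_energy_lower sob Mgam ga gb _ => //.
    by rewrite Ee.
  - by rewrite leey.
  have := @integral_ge0 _ _ R (@lebesgue_measure R) [set` `[0%R, 1%R]]
    (fun t => (g (iota (gam t)) (dgam t) (dgam t))%:E).
  rewrite Ee => H; suff : (0 <= -oo :> \bar R)%E by [].
  apply: H => t tI; by rewrite lee_fin (mform_ge0 (gform (Mgam _ tI))).
have [e1 pe1 e1le] := segment_energy (lt_le_trans ar rr) (lt_le_trans br rr).
have up : (E <= (g (iota a) (b - a) (b - a) + L * `|b - a| ^+ 3)%:E)%E.
  by apply: le_trans e1le; exact: ereal_inf_lbound.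
have E0 : (0 <= E)%E.
  apply: le_ereal_inf_tmp => _ [gam [dgam [sob Mgam ga gb ->]]].
  apply: integral_ge0 => t tI; rewrite lee_fin.
  exact: (mform_ge0 (gform (Mgam _ tI))).
have Efin : E \is a fin_num.
  by rewrite fin_numE; apply/andP; split; apply/eqP => Ei; move: low up; rewrite Ei.
have EE : E = (fine E)%:E by rewrite fineK.
have e0 : 0 <= fine E by rewrite -lee_fin -EE.
exists (fine E).
  by split => //; rewrite /rdist -/E EE.
rewrite EE !lee_fin in low up.
have d3 : 0 <= `|b - a| ^+ 3 by rewrite exprn_ge0.
have Ld := mulr_ge0 L0 d3; have Kd := mulr_ge0 K10 d3.
by rewrite ler_norml mulrDl; apply/andP; split; lra.
Qed.
End local_distance.

(** * Directional derivatives, and jets of the metric *)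

Lemma derive_along_line (R : realType) (E F : normedModType R) (f : E -> F)
    (x h : E) : 'D_h f x = 'D_1 (fun s : R => f (x + s *: h)) 0.
Proof.
apply: (f_equal (fun G : R -> F => lim (G @ 0^'))).
apply/funext => s /=.
by rewrite scale0r addr0 [s%:A]mulr1 addr0 [x + _]addrC.
Qed.

Lemma derive_frechet (R : realType) (E F : normedModType R) (f : E -> F)
    (x h : E) (L : E -> F) :
  (forall e : R, 0 < e -> \forall x' \near x,
     `|f x' - f x - L (x' - x)| <= e * `|x' - x|) ->
  (forall a : R, L (a *: h) = a *: L h) -> 'D_h f x = L h.
Proof.
move=> fL LZ; rewrite derive_along_line.
have := @is_derive_frechet R E F f x h L 0; rewrite scale0r addr0.
by move=> /(_ fL LZ) [_ ->].
Qed.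

Lemma diff_frechet (R : realType) (E F : normedModType R) (f : E -> F)
    (x : E) (L : E -> F) (k : R) :
  (forall e : R, 0 < e -> \forall x' \near x,
     `|f x' - f x - L (x' - x)| <= e * `|x' - x|) ->
  (forall a u v, L (a *: u + v) = a *: L u + L v) ->
  (forall u, `|L u| <= k * `|u|) -> forall h, 'd f x h = L h.
Proof.
move=> fL Llin Lk h.
pose dL : {linear E -> F} := HB.pack_for {linear E -> F} L
  (GRing.isLinear.Build R E F *:%R L Llin).
have dLc : continuous dL.
  apply: bounded_linear_continuous; apply/linear_boundedP.
  have : \forall r \near +oo, k <= r by apply: nbhs_pinfty_ge; rewrite num_real.
  by apply: filterS => r kr u; rewrite (le_trans (Lk u))// ler_wpM2r.
have -> // := @diff_unique R E F f dL x dLc.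
apply/eqaddoP => e e0.
have /nbhs_ballP[d /= d0 dP] := fL _ e0.
apply/nbhs_ballP; exists d => //= u; rewrite -ball_normE /= sub0r normrN => ud.
have /dP : ball x d (u + x).
  by rewrite -ball_normE /= opprD addrCA subrr addr0 normrN.
by rewrite addrK /= opprD addrA.
Qed.

Section jet_unique.
Variables (R : realType) (E : normedModType R) (n : nat) (x0 : E).
Variables (rho K1 K2 K3 : R) (D1 D2 D3 : E -> seq E -> R).
Hypotheses (J1 : jet n x0 rho K1 D1) (J2 : jet n x0 rho K2 D2).
Hypothesis (J3 : jet n x0 rho K3 D3).

(** Each order of a jet is the derivative along lines of the preceding one, so a relation between
    the functions passes to all orders. Linearity of g_x in its arguments is transferred in this
    way, and so is symmetry, with a = 1 and a zero jet. *)
Lemma jet_combination (a : R) :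
  (forall x, `|x - x0| < rho -> D3 x [::] = a * D1 x [::] + D2 x [::]) ->
  forall s x, `|x - x0| < rho -> (size s <= n)%N ->
  D3 x s = a * D1 x s + D2 x s.
Proof.
move=> D0; elim=> [|h s IH] x xr sn; first exact: D0.
have sn' : (size s < n)%N by [].
have x0r : `|x + (0 : R) *: h - x0| < rho by rewrite scale0r addr0.
have H1 := jet_derive J1 x0r sn'; have H2 := jet_derive J2 x0r sn'.
have H3 := jet_derive J3 x0r sn'; rewrite !scale0r !addr0 in H1 H2 H3.
have H4 : is_derive (0 : R) 1 (fun t : R => a * D1 (x + t *: h) s + D2 (x + t *: h) s)
   (a * D1 x (h :: s) + D2 x (h :: s)).
  by apply: is_deriveD => //; apply: is_deriveZ.
case: H3 => _ <-; case: H4 => _ <-.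
apply: near_eq_derive.
have [d d0 dP] := jet_room h 0 xr.
have [d' d'0 dP'] := jet_room (- h) 0 xr.
apply/nbhs_ballP; exists (Num.min d d'); rewrite /= ?lt_min ?d0//.
move=> t; rewrite -ball_normE /= sub0r normrN lt_min => /andP[td td'].
apply: IH; last exact: ltnW.
have [t0|t0|<-] := ltgtP 0 t.
- by rewrite gtr0_norm// in td; have [] := dP t ltac:(by rewrite t0).
- rewrite ltr0_norm// in td'; have [] := dP' (- t) ltac:(by rewrite oppr_gt0 t0).
  by rewrite scaleNr scalerN opprK.
by rewrite scale0r addr0.
Qed.
End jet_unique.

Lemma norm_pairE (R : realType) (E F : normedModType R) (u : E) (v : F) :
  `|(u, v)| = Num.max `|u| `|v|.
Proof. by []. Qed.

Lemma interior_norm (R : realType) (E : normedModType R) (A : set E) (x : E) :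
  A° x <-> exists2 d : R, 0 < d & forall x', `|x' - x| < d -> A x'.
Proof.
split.
  move=> /nbhs_ballP[d /= d0 dA]; exists d => // x' xd.
  by apply: dA; rewrite -ball_normE /= distrC.
move=> [d d0 dA]; apply/nbhs_ballP; exists d => // x'.
by rewrite -ball_normE /= distrC; exact: dA.
Qed.

Section metric_jets.
Variables (R : realType) (V : normedModType R) (Y : normedModType R).
Variables (iota : V -> Y) (M : set V) (g : Y -> V -> V -> R^o).
Variables (m : nat) (y : V).
Hypothesis g_Cm : Cn_on m (M `*` [set: V] `*` [set: V])
       (fun q : V * V * V => g (iota q.1.1) q.1.2 q.2).
Hypothesis gZl : forall x, M x -> forall a u w,
  g (iota x) (a *: u) w = a * g (iota x) u w.
Hypothesis gZr : forall x, M x -> forall a u w,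
  g (iota x) w (a *: u) = a * g (iota x) w u.
Hypothesis y_int : M° y.

(* The jet of g at (y, 0, 0) controls x |-> g_x(a, b) for small a and b only;
   rescaling a and b to norm rho / 2 covers all of them. *)
Lemma metric_jets : exists (Dg : V -> V -> V -> seq V -> R) (rho K : R),
  [/\ 0 < rho, 0 <= K, forall x, `|x - y| < rho -> M x,
      forall a b, jet m y rho (K * `|a| * `|b|) (Dg a b) &
      forall a b x, `|x - y| < rho -> Dg a b x [::] = g (iota x) a b].
Proof.
have int0 : (M `*` [set: V] `*` [set: V])° ((y, 0), 0).
  move/interior_norm: y_int => [d d0 dM]; apply/interior_norm; exists d => //.
  by move=> [[x a] b]; rewrite !norm_pairE !gt_max => /andP[/andP[/dM]].
have [D [rho [K [rho0 K0 inM D0 JD]]]] := Cn_on_frechet_jet g_Cm int0.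
have J := @jet_of_frechet R _ R^o m _ rho K 1 D id JD ler01 (fun a u v => erefl)
   (fun u => ltac:(by rewrite mul1r)).
rewrite mulr1 in J.
pose emb (h : V) : V * V * V := ((h, 0), 0).
have embl a u v : emb (a *: u + v) = a *: emb u + emb v.
  by congr (_, _, _); rewrite /= scaler0 addr0.
have embn h : `|emb h| = `|h|.
  by rewrite /emb !norm_pairE normr0 !(max_l (normr_ge0 _)).
have embp s : nprod (map emb s) = nprod s.
  by elim: s => [|h s IH] /=; rewrite ?nprod0 // !nprod_cons IH embn.
pose r := rho / 2.
have r0 : 0 < r by rewrite divr_gt0.
have rr : r < rho by rewrite ltr_pdivrMr// ltr_pMr// ltr1n.
(* Division by zero gives nm 0 = 0, so the rescaling identity [nmK] covers the zero vector too. *)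
pose nm (a : V) := (r / `|a|) *: a.
have nm_lt a : `|nm a| < rho.
  rewrite /nm normrZ normrM normfV normr_id (gtr0_norm r0).
  have [->|a0] := eqVneq a 0; first by rewrite normr0 mulr0.
  by rewrite divfK ?normr_eq0.
have nmK a : (`|a| / r) *: nm a = a.
  rewrite /nm scalerA; have [->|a0] := eqVneq a 0; first by rewrite scaler0.
  rewrite mulrA divfK ?gt_eqF// divff ?normr_eq0// scale1r //.
have inball x a b : `|x - y| < rho -> `|((x, nm a), nm b) - ((y, 0), 0)| < rho.
  move=> xr; rewrite !norm_pairE !gt_max /= xr !subr0 !nm_lt //.
exists (fun a b x s => `|a| / r * (`|b| / r) * D ((x, nm a), nm b) (map emb s)).
exists rho, (K / r ^+ 2); split.
- exact: rho0.
- by rewrite divr_ge0// exprn_ge0// ltW.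
- move=> x xr; have /inM : `|((x, nm 0), nm 0) - ((y, 0), 0)| < rho by exact: inball.
  by move=> [[]].
- move=> a b; have c0 : 0 <= `|a| / r * (`|b| / r).
    by rewrite mulr_ge0// divr_ge0// ltW.
  split.
  + move=> x s1 s2 t u v xr sn; rewrite !map_cat /= embl.
    rewrite (jet_linear J) ?size_map//; last exact: inball.
    by rewrite mulrDr mulrCA.
  + move=> x s xr sn; rewrite normrM (ger0_norm c0).
    have := jet_bound J (inball _ a b xr) (s := map emb s); rewrite size_map embp.
    move=> /(_ sn) H; rewrite (le_trans (ler_wpM2l c0 H))//.
    rewrite le_eqVlt; apply/orP; left; apply/eqP; field.
    by rewrite gt_eqF.
  + move=> x h s t xr sn.
    have E u : (x + u *: h, nm a, nm b) = (x, nm a, nm b) + u *: emb h.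
      by rewrite /emb; congr (_, _, _); rewrite /= scaler0 addr0.
    have := jet_derive J (x := ((x, nm a), nm b)) (h := emb h) (s := map emb s) (t := t).
    rewrite -E size_map => /(_ (inball _ a b xr) sn) H.
    rewrite (_ : (fun u : R => _ * _) = (`|a| / r * (`|b| / r)) \*:
       (fun u : R => D ((x, nm a, nm b) + u *: emb h) (map emb s) : R)).
      exact: is_deriveZ.
    by apply/funext => u; rewrite /= -E.
move=> a b x xr /=; rewrite D0 /=; last exact: inball.
have Mx : M x by have [[]] := inM _ (inball _ a b xr).
have Ea u : g (iota x) a u = `|a| / r * g (iota x) (nm a) u by rewrite -gZl// nmK.
have Eb u : g (iota x) u b = `|b| / r * g (iota x) u (nm b) by rewrite -gZr// nmK.
by rewrite Ea Eb; exact: esym (mulrA _ _ _).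
Qed.
End metric_jets.

(** * Derivatives of W on the diagonal *)

(** The coefficients are identified order by order. It will be applied to t |-> W(x + t al_1, x + t
    al_2) minus its metric model. *)
Lemma quadratic_eq0 (R : realType) (a b e C d : R) : 0 < d ->
  (forall t : R, 0 < t < d -> `|a + b * t + e * t ^+ 2| <= C * t ^+ 3) ->
  [/\ a = 0, b = 0 & e = 0].
Proof.
move=> d0 H.
pose d1 := Num.min d 1.
have d10 : 0 < d1 by rewrite lt_min d0 ltr01.
have H1 t : 0 < t < d1 -> [/\ 0 < t, t < 1, t < d & `|a + b * t + e * t ^+ 2| <= `|C| * t ^+ 3].
  move=> /andP[t0]; rewrite lt_min => /andP[td t1]; split => //.
  rewrite (le_trans (H t _)) ?t0// ler_wpM2r ?ler_norm// exprn_ge0// ltW //.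
have a0 : a = 0.
  apply: (@eq0_of_le_linear _ _ (`|C| + `|b| + `|e|) d1) => // t /H1[t0 t1 td Ht].
  have t2 : t ^+ 2 <= t by rewrite expr2 ler_piMl ?ltW.
  have t3 : t ^+ 3 <= t by rewrite exprS ler_piMr ?ltW// (le_lt_trans t2).
  rewrite (_ : a = (a + b * t + e * t ^+ 2) + (- (b * t) + - (e * t ^+ 2))); last by ring.
  rewrite (le_trans (ler_normD _ _))// -[`|C| + _ + _]addrA mulrDl lerD//.
    by rewrite (le_trans Ht)// ler_wpM2l.
  rewrite (le_trans (ler_normD _ _))// !normrN mulrDl !normrM !(gtr0_norm t0).
  by rewrite lerD// ler_wpM2l.
have b0 : b = 0.
  apply: (@eq0_of_le_linear _ _ (`|C| + `|e|) d1) => // t /H1[t0 t1 td].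
  rewrite a0 add0r (_ : b * t + e * t ^+ 2 = t * (b + e * t)); last by ring.
  rewrite normrM gtr0_norm// (_ : `|C| * t ^+ 3 = t * (`|C| * t ^+ 2)); last by ring.
  rewrite ler_pM2l// => Ht.
  have t2 : t ^+ 2 <= t by rewrite expr2 ler_piMl ?ltW.
  rewrite (_ : b = (b + e * t) - e * t); last by ring.
  rewrite (le_trans (ler_normB _ _))// mulrDl lerD//.
    by rewrite (le_trans Ht)// ler_wpM2l.
  by rewrite normrM (gtr0_norm t0).
split => //; apply: (@eq0_of_le_linear _ _ `|C| d1) => // t /H1[t0 t1 td].
rewrite a0 b0 mul0r !add0r normrM (ger0_norm (exprn_ge0 2 (ltW t0))).
rewrite (_ : `|C| * t ^+ 3 = `|C| * t * t ^+ 2); last by ring.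
by rewrite ler_pM2r// exprn_gt0.
Qed.

(* dW and dg a b are the iterated derivatives of W and of x |-> g_x(a, b), read
   as jets near y. *)
Record local_structure (R : realType) (V : normedModType R) (m : nat) (y : V)
    (rho K c C : R) (dW : V * V -> seq (V * V) -> R)
    (dg : V -> V -> V -> seq V -> R) : Prop := LocalStructure {
  ls_rho : 0 < rho;
  ls_K : 0 <= K;
  ls_jetW : jet m (y, y) rho K dW;
  ls_jetg : forall a b, jet m y rho (K * `|a| * `|b|) (dg a b);
  ls_form : forall x, `|x - y| < rho -> metric_form c C (fun a b => dg a b x [::]);
  ls_dg_lin : forall x s a u v w, `|x - y| < rho -> (size s <= m)%N ->
    dg (a *: u + v) w x s = a * dg u w x s + dg v w x s;
  ls_dg_sym : forall x s v w, `|x - y| < rho -> (size s <= m)%N ->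
    dg v w x s = dg w v x s;
  ls_W1 : forall x al, `|x - y| < rho -> dW (x, x) [:: al] = 0;
  ls_W2 : forall x al be, `|x - y| < rho ->
    dW (x, x) [:: al; be] = 2 * dg (al.1 - al.2) (be.1 - be.2) x [::] }.

Section local_structure_existence.
Variables (R : realType) (V Y : completeNormedModType R).
Variables (iota : V -> Y) (M : set V).
Variables (g : Y -> V -> V -> R^o) (W : V -> V -> R^o) (m : nat) (y : V).
Hypothesis g_metric : riemannian_metric iota M g.
Hypothesis W_consistent : locally_consistent iota M g W.
Hypothesis W_Cm : Cn_on m (M `*` M) (fun q : V * V => W q.1 q.2).
Hypothesis g_Cm : Cn_on m (M `*` [set: V] `*` [set: V])
  (fun q : V * V * V => g (iota q.1.1) q.1.2 q.2).
Hypothesis y_int : M° y.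
Hypothesis m4 : (4 <= m)%N.

Let m3 : (3 <= m)%N. Proof. exact: ltnW. Qed.

Lemma riemannian_metric_form : exists c C : R, forall x, M x ->
  metric_form c C (g (iota x)).
Proof.
case: g_metric => gs gl [c [C [c0 C0 cC]]]; exists c, C => x Mx; split => //.
- exact: gs.
- by move=> a u v w; exact: gl.
- by move=> v; have /andP[] := cC x v Mx.
- by move=> v; have /andP[] := cC x v Mx.
Qed.

Lemma W_quadratic_expansion (Dg : V -> V -> V -> seq V -> R) (rho K c C : R) :
  0 < rho -> 0 <= K -> (forall x, `|x - y| < rho -> M x) ->
  (forall x, M x -> metric_form c C (g (iota x))) ->
  (forall a b, jet m y rho (K * `|a| * `|b|) (Dg a b)) ->
  (forall a b x, `|x - y| < rho -> Dg a b x [::] = g (iota x) a b) ->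
  exists K' r : R, [/\ 0 <= K', 0 < r, r <= rho & forall a b,
    `|a - y| < r -> `|b - y| < r ->
    `|W a b - g (iota a) (b - a) (b - a)| <= K' * `|b - a| ^+ 3].
Proof.
move=> rho0 K0 rhoM gform Jg Dg0.
have My : M y by apply: rhoM; rewrite subrr normr0.
have c0 := mform_c0 (gform y My); have C0 := mform_C0 (gform y My).
have gL a b u : `|a - y| < rho -> `|b - y| < rho ->
    `|g (iota a) u u - g (iota b) u u| <= K * `|a - b| * `|u| ^+ 2.
  move=> ar br; rewrite -!Dg0//.
  have := @jet_taylor1 _ _ _ _ _ _ _ (Jg u u) b (a - b) [::].
  rewrite subrKC nprod0 mulr1 => /(_ (leq_trans _ m4) br ar) H.
  apply: le_trans (H _) _ => //.
  by rewrite le_eqVlt; apply/orP; left; apply/eqP; ring.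
have [K1 [r1 [K10 r10 r1rho H1]]] := rdist_local gform rhoM gL rho0 K0 c0 C0.
have [Cw [dl [Cw0 dl0 H2]]] := W_consistent My.
pose r := Num.min (Num.min r1 dl) 2^-1.
(* Once |d| <= 1, dist^2 = e <= (C + K1) |d|^2, so that dist^3 <= S^3 |d|^3; the bound 2^-1 in the
   radius ensures |d| <= 1. *)
pose S := Num.sqrt (C + K1).
have S0 : 0 <= S by exact: sqrtr_ge0.
exists (Cw * S ^+ 3 + K1), r; split.
- by rewrite addr_ge0// mulr_ge0 ?exprn_ge0// ltW.
- by rewrite !lt_min r10 dl0 invr_gt0 ltr0n.
- by rewrite !ge_min r1rho.
move=> a b; rewrite !lt_min => /andP[/andP[ar1 ad] a2] /andP[/andP[br1 bd] b2].
have [e [e0 rE] eE] := H1 a b ar1 br1.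
have Ma : M a by apply: rhoM; rewrite (lt_le_trans ar1).
have Mb : M b by apply: rhoM; rewrite (lt_le_trans br1).
have := H2 a b Ma Mb ad bd; rewrite rE.
rewrite -!EFin_expe -EFinM lee_fin /= sqr_sqrtr// => H3.
set d := b - a in eE *.
have d1 : `|d| <= 1.
  rewrite /d -(subrK y b) -addrA (le_trans (ler_normD _ _))// (distrC y).
  by move: a2 b2; lra.
have eS : Num.sqrt e <= S * `|d|.
  rewrite -[`|d|]ger0_norm// -sqrtr_sqr -sqrtrM; last by rewrite addr_ge0// ltW.
  apply: ler_wsqrtr; rewrite mulrDl.
  have H4 := mform_bound (gform a Ma) d.
  have H5 : K1 * `|d| ^+ 3 <= K1 * `|d| ^+ 2.
    by rewrite ler_wpM2l// exprS ler_piMl// exprn_ge0.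
  rewrite ler_norml in eE; case/andP: eE => _ eE.
  by move: H4 H5 eE; lra.
have eS3 : Num.sqrt e ^+ 3 <= S ^+ 3 * `|d| ^+ 3.
  by rewrite -exprMn lerXn2r ?nnegrE ?mulr_ge0 ?sqrtr_ge0.
have H6 := ler_wpM2l (ltW Cw0) eS3.
move: H3 eE H6; rewrite !ler_norml => /andP[? ?] /andP[? ?] ?.
by rewrite mulrDl; apply/andP; split; lra.
Qed.

Lemma local_structure_exists : exists (dW : V * V -> seq (V * V) -> R)
    (dg : V -> V -> V -> seq V -> R) (rho K c C : R),
  [/\ local_structure m y rho K c C dW dg,
      forall x, `|x - y| < rho -> M x,
      forall p q psi, `|p - y| < rho -> `|q - y| < rho ->
        'd (fun q => W p q) q psi = dW (p, q) [:: (0, psi)] /\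
        'd (fun p => W p q) p psi = dW (p, q) [:: (psi, 0)],
      forall x a b, `|x - y| < rho -> dg a b x [::] = g (iota x) a b &
      forall x a b w, `|x - y| < rho ->
        'D_w (fun q => g (iota q) a b) x = dg a b x [:: w]].
Proof.
have [c [C gform]] := riemannian_metric_form.
have gZl x : M x -> forall a u w, g (iota x) (a *: u) w = a * g (iota x) u w.
  by move=> Mx a u w; rewrite (mformZl (gform x Mx)).
have gZr x : M x -> forall a u w, g (iota x) w (a *: u) = a * g (iota x) w u.
  by move=> Mx a u w; rewrite (mformZr (gform x Mx)).
have [Dg [rho1 [K1 [rho10 K10 rho1M Jg Dg0]]]] := metric_jets g_Cm gZl gZr y_int.
have intW : (M `*` M)° (y, y).
  move/interior_norm: y_int => [d d0 dM]; apply/interior_norm; exists d => //.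
  by move=> [x x']; rewrite norm_pairE gt_max => /andP[/dM ? /dM].
have [DW [rho2 [K2 [rho20 K20 _ DW0 JW]]]] := Cn_on_frechet_jet W_Cm intW.
have [K3 [r [K30 r0 r1 HW]]] := W_quadratic_expansion rho10 K10 rho1M gform Jg Dg0.
pose rho := Num.min r rho2.
have rho0 : 0 < rho by rewrite lt_min r0.
have rr x : `|x - y| < rho -> `|x - y| < r by rewrite lt_min => /andP[].
have rrho1 x : `|x - y| < rho -> `|x - y| < rho1.
  by move=> /rr xr; rewrite (lt_le_trans xr).
have pr p q : `|p - y| < rho -> `|q - y| < rho -> `|(p, q) - (y, y)| < rho2.
  by rewrite !lt_min norm_pairE gt_max => /andP[_ ->] /andP[_ ->].
pose K := Num.max K1 K2.
have K0 : 0 <= K by rewrite le_max K10.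
have Jg' a b : jet m y rho (K * `|a| * `|b|) (Dg a b).
  split.
  - by move=> x s1 s2 t u v /rrho1; exact: (jet_linear (Jg a b)).
  - move=> x s /rrho1 xr sn; rewrite (le_trans (jet_bound (Jg a b) xr sn))//.
    by rewrite !ler_wpM2r ?nprod_ge0// le_max lexx.
  - by move=> x h s t /rrho1; exact: (jet_derive (Jg a b)).
have JW2 := @jet_of_frechet R _ R^o m _ rho2 K2 1 DW id JW ler01 (fun a u v => erefl)
   (fun u => ltac:(by rewrite mul1r)).
have rr2 x : `|x - (y, y)| < rho -> `|x - (y, y)| < rho2.
  by rewrite lt_min => /andP[].
have JW' : jet m (y, y) rho K DW.
  split.
  - by move=> x s1 s2 t u v /rr2; exact: (jet_linear JW2).
  - move=> x s /rr2 xr sn; rewrite (le_trans (jet_bound JW2 xr sn))// mulr1.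
    by rewrite ler_wpM2r ?nprod_ge0// le_max lexx orbT.
  - by move=> x h s t /rr2; exact: (jet_derive JW2).
have prho p q : `|p - y| < rho -> `|q - y| < rho -> `|(p, q) - (y, y)| < rho.
  by rewrite norm_pairE gt_max => -> ->.
have gform' x : `|x - y| < rho -> metric_form c C (fun a b => Dg a b x [::]).
  move=> xr; have xr1 := rrho1 x xr; have F := gform x (rho1M x xr1).
  split; rewrite ?(mform_c0 F) ?(mform_C0 F)//.
  - by move=> u v; rewrite !Dg0// (mform_sym F).
  - by move=> a u v w; rewrite !Dg0// (mform_lin F).
  - by move=> v; rewrite Dg0// (mform_coer F).
  - by move=> v; rewrite Dg0// (mform_bound F).
have Dg_lin x s a u v w : `|x - y| < rho -> (size s <= m)%N ->
    Dg (a *: u + v) w x s = a * Dg u w x s + Dg v w x s.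
  move=> xr sn; apply: (jet_combination (Jg' u w) (Jg' v w) (Jg' (a *: u + v) w)) => //.
  by move=> x' x'r; exact: (mform_lin (gform' x' x'r)).
have Dg_sym x s v w : `|x - y| < rho -> (size s <= m)%N ->
    Dg v w x s = Dg w v x s.
  move=> xr sn; have := @jet_combination _ _ _ _ _ _ _ _ _ _ _ (Jg' v w) (Jg' 0 v) (Jg' w v) 1.
  move=> /(_ _ s x xr sn); rewrite mul1r => -> //.
    have := Dg_lin x s 1 0 0 v xr sn; rewrite scaler0 addr0 mul1r => /eqP.
    by rewrite -subr_eq subrr => /eqP <-; rewrite addr0.
  move=> x' x'r; rewrite (mform_sym (gform' x' x'r) w) mul1r.
  by rewrite (mform0l (gform' x' x'r)) addr0.
(* Up to O(t^3), W(x + t al_1, x + t al_2) is its second-order Taylor polynomial and also t^2 g(de,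
   de) at the base point x + t al_1; moving this base point to x costs another O(t^3). The
   comparison determines the coefficients of order 0, 1 and 2. *)
have W012 x al : `|x - y| < rho -> DW (x, x) [:: al] = 0 /\
    2^-1 * DW (x, x) [:: al; al] = g (iota x) (al.1 - al.2) (al.1 - al.2).
  move=> xr; have xxr := prho x x xr xr.
  have F := gform x (rho1M x (rrho1 x xr)).
  have [d d0 dP] := jet_room al 0 xxr.
  pose de := al.2 - al.1.
  have gde : g (iota x) (al.1 - al.2) (al.1 - al.2) = g (iota x) de de.
    rewrite /de -opprB -scaleN1r (mformZl F) (mformZr F).
    by rewrite mulrA mulN1r opprK mul1r.
  have [|e0 e1 e2] := @quadratic_eq0 _ (DW (x, x) [::]) (DW (x, x) [:: al])
    (2^-1 * DW (x, x) [:: al; al] - g (iota x) de de)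
    (K * `|al| ^+ 3 + (K3 * `|de| ^+ 3 + K * `|al.1| * `|de| ^+ 2)) d d0.
    move=> t td; have [t0 _] := andP td; have [xtr _ _] := dP t td.
    have Hx : (x, x) + t *: al = (x + t *: al.1, x + t *: al.2) by case: (al).
    have T := @jet_taylor3 _ _ _ _ _ _ _ JW' (x, x) (t *: al) [::] m3 xxr xtr.
    have [xtr1 xtr2] : `|x + t *: al.1 - y| < rho /\ `|x + t *: al.2 - y| < rho.
      by move: xtr; rewrite Hx norm_pairE gt_max => /andP.
    have Wx := HW _ _ (rr _ xtr1) (rr _ xtr2).
    have dE : x + t *: al.2 - (x + t *: al.1) = t *: de.
      by rewrite opprD addrACA subrr add0r -scalerBr.
    have Fa := gform _ (rho1M _ (rrho1 _ xtr1)).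
    have L := @jet_taylor1 _ _ _ _ _ _ _ (Jg' de de) x (t *: al.1) [::] (leq_trans _ m4) xr xtr1.
    have {}L := L isT; rewrite !Dg0 ?nprod0 ?mulr1 ?normrZ in L; try exact: rrho1.
    rewrite dE (mformZl Fa) (mformZr Fa) normrZ in Wx.
    rewrite Hx DW0 ?nprod0 ?mulr1 /= in T; last by rewrite -Hx rr2.
    rewrite (@jetZ _ _ _ _ _ _ _ JW' (x, x) [::] [::] t al xxr) in T; last exact: leq_trans m4.
    rewrite (@jetZ _ _ _ _ _ _ _ JW' (x, x) [::] [:: t *: al] t al xxr) in T; last exact: leq_trans m4.
    rewrite (@jetZ _ _ _ _ _ _ _ JW' (x, x) [:: al] [::] t al xxr) in T; last exact: leq_trans m4.
    move: T Wx L => /=; rewrite !normrZ !(gtr0_norm t0).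
    set w0 := DW (x, x) [::]; set w1 := DW (x, x) [:: al].
    set w2 := DW (x, x) [:: al; al]; set ga := g _ de de; set gx := g _ de de.
    set ww := W _ _ => T Wx L.
    have {}L : `|t ^+ 2 * (ga - gx)| <= K * `|al.1| * `|de| ^+ 2 * t ^+ 3.
      rewrite normrM (ger0_norm (exprn_ge0 2 (ltW t0))).
      rewrite (le_trans (ler_wpM2l (exprn_ge0 2 (ltW t0)) L))//.
      by rewrite le_eqVlt; apply/orP; left; apply/eqP; ring.
    rewrite (_ : w0 + w1 * t + _ = - (ww - w0 - t * w1 - 2^-1 * (t * (t * w2)))
        + (ww - t * (t * ga)) + t ^+ 2 * (ga - gx)); last by ring.
    rewrite [leRHS](_ : _ = K * `|al| ^+ 3 * t ^+ 3 + K3 * `|de| ^+ 3 * t ^+ 3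
      + K * `|al.1| * `|de| ^+ 2 * t ^+ 3); last by ring.
    apply: (le_trans (ler_normD _ _)); apply: lerD => //.
    apply: (le_trans (ler_normD _ _)); apply: lerD; rewrite ?normrN.
      by rewrite (le_trans T)// le_eqVlt; apply/orP; left; apply/eqP; ring.
    by rewrite (le_trans Wx)// le_eqVlt; apply/orP; left; apply/eqP; ring.
  split; first exact: e1.
  by rewrite gde; apply/eqP; rewrite -subr_eq0 e2.
exists DW, Dg, rho, K, c, C; split.
- split => //.
  + by move=> x al xr; have [] := W012 x al xr.
  + move=> x al be xr; have xxr := prho x x xr xr.
    have F := gform' x xr.
    (* Only the quadratic form is known so far; the bilinear identity follows by polarisation, [sy]
       being the symmetry of the second derivative. *)
    have W2 u : DW (x, x) [:: u; u] = 2 * Dg (u.1 - u.2) (u.1 - u.2) x [::].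
      by rewrite Dg0 ?rrho1// -(W012 x u xr).2 mulrA divff ?mul1r.
    have sy := jet_sym JW' al be (s := [::]) m3 xxr K0.
    have := W2 (al + be).
    have -> : DW (x, x) [:: al + be; al + be] = DW (x, x) [:: al; al] +
       2 * DW (x, x) [:: al; be] + DW (x, x) [:: be; be].
      rewrite (@jetD _ _ _ _ _ _ _ JW' (x, x) [::] [:: al + be] al be xxr); last exact: leq_trans m4.
      rewrite (@jetD _ _ _ _ _ _ _ JW' (x, x) [:: al] [::] al be xxr); last exact: leq_trans m4.
      rewrite (@jetD _ _ _ _ _ _ _ JW' (x, x) [:: be] [::] al be xxr); last exact: leq_trans m4.
      by rewrite /= -sy; ring.
    rewrite !W2 /= opprD addrACA.
    move: (al.1 - al.2) (be.1 - be.2) => a b.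
    rewrite (mformDl F) !(mformDr F) (mform_sym F b a) => H.
    by move: H; lra.
- by move=> x /rrho1; exact: rho1M.
- move=> p q psi pr' qr'; have pq := pr p q pr' qr'.
  have D0 : forall p' q', `|p' - y| < rho -> `|q' - y| < rho -> DW (p', q') [::] = W p' q'.
    by move=> p' q' p'r q'r; rewrite DW0//; exact: pr.
  have nr (v v' : V) (d : R) : 0 < d -> `|v - y| < rho ->
      \forall v' \near v, `|v' - v| < d /\ `|v' - y| < rho.
    move=> d0 vr; have := near_norm_lt vr; have : `|v - v| < d by rewrite subrr normr0.
    by move=> /near_norm_lt; apply: filterS2.
  have m0 : (size ([::] : seq (V * V)) < m)%N by exact: leq_trans m4.
  have b1 al : `|DW (p, q) [:: al]| <= K2 * `|al|.
    have := jet_bound JW2 pq (s := [:: al]); rewrite nprod_cons nprod0 !mulr1.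
    by apply; exact: leq_trans m4.
  split.
    apply: (@diff_frechet _ _ R^o _ q (fun psi => DW (p, q) [:: (0, psi)]) K2).
    + move=> e e0; have /nbhs_ballP[d /= d0 dP] := fjet_diff JW pq m0 e0.
      have := nr q q d d0 qr'; apply: filterS => q' [q'd q'r].
      have /dP : ball (p, q) d (p, q').
        by rewrite -ball_normE /= norm_pairE gt_max subrr normr0 d0 distrC.
      have -> : (p, q') - (p, q) = (0, q' - q) by congr (_, _); rewrite /= subrr.
      by rewrite norm_pairE normr0 (max_r (normr_ge0 _)) !D0.
    + move=> a u v; have := fjet_linear JW (s1 := [::]) (s2 := [::]) a (0, u) (0, v) pq m0.
      rewrite /= => <-; congr (DW _ [:: _]); congr (_, _).
      by rewrite /= scaler0 addr0.
    + by move=> u; rewrite (le_trans (b1 _))// norm_pairE normr0 (max_r (normr_ge0 _)).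
  apply: (@diff_frechet _ _ R^o (fun p => W p q) p (fun psi => DW (p, q) [:: (psi, 0)]) K2).
  + move=> e e0; have /nbhs_ballP[d /= d0 dP] := fjet_diff JW pq m0 e0.
    have := nr p p d d0 pr'; apply: filterS => p' [p'd p'r].
    have /dP : ball (p, q) d (p', q).
      by rewrite -ball_normE /= norm_pairE gt_max subrr normr0 d0 distrC p'd.
    have -> : (p', q) - (p, q) = (p' - p, 0) by congr (_, _); rewrite /= subrr.
    by rewrite norm_pairE normr0 (max_l (normr_ge0 _)) !D0.
  + move=> a u v; have := fjet_linear JW (s1 := [::]) (s2 := [::]) a (u, 0) (v, 0) pq m0.
    rewrite /= => <-; congr (DW _ [:: _]); congr (_, _).
    by rewrite /= scaler0 addr0.
  + by move=> u; rewrite (le_trans (b1 _))// norm_pairE normr0 (max_l (normr_ge0 _)).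
- by move=> x a b xr; rewrite Dg0// rrho1.
move=> x a b w xr; rewrite derive_along_line.
have x0r : `|x + (0 : R) *: w - y| < rho by rewrite scale0r addr0.
have m0 : (size ([::] : seq V) < m)%N by exact: leq_trans m4.
have := jet_derive (Jg' a b) x0r m0; rewrite scale0r addr0 => -[_ <-].
apply: near_eq_derive.
have [d d0 dP] := jet_room w 0 xr.
have [d' d'0 dP'] := jet_room (- w) 0 xr.
apply/nbhs_ballP; exists (Num.min d d'); rewrite /= ?lt_min ?d0//.
move=> t; rewrite -ball_normE /= sub0r normrN lt_min => /andP[td td'].
rewrite Dg0//; apply: rrho1.
have [t0|t0|<-] := ltgtP 0 t.
- by rewrite gtr0_norm// in td; have [] := dP t ltac:(by rewrite t0).
- rewrite ltr0_norm// in td'; have [] := dP' (- t) ltac:(by rewrite oppr_gt0 t0).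
  by rewrite scaleNr scalerN opprK.
by rewrite scale0r addr0.
Qed.
End local_structure_existence.

(** * Discrete Euler-Lagrange equations *)

Section transport_equations.
Variables (R : realType) (V : completeNormedModType R) (m : nat) (y : V).
Variables (rho K c C : R) (dW : V * V -> seq (V * V) -> R).
Variable (dg : V -> V -> V -> seq V -> R).
Hypothesis LS : local_structure m y rho K c C dW dg.
Hypothesis m4 : (4 <= m)%N.
Local Notation gx x := (fun a b => dg a b x [::]).

Let K0 : 0 <= K. Proof. exact: ls_K LS. Qed.
Let JW := ls_jetW LS.
Let GF x (xr : `|x - y| < rho) := ls_form LS xr.

Lemma pair_near p q : `|p - y| < rho -> `|q - y| < rho ->
  `|(p, q) - (y, y)| < rho.
Proof. by rewrite norm_pairE gt_max => -> ->. Qed.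

Lemma ls_dg0 x s w : `|x - y| < rho -> (size s <= m)%N -> dg 0 w x s = 0.
Proof.
move=> xr sn; have := ls_dg_lin LS 1 0 0 w xr sn.
by rewrite scaler0 addr0 mul1r => /eqP; rewrite -subr_eq subrr => /eqP <-.
Qed.

Lemma ls_dgZ x s a v w : `|x - y| < rho -> (size s <= m)%N ->
  dg (a *: v) w x s = a * dg v w x s.
Proof.
by move=> xr sn; have := ls_dg_lin LS a v 0 w xr sn; rewrite addr0 ls_dg0// addr0.
Qed.

Lemma ls_dgD x s v v' w : `|x - y| < rho -> (size s <= m)%N ->
  dg (v + v') w x s = dg v w x s + dg v' w x s.
Proof.
by move=> xr sn; have := ls_dg_lin LS 1 v v' w xr sn; rewrite scale1r mul1r.
Qed.

Lemma ls_dgN x s v w : `|x - y| < rho -> (size s <= m)%N ->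
  dg (- v) w x s = - dg v w x s.
Proof. by move=> xr sn; rewrite -scaleN1r ls_dgZ// mulN1r. Qed.

Lemma ls_dgNN x s v w : `|x - y| < rho -> (size s <= m)%N ->
  dg (- v) (- w) x s = dg v w x s.
Proof.
by move=> xr sn; rewrite ls_dgN// (ls_dg_sym LS)// ls_dgN// opprK (ls_dg_sym LS).
Qed.

(* Along the diagonal the second derivative of W is 2 g, so its derivative in a
   diagonal direction is that of 2 g. *)
Lemma ls_W3_diag x q al be : `|x - y| < rho ->
  dW (x, x) [:: (q, q); al; be] = 2 * dg (al.1 - al.2) (be.1 - be.2) x [:: q].
Proof.
move=> xr; have xxr := pair_near xr xr.
have x0r : `|x + (0 : R) *: q - y| < rho by rewrite scale0r addr0.
have xx0r : `|(x, x) + (0 : R) *: (q, q) - (y, y)| < rho by rewrite scale0r addr0.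
have s2 : (size [:: al; be] < m)%N by exact: leq_trans m4.
have s0 : (size ([::] : seq V) < m)%N by exact: leq_trans m4.
have H1 := jet_derive JW xx0r s2.
have H2 := jet_derive (ls_jetg LS (al.1 - al.2) (be.1 - be.2)) x0r s0.
rewrite !scale0r !addr0 in H1 H2.
have H3 : is_derive (0 : R) 1 (fun t : R => 2 * dg (al.1 - al.2) (be.1 - be.2) (x + t *: q) [::])
   (2 * dg (al.1 - al.2) (be.1 - be.2) x [:: q]) by exact: is_deriveZ.
case: H1 => _ <-; case: H3 => _ <-; apply: near_eq_derive.
have [d d0 dP] := jet_room q 0 xr.
have [d' d'0 dP'] := jet_room (- q) 0 xr.
apply/nbhs_ballP; exists (Num.min d d'); rewrite /= ?lt_min ?d0//.
move=> t; rewrite -ball_normE /= sub0r normrN lt_min => /andP[td td'].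
apply: (ls_W2 LS).
have [t0|t0|<-] := ltgtP 0 t.
- by rewrite gtr0_norm// in td; have [] := dP t ltac:(by rewrite t0).
- rewrite ltr0_norm// in td'; have [] := dP' (- t) ltac:(by rewrite oppr_gt0 t0).
  by rewrite scaleNr scalerN opprK.
by rewrite scale0r addr0.
Qed.

(* 2 g_x(Gamma_x(z, v), r) *)
Definition christoffel_form x z v r : R :=
  dg z r x [:: v] - dg z v x [:: r] + dg v r x [:: z].

(* The terms of order tau ^ 2 of the two equations.  Each argument pair is split
   into a diagonal vector (q, q) and a vector (0, a); the terms which are cubic
   in the latter cancel. *)
Lemma transport_identity x v z r : `|x - y| < rho ->
  let c1 := 2^-1 *: (v + z) in
  2^-1 * dW (x, x) [:: (z, c1); (z, c1); (0, r)]
  + 2^-1 * dW (x, x) [:: (c1, v); (c1, v); (r, 0)]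
  - 2^-1 * dW (x, x) [:: (0, c1); (0, c1); (0, r)]
  - 2^-1 * dW (x, x) [:: (c1, v + z); (c1, v + z); (r, 0)]
  = christoffel_form x z v r.
Proof.
move=> xr c1; have xxr := pair_near xr xr.
(* z, c1, v is an arithmetic progression with step e, and 0, c1, v + z is one with step c1. Within
   each progression both pairs of consecutive points are therefore a diagonal vector plus the same
   vector (0, step). *)
pose e := 2^-1 *: (v - z).
have m1 : (1 <= m)%N by exact: leq_trans m4.
pose T a b := dW (x, x) [:: (0, a); (0, b); (0, r)].
have s3 : (size ([::] : seq (V * V)) + 3 <= m)%N by exact: leq_trans m4.
have s4 : (size ([::] : seq (V * V)) + 4 <= m)%N by exact: m4.
have sw01 al be ga : dW (x, x) [:: al; be; ga] = dW (x, x) [:: be; al; ga].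
  by rewrite (jet_sym JW al be (s := [:: ga])).
have sw12 al be ga : dW (x, x) [:: al; be; ga] = dW (x, x) [:: al; ga; be].
  by rewrite (jet_symS JW al be ga (s := [::])).
have dd q q' al : dW (x, x) [:: (q, q); (q', q'); al] = 0.
  by rewrite ls_W3_diag//= subrr ls_dg0// mulr0.
have doo q a b : dW (x, x) [:: (q, q); (0, a); (0, b)] = 2 * dg a b x [:: q].
  by rewrite ls_W3_diag//= !sub0r ls_dgNN.
have D0 u v' be ga : dW (x, x) [:: u + v'; be; ga]
    = dW (x, x) [:: u; be; ga] + dW (x, x) [:: v'; be; ga].
  exact: (jetD JW (s1 := [::]) (s2 := [:: be; ga])).
have D1 u v' be ga : dW (x, x) [:: be; u + v'; ga]
    = dW (x, x) [:: be; u; ga] + dW (x, x) [:: be; v'; ga].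
  exact: (jetD JW (s1 := [:: be]) (s2 := [:: ga])).
have D2 u v' be ga : dW (x, x) [:: be; ga; u + v']
    = dW (x, x) [:: be; ga; u] + dW (x, x) [:: be; ga; v'].
  exact: (jetD JW (s1 := [:: be; ga]) (s2 := [::])).
have D2N u be ga : dW (x, x) [:: be; ga; - u] = - dW (x, x) [:: be; ga; u].
  rewrite -scaleN1r -[RHS]mulN1r.
  exact: (jetZ JW (s1 := [:: be; ga]) (s2 := [::])).
have quad q a : dW (x, x) [:: (q, q) + (0, a); (q, q) + (0, a); (0, r)]
    = 4 * dg a r x [:: q] + T a a.
  rewrite D0 !D1 dd doo [dW _ [:: (0, a); (q, q); _]]sw01 doo /T; ring.
have quadr q a : dW (x, x) [:: (q, q) + (0, a); (q, q) + (0, a); (r, r)]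
    = 2 * dg a a x [:: r].
  rewrite sw12 sw01 D1 dd add0r sw12 D1.
  by rewrite dd add0r doo.
have rE : (r, 0) = (r, r) + - (0, r) :> V * V.
  by congr (_, _); rewrite /= ?subr0 ?subrr.
have dbl (u : V) : 2^-1 *: (u + u) = u.
  by rewrite scalerDr -scalerDl (_ : 2^-1 + 2^-1 = 1 :> R) ?scale1r//; field.
have halfv : v = c1 + e by rewrite /c1 /e -scalerDr addrACA subrr addr0 dbl.
have halfz : c1 = z + e.
  by rewrite /c1 /e -[X in _ = X + _](dbl z) -scalerDr addrACA subrr addr0 addrC.
have E1 : (z, c1) = (z, z) + (0, e) by congr (_, _); rewrite /= ?addr0// -halfz.
have E2 : (c1, v) = (c1, c1) + (0, e) by congr (_, _); rewrite /= ?addr0// -halfv.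
have E4 : (c1, v + z) = (c1, c1) + (0, c1).
  congr (_, _); rewrite /= ?addr0// /c1 -scalerDr dbl //.
rewrite E1 E2 E4 rE quad !D2 !D2N !quad !quadr -/(T c1 c1).
have s1 q : (size [:: q] <= m)%N by [].
have jl a b q q' : dg a b x [:: 2^-1 *: (q + q')] = 2^-1 * (dg a b x [:: q] + dg a b x [:: q']).
  rewrite (jetZ (ls_jetg LS a b) (s1 := [::]) (s2 := [::]))//=.
  by rewrite (jetD (ls_jetg LS a b) (s1 := [::]) (s2 := [::])).
have lin2 a b a' q : dg (2^-1 *: (a + b)) a' x [:: q] = 2^-1 * (dg a a' x [:: q] + dg b a' x [:: q]).
  by rewrite ls_dgZ// ls_dgD.
have lin2' a b a' q : dg a' (2^-1 *: (a + b)) x [:: q] = 2^-1 * (dg a' a x [:: q] + dg a' b x [:: q]).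
  by rewrite !(ls_dg_sym LS a')// lin2.
have nl b q : dg (- z) b x [:: q] = - dg z b x [:: q] by rewrite ls_dgN.
have nr b q : dg b (- z) x [:: q] = - dg b z x [:: q].
  by rewrite !(ls_dg_sym LS b)// nl.
rewrite /christoffel_form {quad quadr halfv halfz E1 E2 E4}.
rewrite /e /c1 !jl !lin2 !lin2' !nl !nr !(ls_dg_sym LS v z)//.
by field.
Qed.

(** The term k c / 2 |de| is half of what coercivity gives on the left; absorbing it costs the
    factor 2 in the conclusion. *)
Lemma mform_stability (G : V -> V -> R) (k eta : R) (de : V) :
  metric_form c C G -> 0 < k -> 0 <= eta ->
  (forall r, k * `|G de r| <= (eta + k * c / 2 * `|de|) * `|r|) ->
  `|de| <= 2 * eta / (k * c).
Proof.
move=> G_form k0 eta0 H; have c0 := mform_c0 G_form.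
have kc0 : 0 < k * c by rewrite mulr_gt0.
have kd0 : 0 <= k * c / 2 * `|de| by rewrite !mulr_ge0// ltW.
have H1 : `|de| <= (eta + k * c / 2 * `|de|) / k / c.
  apply: (mform_norm_le G_form); first by rewrite divr_ge0 ?addr_ge0 ?(ltW k0).
  by move=> r; rewrite mulrAC ler_pdivlMr// mulrC.
move: H1; rewrite ler_pdivlMr// ler_pdivlMr// ler_pdivlMr//.
lra.
Qed.

(* The discrete Euler-Lagrange equation in the middle of the chain (p, q, s). *)
Definition el p q s r : R := dW (p, q) [:: (0, r)] + dW (q, s) [:: (r, 0)].

Section frozen_point.
Variables (x : V) (Rad : R).
Hypotheses (xr : `|x - y| < rho / 2) (Rad0 : 0 < Rad) (Rad_rho : Rad <= rho / 2).
Hypothesis Rad_c : 3 * K * Rad <= c.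

Let rho0 : 0 < rho. Proof. exact: ls_rho LS. Qed.
Let xr' : `|x - y| < rho.
Proof. by rewrite (lt_le_trans xr)// ler_pdivrMr// ler_pMr// ler1n. Qed.
Let xxr : `|(x, x) - (y, y)| < rho. Proof. exact: pair_near. Qed.
Let G_form := GF xr'.
Let c0 : 0 < c. Proof. exact: mform_c0 G_form. Qed.
Let s2 (al : V * V) : (size [:: al] + 2 <= m)%N. Proof. exact: leq_trans m4. Qed.
Let s1 (al : V * V) : (size [:: al] < m)%N. Proof. exact: leq_trans m4. Qed.
Let s0 : (size ([::] : seq (V * V)) < m)%N. Proof. exact: leq_trans m4. Qed.

Lemma near_center p : `|p - x| <= Rad -> `|p - y| < rho.
Proof.
move=> pR; rewrite -(subrK x p) -addrA (le_lt_trans (ler_normD _ _))//.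
rewrite (_ : rho = rho / 2 + rho / 2); last by field.
by apply: ler_ltD => //; exact: le_trans Rad_rho.
Qed.

Lemma ls_g_opp a b : dg (- a) (- b) x [::] = dg a b x [::].
Proof. by rewrite ls_dgNN. Qed.

Lemma ls_W2_22 a b : dW (x, x) [:: (0, a); (0, b)] = 2 * dg a b x [::].
Proof. by rewrite (ls_W2 LS)//= !sub0r ls_g_opp. Qed.

Lemma ls_W2_11 a b : dW (x, x) [:: (a, 0); (b, 0)] = 2 * dg a b x [::].
Proof. by rewrite (ls_W2 LS)//= !subr0. Qed.

Lemma ls_W2_12 a b : dW (x, x) [:: (a, 0); (0, b)] = - (2 * dg a b x [::]).
Proof. by rewrite (ls_W2 LS)//= subr0 sub0r (ls_dg_sym LS)// ls_dgN// mulrN (ls_dg_sym LS). Qed.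

Lemma norm_pair0l (u : V) : `|(0, u) : V * V| = `|u|.
Proof. by rewrite norm_pairE normr0 (max_r (normr_ge0 _)). Qed.

Lemma norm_pair0r (u : V) : `|(u, 0) : V * V| = `|u|.
Proof. by rewrite norm_pairE normr0 (max_l (normr_ge0 _)). Qed.

Lemma nprod_pair0l (u : V) : nprod [:: ((0, u) : V * V)] = `|u|.
Proof. by rewrite nprod_cons nprod0 mulr1 norm_pair0l. Qed.

Lemma nprod_pair0r (u : V) : nprod [:: ((u, 0) : V * V)] = `|u|.
Proof. by rewrite nprod_cons nprod0 mulr1 norm_pair0r. Qed.

Let lin p q p' q' al : `|p - x| <= Rad -> `|q - x| <= Rad ->
  `|p' - x| <= Rad -> `|q' - x| <= Rad ->
  `|dW (p, q) [:: al] - dW (p', q') [:: al]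
     - dW (x, x) [:: (p - p', q - q'); al]|
    <= 3 * K * Rad * `|(p - p', q - q') : V * V| * nprod [:: al].
Proof.
move=> pR qR p'R q'R.
apply: (@jet_linearization _ _ _ _ _ _ _ JW (x, x) (p, q) (p', q') [:: al] Rad) => //.
- by apply: pair_near; exact: near_center.
- by apply: pair_near; exact: near_center.
- by rewrite norm_pairE ge_max pR.
- by rewrite norm_pairE ge_max p'R.
Qed.

(** The middle point enters both copies of W, each with second derivative 2 g_x, whence 4 g_x. Each
    linearization error has the factor 3 K Rad <= c, and their sum 2 c is the tolerance kappa c / 2
    of [mform_solve] for kappa = 4. *)
Lemma el_sub_mid p q q' s r : `|p - x| <= Rad -> `|q - x| <= Rad ->
  `|q' - x| <= Rad -> `|s - x| <= Rad ->
  `|el p q s r - el p q' s r - 4 * dg (q - q') r x [::]|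
    <= 4 * c / 2 * `|q - q'| * `|r|.
Proof.
move=> pR qR q'R sR.
have := @lin p q p q' (0, r) pR qR pR q'R.
have := @lin q s q' s (r, 0) qR sR q'R sR.
rewrite !subrr ls_W2_22 ls_W2_11 norm_pair0l norm_pair0r nprod_pair0l nprod_pair0r.
have H : 3 * K * Rad * `|q - q'| * `|r| <= c * `|q - q'| * `|r|.
  by rewrite !ler_wpM2r.
move=> H1 H2; have {H1} := le_trans H1 H; have {H2} := le_trans H2 H.
rewrite /el !ler_norml => /andP[? ?] /andP[? ?]; apply/andP; split; lra.
Qed.

Lemma el_sub_fst p p' q s r : `|p - x| <= Rad -> `|p' - x| <= Rad ->
  `|q - x| <= Rad ->
  `|- el p q s r - - el p' q s r - 2 * dg (p - p') r x [::]|
    <= 2 * c / 2 * `|p - p'| * `|r|.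
Proof.
move=> pR p'R qR.
have := @lin p q p' q (0, r) pR qR p'R qR.
rewrite !subrr ls_W2_12 norm_pair0r nprod_pair0l.
have H : 3 * K * Rad * `|p - p'| * `|r| <= 2 * c / 2 * `|p - p'| * `|r|.
  by rewrite (_ : 2 * c / 2 = c) ?ler_wpM2r//; field.
move=> H1; have {H1} := le_trans H1 H.
by rewrite /el !ler_norml => /andP[? ?]; apply/andP; split; lra.
Qed.

Lemma el_mid_stable p q q' s eta : `|p - x| <= Rad -> `|q - x| <= Rad ->
  `|q' - x| <= Rad -> `|s - x| <= Rad -> 0 <= eta ->
  (forall r, `|el p q s r - el p q' s r| <= eta * `|r|) ->
  `|q - q'| <= 2 * eta / (4 * c).
Proof.
move=> pR qR q'R sR eta0 H; apply: (mform_stability G_form) => // r.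
have := @el_sub_mid p q q' s r pR qR q'R sR; have := H r.
rewrite (_ : 4 * `|_| = `|4 * dg (q - q') r x [::]|); last by rewrite normrM ger0_norm.
rewrite mulrDl.
rewrite !ler_norml => /andP[? ?] /andP[? ?]; apply/andP; split; lra.
Qed.

Lemma el_fst_stable p p' q s eta : `|p - x| <= Rad -> `|p' - x| <= Rad ->
  `|q - x| <= Rad -> 0 <= eta ->
  (forall r, `|el p q s r - el p' q s r| <= eta * `|r|) ->
  `|p - p'| <= 2 * eta / (2 * c).
Proof.
move=> pR p'R qR eta0 H; apply: (mform_stability G_form) => // r.
have := @el_sub_fst p p' q s r pR p'R qR; have := H r.
rewrite (_ : 2 * `|_| = `|2 * dg (p - p') r x [::]|); last by rewrite normrM ger0_norm.
rewrite mulrDl.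
rewrite !ler_norml => /andP[? ?] /andP[? ?]; apply/andP; split; lra.
Qed.

Lemma el_lin p q s a u v : `|p - x| <= Rad -> `|q - x| <= Rad -> `|s - x| <= Rad ->
  el p q s (a *: u + v) = a * el p q s u + el p q s v.
Proof.
move=> pR qR sR; rewrite /el.
have E1 : (0, a *: u + v) = a *: (0, u) + (0, v) :> V * V.
  by congr (_, _); rewrite /= scaler0 addr0.
have E2 : (a *: u + v, 0) = a *: (u, 0) + (v, 0) :> V * V.
  by congr (_, _); rewrite /= scaler0 addr0.
rewrite E1 E2 (jet_linear JW (s1 := [::]) (s2 := [::]))//; last first.
  by apply: pair_near; exact: near_center.
rewrite (jet_linear JW (s1 := [::]) (s2 := [::]))//; last first.
  by apply: pair_near; exact: near_center.
by rewrite /=; ring.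
Qed.

Lemma el_bound p q s r : `|p - x| <= Rad -> `|q - x| <= Rad -> `|s - x| <= Rad ->
  `|el p q s r| <= 2 * K * `|r|.
Proof.
move=> pR qR sR.
have H1 := jet_bound JW (pair_near (near_center pR) (near_center qR)) (ltnW (s1 (0, r))).
have H2 := jet_bound JW (pair_near (near_center qR) (near_center sR)) (ltnW (s1 (r, 0))).
rewrite nprod_pair0l in H1; rewrite nprod_pair0r in H2.
rewrite /el (le_trans (ler_normD _ _))// (_ : 2 * K = K + K); last by ring.
by rewrite mulrDl lerD.
Qed.

(** First derivatives of W vanish on the diagonal, so the residual at the centre is of the size of
    the data: this is the starting error of the Newton iteration. *)
Lemma el_center q s r : `|q - x| <= Rad -> `|s - x| <= Rad ->
  `|el x q s r| <= 2 * K * (`|q - x| + `|s - x|) * `|r|.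
Proof.
move=> qR sR; have xR : `|x - x| <= Rad by rewrite subrr normr0 ltW.
have H1 := @jet_taylor1 _ _ _ _ _ _ _ JW (x, x) (0, q - x) [:: (0, r)] (s1 _) xxr.
have H2 := @jet_taylor1 _ _ _ _ _ _ _ JW (x, x) (q - x, s - x) [:: (r, 0)] (s1 _) xxr.
have E1 : (x, x) + (0, q - x) = (x, q) :> V * V by congr (_, _); rewrite /= ?addr0 ?subrKC.
have E2 : (x, x) + (q - x, s - x) = (q, s) :> V * V by congr (_, _); rewrite /= subrKC.
rewrite E1 (ls_W1 LS)// subr0 norm_pair0l nprod_pair0l in H1.
rewrite E2 (ls_W1 LS)// subr0 nprod_pair0r in H2.
have {}H1 := H1 (pair_near (near_center xR) (near_center qR)).
have {}H2 := H2 (pair_near (near_center qR) (near_center sR)).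
rewrite /el (le_trans (ler_normD _ _))//; apply: (le_trans (lerD H1 H2)).
rewrite norm_pairE; set A := `|q - x|; set B := `|s - x|.
have A0 : 0 <= A by rewrite /A.
have B0 : 0 <= B by rewrite /B.
have H : Num.max A B <= A + B by rewrite ge_max lerDl lerDr B0.
have := ler_wpM2r (normr_ge0 r) (ler_wpM2l K0 H).
have : 0 <= K * B * `|r| by rewrite !mulr_ge0.
by lra.
Qed.

Lemma el_mid_solve s r : 0 < r -> r <= Rad -> `|s - x| <= Rad ->
  2 * K * `|s - x| <= 2 * c * r ->
  exists2 q, `|q - x| <= r & forall h, el x q s h = 0.
Proof.
move=> r0 rRad sR small; have xR : `|x - x| <= Rad by rewrite subrr normr0 ltW.
apply: (@mform_solve _ _ c C (gx x) G_form (fun q => el x q s) x r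
   (2 * K * `|s - x|) 4 (2 * K)) => //.
- by rewrite !mulr_ge0.
- by move=> p a u v pr; apply: el_lin => //; exact: le_trans rRad.
- by move=> p h pr; apply: el_bound => //; exact: le_trans rRad.
- by move=> p p' h pr p'r; apply: el_sub_mid => //; exact: le_trans rRad.
- move=> h; have := @el_center x s h xR sR.
  by rewrite subrr normr0 add0r.
- by move: small; lra.
Qed.

Lemma el_fst_solve q s r : 0 < r -> r <= Rad -> `|q - x| <= Rad -> `|s - x| <= Rad ->
  2 * K * (`|q - x| + `|s - x|) <= c * r ->
  exists2 p, `|p - x| <= r & forall h, el p q s h = 0.
Proof.
move=> r0 rRad qR sR small.
have small' : 2 * K * (`|q - x| + `|s - x|) <= 2 * c * r / 2.
  by move: small; lra.
have [|||||//|p pr H] := @mform_solve _ _ c C (gx x) G_form (fun p h => - el p q s h) x r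
   (2 * K * (`|q - x| + `|s - x|)) 2 (2 * K) r0 (ltr0n R 2).
- by rewrite !mulr_ge0// addr_ge0.
- move=> p a u v pr; rewrite el_lin//; last exact: le_trans rRad.
  by ring.
- by move=> p h pr; rewrite normrN; apply: el_bound => //; exact: le_trans rRad.
- by move=> p p' h pr p'r; apply: el_sub_fst => //; exact: le_trans rRad.
- by move=> h; rewrite normrN; exact: el_center.
by exists p => // h; apply/eqP; rewrite -oppr_eq0 H.
Qed.
End frozen_point.
End transport_equations.

(** * Solutions of the transport system and their expansion in tau *)

Section transport_expansion.
Variables (R : realType) (V : completeNormedModType R) (m : nat) (y : V).
Variables (rho K c C : R) (dW : V * V -> seq (V * V) -> R).
Variable (dg : V -> V -> V -> seq V -> R).
Hypothesis LS : local_structure m y rho K c C dW dg.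
Hypothesis m4 : (4 <= m)%N.
Local Notation el := (el dW).

Let K0 : 0 <= K. Proof. exact: ls_K LS. Qed.
Let JW := ls_jetW LS.

Section el_curves.
Variables (x : V) (a1 a2 a3 b1 b2 b3 e1 e2 e3 : V) (B tau : R).
Hypotheses (xr : `|x - y| < rho) (B1 : 1 <= B) (tau1 : `|tau| <= 1).
Hypotheses (a1B : `|a1| <= B) (a2B : `|a2| <= B) (a3B : `|a3| <= B * `|tau| ^+ 3).
Hypotheses (b1B : `|b1| <= B) (b2B : `|b2| <= B) (b3B : `|b3| <= B * `|tau| ^+ 3).
Hypotheses (e1B : `|e1| <= B) (e2B : `|e2| <= B) (e3B : `|e3| <= B * `|tau| ^+ 3).
Let p := x + (tau *: a1 + (tau ^+ 2 *: a2 + a3)).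
Let q := x + (tau *: b1 + (tau ^+ 2 *: b2 + b3)).
Let s := x + (tau *: e1 + (tau ^+ 2 *: e2 + e3)).
Hypotheses (pr : `|p - y| < rho) (qr : `|q - y| < rho) (sr : `|s - y| < rho).

(** [el_linear], [el_quadratic] and [el_cubic] are Taylor coefficients of [el] at (x, x, x) when its
    three points are displaced; the linear one is written with g since the second derivative of W on
    the diagonal is known. *)
Definition el_linear (r u v w : V) : R :=
  4 * dg v r x [::] - 2 * dg u r x [::] - 2 * dg w r x [::].

Definition el_quadratic (r u v w : V) : R :=
  2^-1 * dW (x, x) [:: (u, v); (u, v); (0, r)]
  + 2^-1 * dW (x, x) [:: (v, w); (v, w); (r, 0)].

(** The part of order tau^3 produced by the displacements of first and second order; those of third
    order pass through [el_linear]. *)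
Definition el_cubic (r u1 v1 w1 u2 v2 w2 : V) : R :=
  2^-1 * (dW (x, x) [:: (u1, v1); (u2, v2); (0, r)]
          + dW (x, x) [:: (u2, v2); (u1, v1); (0, r)])
  + 6^-1 * dW (x, x) [:: (u1, v1); (u1, v1); (u1, v1); (0, r)]
  + (2^-1 * (dW (x, x) [:: (v1, w1); (v2, w2); (r, 0)]
             + dW (x, x) [:: (v2, w2); (v1, w1); (r, 0)])
     + 6^-1 * dW (x, x) [:: (v1, w1); (v1, w1); (v1, w1); (r, 0)]).

Let xxr : `|(x, x) - (y, y)| < rho. Proof. exact: pair_near. Qed.

Let lin0 (r u v : V) : dW (x, x) [:: (u, v); (0, r)] = 2 * dg v r x [::] - 2 * dg u r x [::].
Proof.
rewrite (ls_W2 LS)//= sub0r (ls_dg_sym LS)// (ls_dgN LS)// (ls_dg_sym LS)//.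
by rewrite (ls_dgD LS)// (ls_dgN LS)//; ring.
Qed.

Let lin1 (r u v : V) : dW (x, x) [:: (u, v); (r, 0)] = 2 * dg u r x [::] - 2 * dg v r x [::].
Proof.
by rewrite (ls_W2 LS)//= subr0 (ls_dgD LS)// (ls_dgN LS)//; ring.
Qed.

Let pairB (u v : V) (b : R) : `|u| <= b -> `|v| <= b -> `|(u, v) : V * V| <= b.
Proof. by move=> ub vb; rewrite norm_pairE ge_max ub. Qed.

Let pqE : (p, q) = (x, x) + (tau *: (a1, b1) + (tau ^+ 2 *: (a2, b2) + (a3, b3))).
Proof. by []. Qed.
Let qsE : (q, s) = (x, x) + (tau *: (b1, e1) + (tau ^+ 2 *: (b2, e2) + (b3, e3))).
Proof. by []. Qed.

Lemma el_curve3 r : `|el p q s r - (tau * el_linear r a1 b1 e1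
    + tau ^+ 2 * (el_linear r a2 b2 e2 + el_quadratic r a1 b1 e1))|
  <= 64 * K * B ^+ 3 * `|tau| ^+ 3 * `|r|.
Proof.
have s3 al : (size [:: al : V * V] + 3 <= m)%N by [].
have pq := pair_near pr qr; have qs := pair_near qr sr.
rewrite pqE in pq; rewrite qsE in qs.
have H1 := @jet_curve3 _ _ _ _ _ _ _ JW (x, x) (a1, b1) (a2, b2) (a3, b3) [:: (0, r)] B tau
  K0 xxr B1 (pairB a1B b1B) (pairB a2B b2B) tau1 (pairB a3B b3B) pq (s3 _).
have H2 := @jet_curve3 _ _ _ _ _ _ _ JW (x, x) (b1, e1) (b2, e2) (b3, e3) [:: (r, 0)] B tau
  K0 xxr B1 (pairB b1B e1B) (pairB b2B e2B) tau1 (pairB b3B e3B) qs (s3 _).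
move: H1 H2; rewrite -pqE -qsE !lin0 !lin1 !(ls_W1 LS)// nprod_pair0l nprod_pair0r.
rewrite /el /el_linear /el_quadratic.
rewrite !ler_norml => /andP[? ?] /andP[? ?]; apply/andP; split; lra.
Qed.

Lemma el_curve4 r : (5 <= m)%N -> `|el p q s r - (tau * el_linear r a1 b1 e1
    + tau ^+ 2 * (el_linear r a2 b2 e2 + el_quadratic r a1 b1 e1)
    + el_linear r a3 b3 e3 + tau ^+ 3 * el_cubic r a1 b1 e1 a2 b2 e2)|
  <= 180 * K * B ^+ 4 * `|tau| ^+ 4 * `|r|.
Proof.
move=> m5; have s4 al : (size [:: al : V * V] + 4 <= m)%N by [].
have pq := pair_near pr qr; have qs := pair_near qr sr.
rewrite pqE in pq; rewrite qsE in qs.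
have H1 := @jet_curve4 _ _ _ _ _ _ _ JW (x, x) (a1, b1) (a2, b2) (a3, b3) [:: (0, r)] B tau
  K0 xxr B1 (pairB a1B b1B) (pairB a2B b2B) tau1 (pairB a3B b3B) pq (s4 _).
have H2 := @jet_curve4 _ _ _ _ _ _ _ JW (x, x) (b1, e1) (b2, e2) (b3, e3) [:: (r, 0)] B tau
  K0 xxr B1 (pairB b1B e1B) (pairB b2B e2B) tau1 (pairB b3B e3B) qs (s4 _).
move: H1 H2; rewrite -pqE -qsE !lin0 !lin1 !(ls_W1 LS)// nprod_pair0l nprod_pair0r.
rewrite /el /el_linear /el_quadratic /el_cubic.
rewrite !ler_norml => /andP[? ?] /andP[? ?]; apply/andP; split; lra.
Qed.
End el_curves.

Section solutions.
Variable Rad : R.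
Hypotheses (Rad0 : 0 < Rad) (Rad_rho : Rad <= rho / 2) (Rad_c : 3 * K * Rad <= c).

Let rho0 : 0 < rho. Proof. exact: ls_rho LS. Qed.
Let half_rho x : `|x - y| < rho / 2 -> `|x - y| < rho.
Proof. by move=> xr; rewrite (lt_le_trans xr)// ler_pdivrMr// ler_pMr// ler1n. Qed.
Let c0 : 0 < c.
Proof.
have yr : `|y - y| < rho by rewrite subrr normr0.
exact: mform_c0 (ls_form LS yr).
Qed.

(** The second equation does not contain p, so it is solved first, for q in a radius r1 small enough
    to leave room for solving the other equation for p within r / 2. The radius r / 2 puts both
    points strictly inside the ball in which [transport_pairs] looks. *)
Lemma transport_solution r : 0 < r -> r <= Rad -> exists2 eps : R, 0 < eps &
  forall x u ze, `|x - y| < rho / 2 -> `|u| <= eps -> `|ze| <= eps ->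
  exists q p, [/\ `|q - x| <= r / 2, `|p - x| <= r / 2,
    forall h, el p q (x + u) h = 0 & forall h, el x q (x + u + ze) h = 0].
Proof.
move=> r0 rRad; pose r1 := Num.min (r / 2) (c * r / (8 * K + 8)).
have K8 : 0 < 8 * K + 8 by have := K0; lra.
have K2 : 0 < 2 * K + 2 by have := K0; lra.
have r10 : 0 < r1 by rewrite lt_min !divr_gt0 ?mulr_gt0.
pose eps := Num.min (r1 / 2) (c * r1 / (2 * K + 2)).
have eps0 : 0 < eps by rewrite lt_min !divr_gt0 ?mulr_gt0.
have r1r : r1 <= r / 2 by rewrite ge_min lexx.
have r1c : 2 * K * r1 <= c * r / 4.
  have : r1 <= c * r / (8 * K + 8) by rewrite ge_min lexx orbT.
  by rewrite ler_pdivlMr// => H; move: r10 H; lra.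
have er : eps <= r1 / 2 by rewrite ge_min lexx.
have ec : 2 * K * eps <= c * r1.
  have : eps <= c * r1 / (2 * K + 2) by rewrite ge_min lexx orbT.
  by rewrite ler_pdivlMr// => H; move: eps0 H; lra.
exists eps => // x u ze xr ue zee.
have sx : `|x + u + ze - x| <= 2 * eps.
  rewrite -(addrA x) addrAC subrr add0r (le_trans (ler_normD _ _))//.
  by rewrite mulr2n mulrDl mul1r lerD.
have ux : `|x + u - x| <= eps by rewrite addrAC subrr add0r.
have Kux := ler_wpM2l K0 ux; have Ksx := ler_wpM2l K0 sx.
have [||||q qr qP] := @el_mid_solve _ _ _ _ _ _ _ _ _ _ LS m4 x Rad xr Rad0 Rad_rho Rad_c (x + u + ze) r1.
- by [].
- by move: r1r rRad r0; lra.
- by apply: (le_trans sx); move: r1r rRad r0 er; lra.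
- by move: Ksx ec; lra.
have Kqr := ler_wpM2l K0 qr.
have [|||||p pr pP] := @el_fst_solve _ _ _ _ _ _ _ _ _ _ LS m4 x Rad xr Rad0 Rad_rho Rad_c q (x + u) (r / 2).
- by rewrite divr_gt0.
- by move: rRad r0; lra.
- by apply: (le_trans qr); move: r1r rRad r0; lra.
- by apply: (le_trans ux); move: er r1r rRad r0; lra.
- have := mulr_gt0 c0 r0; have := ler_wpM2l K0 er; move: Kqr Kux r1c ; lra.
by exists q, p; split => //; exact: le_trans r1r.
Qed.

Lemma transport_unique x u ze q p q' p' : `|x - y| < rho / 2 ->
  `|x + u - x| <= Rad -> `|x + u + ze - x| <= Rad ->
  `|q - x| <= Rad -> `|p - x| <= Rad -> `|q' - x| <= Rad -> `|p' - x| <= Rad ->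
  (forall h, el p q (x + u) h = 0) -> (forall h, el x q (x + u + ze) h = 0) ->
  (forall h, el p' q' (x + u) h = 0) -> (forall h, el x q' (x + u + ze) h = 0) ->
  q = q' /\ p = p'.
Proof.
move=> xr uR zR qR pR q'R p'R e1 e2 e1' e2'.
have xR : `|x - x| <= Rad by rewrite subrr normr0 ltW.
have qq : q = q'.
  apply/eqP; rewrite -subr_eq0 -normr_eq0 eq_le normr_ge0 andbT.
  have := @el_mid_stable _ _ _ _ _ _ _ _ _ _ LS m4 x Rad xr Rad_rho Rad_c
    x q q' (x + u + ze) 0 xR qR q'R zR (lexx _).
  rewrite mulr0 mul0r; apply => h.
  by rewrite e2 e2' subr0 normr0 mul0r.
split => //; rewrite -{}qq in e1'.
apply/eqP; rewrite -subr_eq0 -normr_eq0 eq_le normr_ge0 andbT.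
have := @el_fst_stable _ _ _ _ _ _ _ _ _ _ LS m4 x Rad xr Rad_rho Rad_c
    p p' q (x + u) 0 pR p'R qR (lexx _).
rewrite mulr0 mul0r; apply => h.
by rewrite e1 e1' subr0 normr0 mul0r.
Qed.

(** The order of the quantifiers matters: K' is uniform in x and in the vectors, and N is chosen
    before tau and d. The polynomials tau c1 + tau^2 c2 for q - x and tau z1 + tau^2 (z2 + Gam) for
    p - x cancel both equations through second order, the first equation by [transport_identity]. *)
Lemma transport_expansion B : 1 <= B -> exists2 K' : R, 0 <= K' &
  forall x v z1 z2 Gam, `|x - y| < rho / 2 ->
  `|v| <= B -> `|z1| <= B -> `|z2| <= B -> `|Gam| <= B ->
  (forall r, 2 * dg Gam r x [::] = christoffel_form dg x z1 v r) ->
  exists N : V -> R, forall (tau : R) d q p,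
    `|tau| <= 1 -> K' * `|tau| <= Rad -> `|d| <= B * `|tau| ^+ 3 ->
    `|q - x| <= Rad -> `|p - x| <= Rad ->
    (forall h, el p q (x + tau *: v) h = 0) ->
    (forall h, el x q (x + tau *: v + (tau *: z1 + (tau ^+ 2 *: z2 + d))) h = 0) ->
    let P := p - x - (tau *: z1 + tau ^+ 2 *: (z2 + Gam)) in
    `|P| <= K' * `|tau| ^+ 3 /\
    ((5 <= m)%N -> forall r,
      `|2 * dg P r x [::] - 2 * dg d r x [::] - tau ^+ 3 * N r|
        <= K' * `|tau| ^+ 4 * `|r|).
Proof.
move=> B_ge1.
have B_ge0 : 0 <= B by exact: le_trans B_ge1.
(* Successive bounds for the data of the curves: B1 covers c2, B2 also the cubic error of q, B3 also
   that of p. *)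
pose B1 := 2 * B + 5 * K * B ^+ 2 / c.
pose B2 := B1 + 32 * K * B1 ^+ 3 / c.
pose B3 := B2 + 64 * K * B2 ^+ 3 / c.
have q1 : 0 <= 5 * K * B ^+ 2 / c by rewrite !(divr_ge0, mulr_ge0, exprn_ge0)// ltW.
have B1B : 2 * B <= B1 by rewrite /B1 lerDl.
have B1_ge0 : 0 <= B1 by move: B1B B_ge0; lra.
have pos (k b : R) (i : nat) : 0 <= k -> 0 <= b -> 0 <= k * K * b ^+ i.
  by move=> k0 b0; rewrite mulr_ge0 ?exprn_ge0// mulr_ge0.
have q2 : 0 <= 32 * K * B1 ^+ 3 / c by apply: divr_ge0 (ltW c0); exact: pos.
have B12 : B1 <= B2 by rewrite /B2 lerDl.
have B2_ge0 : 0 <= B2 by exact: le_trans B12.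
have q3 : 0 <= 64 * K * B2 ^+ 3 / c by apply: divr_ge0 (ltW c0); exact: pos.
have B23 : B2 <= B3 by rewrite /B3 lerDl.
have B3_ge0 : 0 <= B3 by exact: le_trans B23.
have q4 : 0 <= 360 * K * B3 ^+ 4 by exact: pos (ler0n R 360) B3_ge0.
exists (3 * B3 + 360 * K * B3 ^+ 4); first by rewrite addr_ge0// mulr_ge0.
set K' := 3 * B3 + _.
have K'3 : 3 * B3 <= K' by rewrite /K' lerDl.
move=> x v z1 z2 Gam xr vB z1B z2B GB GamP.
have xr' := half_rho xr; have xxr := pair_near xr' xr'.
have F := ls_form LS xr'.
pose c1 := 2^-1 *: (v + z1).
have c1B : `|c1| <= B.
  rewrite normrZ ger0_norm ?invr_ge0// ler_pdivrMl// mulr2n mulrDl mul1r.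
  by rewrite (le_trans (ler_normD _ _))// lerD.
have vzB : `|v + z1| <= 2 * B.
  by rewrite (le_trans (ler_normD _ _))// mulr2n mulrDl mul1r lerD.
(* The part of order tau^2 of the second equation, solved for g_x(c2, r); Riesz' theorem then
   produces c2. *)
pose l r := 4^-1 * (2 * dg z2 r x [::] - 2^-1 * dW (x, x) [:: (0, c1); (0, c1); (0, r)]
   - 2^-1 * dW (x, x) [:: (c1, v + z1); (c1, v + z1); (r, 0)]).
have s3 (al : V * V) : (size [:: al] + 2 <= m)%N by exact: leq_trans m4.
have lB r : `|l r| <= (5 * K * B ^+ 2 / 4) * `|r|.
  have H1 := jet_bound (ls_jetg LS z2 r) xr' (leq0n m : size ([::] : seq V) <= m)%N.
  rewrite nprod0 mulr1 in H1.
  have H2 := @jet_le2 _ _ _ _ _ _ _ JW (x, x) (0, c1) (0, c1) [:: (0, r)] B B K0 xxr (s3 _).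
  have H3 := @jet_le2 _ _ _ _ _ _ _ JW (x, x) (c1, v + z1) (c1, v + z1) [:: (r, 0)] (2 * B) (2 * B) K0 xxr (s3 _).
  rewrite !norm_pair0l nprod_pair0l in H2.
  rewrite !norm_pairE !ge_max nprod_pair0r vzB (le_trans c1B) in H3; last by move: B_ge0; lra.
  have {}H2 := H2 c1B c1B; have {}H3 := H3 isT isT.
  have H4 : K * `|z2| * `|r| <= K * B ^+ 2 * `|r|.
    rewrite ler_wpM2r// ler_wpM2l// (le_trans z2B)// expr2 ler_peMl//.
  have {}H1 := le_trans H1 H4.
  have n0 : 0 <= K * B ^+ 2 * `|r| by rewrite !mulr_ge0// exprn_ge0.
  rewrite /l; move: H1 H2 H3 n0.
  rewrite !ler_norml => /andP[? ?] /andP[? ?] /andP[? ?] ?; apply/andP; split; lra.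
have llin a r r' : l (a *: r + r') = a * l r + l r'.
  have E1 : (0, a *: r + r') = a *: (0, r) + (0, r') :> V * V.
    by congr (_, _); rewrite /= scaler0 addr0.
  have E2 : (a *: r + r', 0) = a *: (r, 0) + (r', 0) :> V * V.
    by congr (_, _); rewrite /= scaler0 addr0.
  have m3 : (2 < m)%N by exact: ltnW m4.
  rewrite /l E1 E2 (mformDr F) (mformZr F).
  rewrite (jet_linear JW (s1 := [:: (0, c1); (0, c1)]) (s2 := [::]))//.
  rewrite (jet_linear JW (s1 := [:: (c1, v + z1); (c1, v + z1)]) (s2 := [::]))//.
  by rewrite /=; ring.
have [c2 c2P] := mform_riesz F llin lB.
have c2B : `|c2| <= B1.
  have : `|c2| <= 5 * K * B ^+ 2 / 4 / c.
    apply: (mform_norm_le F); first by rewrite !(mulr_ge0, exprn_ge0).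
    by move=> r; rewrite c2P.
  move=> H; apply: (le_trans H); rewrite /B1.
  have -> : 5 * K * B ^+ 2 / 4 / c = (5 * K * B ^+ 2 / c) / 4 by field; rewrite gt_eqF.
  by move: q1 B_ge0; lra.
have B1_ge1 : 1 <= B1 by move: B1B B_ge1; lra.
have B2_ge1 : 1 <= B2 by exact: le_trans B12.
have B3_ge1 : 1 <= B3 by exact: le_trans B23.
have B_B1 : B <= B1 by move: B1B B_ge0; lra.
have zGB : `|z2 + Gam| <= B1.
  by rewrite (le_trans (ler_normD _ _))// (le_trans (lerD z2B GB))//; move: B1B; lra.
have {}vzB : `|v + z1| <= B1 by exact: le_trans vzB B1B.
have {}vB : `|v| <= B1 by exact: le_trans vB B_B1.
have {}z1B : `|z1| <= B1 by exact: le_trans z1B B_B1.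
have {}z2B : `|z2| <= B1 by exact: le_trans z2B B_B1.
have {}c1B : `|c1| <= B1 by exact: le_trans c1B B_B1.
have g0 r : dg 0 r x [::] = 0 by rewrite (ls_dg0 LS).
have gD u u' r : dg (u + u') r x [::] = dg u r x [::] + dg u' r x [::].
  by rewrite (ls_dgD LS).
have gc1 r : 4 * dg c1 r x [::] = 2 * dg v r x [::] + 2 * dg z1 r x [::].
  by rewrite /c1 (ls_dgZ LS)// gD; field.
have mid1 r : el_linear x r 0 c1 (v + z1) = 0.
  by rewrite /el_linear g0 gD gc1; ring.
have fst1 r : el_linear x r z1 c1 v = 0 by rewrite /el_linear gc1; ring.
have mid2 r : el_linear x r 0 c2 z2 + el_quadratic x r 0 c1 (v + z1) = 0.
  by rewrite /el_linear /el_quadratic g0 c2P /l; field.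
have fst2 r : el_linear x r (z2 + Gam) c2 0 + el_quadratic x r z1 c1 v = 0.
  have GE : 2 * dg (z2 + Gam) r x [::] = 2 * dg z2 r x [::] + christoffel_form dg x z1 v r.
    by rewrite gD mulrDr GamP.
  rewrite /el_linear /el_quadratic g0 c2P /l GE.
  by rewrite -(transport_identity LS m4 v z1 r xr') -/c1; field.
(* Subtracting the two expanded equations eliminates the unknown cubic part of q, which enters both
   with the coefficient 4 g_x. The cubic coefficients leave their difference, in which neither tau
   nor d occurs. *)
exists (fun r => el_cubic x r z1 c1 v (z2 + Gam) c2 0
  - el_cubic x r 0 c1 (v + z1) 0 c2 z2).
move=> tau d q p t1 tK dB qR pR e1 e2 P.
pose t := `|tau|; have t0 : 0 <= t by rewrite /t.
have tt3 : 0 <= t ^+ 3 by rewrite exprn_ge0.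
have t21 : t ^+ 2 <= t by rewrite expr2 ler_piMl.
have t31 : t ^+ 3 <= t by rewrite exprS ler_piMr// expr2 mulr_ile1.
have small b1 b2 b3 b : 0 <= b -> b <= B3 -> `|b1| <= b -> `|b2| <= b ->
    `|b3| <= b * t ^+ 3 -> `|x + (tau *: b1 + (tau ^+ 2 *: b2 + b3)) - x| <= Rad.
  move=> b0 bB3 H1 H2 H3; rewrite addrAC subrr add0r.
  apply: le_trans tK; rewrite -/t; apply: (@le_trans _ _ (3 * B3 * t)); last first.
    by rewrite ler_wpM2r.
  apply: (@le_trans _ _ (3 * b * t)); last first.
    by rewrite ler_wpM2r// ler_wpM2l.
  rewrite (le_trans (ler_normD _ _))// (_ : 3 * b * t = b * t + (b * t + b * t)); last by ring.
  rewrite lerD//; first by rewrite normrZ mulrC ler_wpM2r.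
  rewrite (le_trans (ler_normD _ _))// lerD//; last by rewrite (le_trans H3)// ler_wpM2l.
  rewrite normrZ normrX -/t mulrC ler_pM// exprn_ge0 //.
have n0 b : 0 <= b -> `|0 : V| <= b * t ^+ 3 by move=> b0; rewrite normr0 mulr_ge0.
have n0' b : 0 <= b -> `|0 : V| <= b by rewrite normr0.
have x0E : x + (tau *: 0 + (tau ^+ 2 *: 0 + 0)) = x by rewrite !scaler0 !addr0.
have u0E : x + tau *: v = x + (tau *: v + (tau ^+ 2 *: 0 + 0)).
  by rewrite scaler0 !addr0.
have sE : x + tau *: v + (tau *: z1 + (tau ^+ 2 *: z2 + d))
    = x + (tau *: (v + z1) + (tau ^+ 2 *: z2 + d)).
  by rewrite scalerDr -!addrA.
rewrite sE in e2; rewrite u0E in e1.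
have nc := near_center xr Rad_rho.
have xR : `|x - x| <= Rad by rewrite subrr normr0 ltW.
have x0r : `|x + (tau *: 0 + (tau ^+ 2 *: 0 + 0)) - y| < rho by rewrite x0E.
have d1 : `|d| <= B1 * t ^+ 3 by rewrite (le_trans dB)// ler_wpM2r.
have sR := small _ _ _ B1 B1_ge0 (le_trans B12 B23) vzB z2B d1.
have uR := small _ _ _ B1 B1_ge0 (le_trans B12 B23) vB (n0' _ B1_ge0) (n0 _ B1_ge0).
pose qt := x + (tau *: c1 + (tau ^+ 2 *: c2 + 0)).
have qtR : `|qt - x| <= Rad.
  exact: (small _ _ _ B1 B1_ge0 (le_trans B12 B23) c1B c2B (n0 _ B1_ge0)).
pose Cq := q - qt.
(* The residual of the polynomial is multiplied by the stability factor 2 / (4 c) of the middle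
   point; for the first point, below, the factor is 2 / (2 c). *)
have CqB : `|Cq| <= (32 * K * B1 ^+ 3 / c) * t ^+ 3.
  have H : forall r, `|el x q (x + (tau *: (v + z1) + (tau ^+ 2 *: z2 + d))) r
      - el x qt (x + (tau *: (v + z1) + (tau ^+ 2 *: z2 + d))) r|
      <= 64 * K * B1 ^+ 3 * t ^+ 3 * `|r|.
    move=> r; rewrite e2 sub0r normrN.
    have := @el_curve3 x 0 0 0 c1 c2 0 (v + z1) z2 d B1 tau xr' B1_ge1 t1
      (n0' _ B1_ge0) (n0' _ B1_ge0) (n0 _ B1_ge0) c1B c2B (n0 _ B1_ge0) vzB z2B d1
      x0r (nc _ qtR) (nc _ sR) r.
    by rewrite x0E mid1 mid2 !mulr0 (addr0 (0 : R)) subr0.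
  have E0 : 0 <= 64 * K * B1 ^+ 3 * t ^+ 3.
    by rewrite mulr_ge0// (pos _ _ _ (ler0n R 64) B1_ge0).
  have := @el_mid_stable _ _ _ _ _ _ _ _ _ _ LS m4 x Rad xr Rad_rho Rad_c
    x q qt _ _ xR qR qtR sR E0 H.
  move=> H1; apply: (le_trans H1); rewrite le_eqVlt; apply/orP; left; apply/eqP.
  by field; rewrite gt_eqF.
have CqB2 : `|Cq| <= B2 * t ^+ 3.
  by rewrite (le_trans CqB)// ler_wpM2r// /B2 lerDr.
have assoc (b1 b2 w : V) : x + (b1 + (b2 + w)) = x + (b1 + (b2 + 0)) + w.
  by rewrite addr0 !addrA.
have qE : q = x + (tau *: c1 + (tau ^+ 2 *: c2 + Cq)).
  by rewrite assoc -/qt /Cq subrKC.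
pose pt := x + (tau *: z1 + (tau ^+ 2 *: (z2 + Gam) + 0)).
have ptR : `|pt - x| <= Rad.
  exact: (small _ _ _ B1 B1_ge0 (le_trans B12 B23) z1B zGB (n0 _ B1_ge0)).
have PE : P = p - pt.
  by rewrite /P /pt addr0 -addrA -opprD.
have PB : `|P| <= (64 * K * B2 ^+ 3 / c) * t ^+ 3.
  have H : forall r, `|el p q (x + (tau *: v + (tau ^+ 2 *: 0 + 0))) r
      - el pt q (x + (tau *: v + (tau ^+ 2 *: 0 + 0))) r|
      <= 64 * K * B2 ^+ 3 * t ^+ 3 * `|r|.
    move=> r; rewrite e1 sub0r normrN qE.
    have := @el_curve3 x z1 (z2 + Gam) 0 c1 c2 Cq v 0 0 B2 tau xr' B2_ge1 t1
      (le_trans z1B B12) (le_trans zGB B12) (n0 _ B2_ge0) (le_trans c1B B12)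
      (le_trans c2B B12) CqB2 (le_trans vB B12) (n0' _ B2_ge0) (n0 _ B2_ge0)
      (nc _ ptR) _ (nc _ uR) r.
    by rewrite -qE fst1 fst2 !mulr0 (addr0 (0 : R)) subr0; apply; exact: nc.
  have E0 : 0 <= 64 * K * B2 ^+ 3 * t ^+ 3.
    by rewrite mulr_ge0// (pos _ _ _ (ler0n R 64) B2_ge0).
  have := @el_fst_stable _ _ _ _ _ _ _ _ _ _ LS m4 x Rad xr Rad_rho Rad_c
    p pt q _ _ pR ptR qR E0 H.
  rewrite -PE => H1; apply: (le_trans H1); rewrite le_eqVlt; apply/orP; left; apply/eqP.
  by field; rewrite gt_eqF.
have PB3 : `|P| <= B3 * t ^+ 3.
  by rewrite (le_trans PB)// ler_wpM2r// /B3 lerDr.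
split.
  rewrite (le_trans PB3)// ler_wpM2r// (le_trans _ K'3)//.
  by move: B3_ge0; lra.
move=> m5 r.
have pE : p = x + (tau *: z1 + (tau ^+ 2 *: (z2 + Gam) + P)).
  by rewrite assoc -/pt PE subrKC.
have B13 := le_trans B12 B23.
have CqB3 : `|Cq| <= B3 * t ^+ 3 by rewrite (le_trans CqB2)// ler_wpM2r.
have d3 : `|d| <= B3 * t ^+ 3 by rewrite (le_trans d1)// ler_wpM2r.
have H1 := @el_curve4 x 0 0 0 c1 c2 Cq (v + z1) z2 d B3 tau xr' B3_ge1 t1
  (n0' _ B3_ge0) (n0' _ B3_ge0) (n0 _ B3_ge0) (le_trans c1B B13) (le_trans c2B B13)
  CqB3 (le_trans vzB B13) (le_trans z2B B13) d3 x0r _ (nc _ sR) r m5.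
have H2 := @el_curve4 x z1 (z2 + Gam) P c1 c2 Cq v 0 0 B3 tau xr' B3_ge1 t1
  (le_trans z1B B13) (le_trans zGB B13) PB3 (le_trans c1B B13) (le_trans c2B B13)
  CqB3 (le_trans vB B13) (n0' _ B3_ge0) (n0 _ B3_ge0) _ _ (nc _ uR) r m5.
rewrite -qE x0E e2 mid1 mid2 in H1.
rewrite -qE -pE e1 fst1 fst2 in H2.
have {}H1 := H1 (nc _ qR); have {}H2 := H2 (nc _ pR) (nc _ qR).
have H3 : 360 * K * B3 ^+ 4 * t ^+ 4 * `|r| <= K' * t ^+ 4 * `|r|.
  by rewrite !ler_wpM2r ?exprn_ge0// /K' lerDr mulr_ge0.
apply: le_trans H3.
move: H1 H2; rewrite /el_linear !g0 -/t.
move: (el_cubic _ _ _ _ _ _ _ _) (el_cubic _ _ _ _ _ _ _ _) => N1 N2.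
move: (dg Cq r x [::]) (dg P r x [::]) (dg d r x [::]) (B3 ^+ 4) => gC gP gd B4.
rewrite !ler_norml => /andP[? ?] /andP[? ?]; apply/andP; split; lra.
Qed.
End solutions.
End transport_expansion.

(** * Covariant difference quotients *)

Lemma odd_part_cancel (R : realType) (p q a b n t e : R) :
  `|2 * p - 2 * a - t * n| <= e -> `|2 * q - 2 * b - - t * n| <= e ->
  `|p + q - (a + b)| <= e.
Proof.
by rewrite !ler_norml => /andP[? ?] /andP[? ?]; apply/andP; split; lra.
Qed.

Lemma le_double (R : realType) (a b : R) : 0 <= a -> 0 <= b ->
  a + 2 * b <= 2 * a + 4 * b.
Proof. lra. Qed.

Lemma central_difference_split (R : numDomainType) (V : lmodType R) (i j a u : V) (t s : R) :
  i + j - (2 * s) *: u = (i - (t *: a + s *: u)) + (j - (- t *: a + s *: u)).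
Proof.
rewrite addrACA -opprD; congr (_ - _).
by rewrite addrACA scaleNr subrr add0r -scalerDl mulr2n mulrDl mul1r.
Qed.

Section discrete_covariant_derivative.
Variables (R : realType) (V Y : completeNormedModType R).
Variables (iota : V -> Y) (M : set V).
Variables (g : Y -> V -> V -> R^o) (W : V -> V -> R^o) (m : nat) (y : V).
Variables (rho K c C : R) (dW : V * V -> seq (V * V) -> R).
Variable (dg : V -> V -> V -> seq V -> R).
Hypothesis LS : local_structure m y rho K c C dW dg.
Hypothesis m4 : (4 <= m)%N.
Hypothesis rhoM : forall x, `|x - y| < rho -> M x.
Hypothesis dWE : forall p q psi, `|p - y| < rho -> `|q - y| < rho ->
  'd (fun q => W p q) q psi = dW (p, q) [:: (0, psi)] /\
  'd (fun p => W p q) p psi = dW (p, q) [:: (psi, 0)].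
Hypothesis dg0E : forall x a b, `|x - y| < rho -> dg a b x [::] = g (iota x) a b.
Hypothesis dg1E : forall x a b w, `|x - y| < rho ->
  'D_w (fun q => g (iota q) a b) x = dg a b x [:: w].

Let K0 : 0 <= K. Proof. exact: ls_K LS. Qed.
Let rho0 : 0 < rho. Proof. exact: ls_rho LS. Qed.
Let yr : `|y - y| < rho. Proof. by rewrite subrr normr0. Qed.
Let c0 : 0 < c. Proof. exact: mform_c0 (ls_form LS yr). Qed.
Let m1 : (1 <= m)%N. Proof. exact: leq_trans m4. Qed.

Lemma dg_bound x a b s : `|x - y| < rho -> (size s <= m)%N ->
  `|dg a b x s| <= K * `|a| * `|b| * nprod s.
Proof. by move=> xr sn; exact: (jet_bound (ls_jetg LS a b) xr sn). Qed.

Lemma dg_last x a b t q q' : `|x - y| < rho ->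
  dg a b x [:: t *: q + q'] = t * dg a b x [:: q] + dg a b x [:: q'].
Proof.
by move=> xr; exact: (jet_linear (ls_jetg LS a b) (s1 := [::]) (s2 := [::])).
Qed.

Lemma dg_linr x a b t b' s : `|x - y| < rho -> (size s <= m)%N ->
  dg a (t *: b + b') x s = t * dg a b x s + dg a b' x s.
Proof.
by move=> xr sn; rewrite !(ls_dg_sym LS a)// (ls_dg_lin LS).
Qed.

Lemma christoffel_exists x z v : `|x - y| < rho -> exists2 Gam : V,
  `|Gam| <= 3 * K * `|z| * `|v| / c &
  forall r, 2 * dg Gam r x [::] = christoffel_form dg x z v r.
Proof.
move=> xr; have F := ls_form LS xr.
pose l r := 2^-1 * christoffel_form dg x z v r.
have lB r : `|l r| <= 3 * K * `|z| * `|v| * `|r|.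
  have H1 := @dg_bound x z r [:: v] xr m1; have H2 := @dg_bound x z v [:: r] xr m1.
  have H3 := @dg_bound x v r [:: z] xr m1.
  rewrite !nprod_cons !nprod0 !mulr1 in H1 H2 H3.
  have n0 : 0 <= K * `|z| * `|v| * `|r| by rewrite !mulr_ge0.
  rewrite /l /christoffel_form; move: H1 H2 H3 n0.
  rewrite !ler_norml => /andP[? ?] /andP[? ?] /andP[? ?] ?; apply/andP; split; lra.
have llin a r r' : l (a *: r + r') = a * l r + l r'.
  by rewrite /l /christoffel_form !dg_linr// dg_last//; ring.
have [Gam GP] := mform_riesz F llin lB.
exists Gam; last by move=> r; rewrite GP /l mulrA divff ?mul1r.
apply: (mform_norm_le F); first by rewrite !mulr_ge0.
by move=> r; rewrite GP.
Qed.

Lemma christoffelP x z v : `|x - y| < rho ->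
  forall r, 2 * dg (christoffel iota g x z v) r x [::] = christoffel_form dg x z v r.
Proof.
move=> xr r; have [Gam _ GP] := christoffel_exists z v xr.
have : is_christoffel iota g x z v (christoffel iota g x z v).
  apply: (@xgetI _ 0 [set X | is_christoffel iota g x z v X] Gam) => r'.
  by rewrite -dg0E// !dg1E// GP.
by move=> /(_ r); rewrite -dg0E// !dg1E.
Qed.

Lemma christoffel_bound x z v : `|x - y| < rho ->
  `|christoffel iota g x z v| <= 3 * K * `|z| * `|v| / c.
Proof.
move=> xr; have [Gam GB GP] := christoffel_exists z v xr.
suff -> : christoffel iota g x z v = Gam by [].
apply: (mform_inj (ls_form LS xr)) => r.
have two : (2 : R) != 0 by [].
by apply: (mulfI two); rewrite christoffelP// GP.
Qed.

Lemma covariantE x w xi : `|x - y| < rho ->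
  covariant iota g w xi x = 'D_w xi x + christoffel iota g x (xi x) w.
Proof.
move=> xr; have F := ls_form LS xr.
apply: xget_unique.
  by move=> r; rewrite -!dg0E// (mformDl F).
move=> X XP; apply: (mform_inj F) => r.
by rewrite (mformDl F) !dg0E//; exact: XP.
Qed.

Lemma elE p q s h : `|p - y| < rho -> `|q - y| < rho -> `|s - y| < rho ->
  'd (fun q => W p q) q h + 'd (fun q => W q s) q h = el dW p q s h.
Proof.
move=> pr qr sr; exact: (f_equal2 +%R (dWE h pr qr).1 (dWE h qr sr).2).
Qed.

Section transport.
Variable Rad : R.
Hypotheses (Rad0 : 0 < Rad) (Rad_rho : Rad <= rho / 2) (Rad_c : 3 * K * Rad <= c).

(** The value of [inv_transport] is meaningful only if the pair is unique within radius r: existence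
    comes from [transport_solution], uniqueness from stability in the ball of radius Rad >= r. K'
    and t0 do not depend on x, so the expansion is available at shifted base points. *)
Lemma inv_transport_expansion (r B : R) : 0 < r -> r <= Rad -> 1 <= B ->
  exists K' t0 : R, [/\ 0 <= K', 0 < t0 &
  forall x v z1 z2, `|x - y| < rho / 2 ->
  `|v| <= B -> `|z1| <= B -> `|z2| <= B ->
  exists N : V -> R, forall (tau : R) d,
    `|tau| <= t0 -> `|d| <= B * `|tau| ^+ 3 ->
    let P := inv_transport M W r x (tau *: v) (tau *: z1 + (tau ^+ 2 *: z2 + d))
       - (tau *: z1 + tau ^+ 2 *: (z2 + christoffel iota g x z1 v)) in
    `|P| <= K' * `|tau| ^+ 3 /\
    ((5 <= m)%N -> forall r,
      `|2 * dg P r x [::] - 2 * dg d r x [::] - tau ^+ 3 * N r|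
        <= K' * `|tau| ^+ 4 * `|r|)].
Proof.
move=> r0 rRad B1.
have B0 : 0 <= B by exact: le_trans B1.
(* Enlarges B so that it also bounds the Christoffel vector, by [christoffel_bound]. *)
pose BG := B + 3 * K * B * B / c.
have q0 : 0 <= 3 * K * B * B / c by rewrite !(divr_ge0, mulr_ge0)// ltW.
have BBG : B <= BG by rewrite /BG lerDl.
have BG1 : 1 <= BG by exact: le_trans BBG.
have [K' K'0 K'P] := transport_expansion LS m4 Rad0 Rad_rho Rad_c BG1.
have [eps eps0 epsP] := transport_solution LS m4 Rad0 Rad_rho Rad_c r0 rRad.
(* Four conditions: |tau| <= 1, the smallness asked by [transport_expansion], u and zeta below eps,
   and the end points x + u and x + u + zeta within Rad of x. *)
pose t0 := Num.min (Num.min 1 (Rad / (K' + 1))) (Num.min (eps / (3 * BG)) (Rad / (6 * BG))).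
have K'1 : 0 < K' + 1 by rewrite ltr_wpDl.
have BG0 : 0 < BG by exact: lt_le_trans BG1.
exists K', t0; split => //.
  by rewrite !lt_min ltr01 !divr_gt0 ?mulr_gt0.
move=> x v z1 z2 xr vB z1B z2B.
have xr' : `|x - y| < rho.
  by rewrite (lt_le_trans xr)// ler_pdivrMr// ler_pMr// ler1n.
have GB : `|christoffel iota g x z1 v| <= BG.
  rewrite (le_trans (christoffel_bound z1 v xr'))//.
  apply: (@le_trans _ _ (3 * K * B * B / c)); last by rewrite /BG lerDr.
  rewrite ler_wpM2r ?invr_ge0 ?(ltW c0)//.
  rewrite -!mulrA ler_wpM2l// ler_wpM2l//; exact: ler_pM.
have [N NP] := K'P x v z1 z2 _ xr (le_trans vB BBG) (le_trans z1B BBG)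
   (le_trans z2B BBG) GB (christoffelP z1 v xr').
exists N => tau d.
rewrite !le_min => /andP[/andP[t1 tK] /andP[teps tRad]] dB.
have tK' : K' * `|tau| <= Rad.
  move: tK; rewrite ler_pdivlMr// => H; apply: le_trans H.
  by rewrite mulrC ler_wpM2l// lerDl.
have {}teps : 3 * BG * `|tau| <= eps by move: teps; rewrite ler_pdivlMr ?mulr_gt0// mulrC.
have {}tRad : 6 * BG * `|tau| <= Rad by move: tRad; rewrite ler_pdivlMr ?mulr_gt0// mulrC.
have dBG : `|d| <= BG * `|tau| ^+ 3 by rewrite (le_trans dB)// ler_wpM2r// exprn_ge0.
have t21 : `|tau| ^+ 2 <= `|tau| by rewrite expr2 ler_piMl.
have t31 : `|tau| ^+ 3 <= `|tau| by rewrite exprS ler_piMr// expr2 mulr_ile1.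
have u1 : `|tau *: v| <= BG * `|tau|.
  by rewrite normrZ mulrC ler_wpM2r// (le_trans vB).
have ze1 : `|tau *: z1 + (tau ^+ 2 *: z2 + d)| <= 3 * BG * `|tau|.
  rewrite (le_trans (ler_normD _ _))//.
  rewrite (_ : 3 * BG * `|tau| = BG * `|tau| + (BG * `|tau| + BG * `|tau|)); last by ring.
  rewrite lerD//; first by rewrite normrZ mulrC ler_wpM2r// (le_trans z1B).
  rewrite (le_trans (ler_normD _ _))// lerD//; last first.
    by rewrite (le_trans dBG)// ler_wpM2l// ltW.
  by rewrite normrZ normrX mulrC ler_pM// ?exprn_ge0// (le_trans z2B).
set ze := tau *: z1 + (tau ^+ 2 *: z2 + d) in ze1 *.
have BGt : 0 <= BG * `|tau| by rewrite mulr_ge0// ltW.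
have ueps : `|tau *: v| <= eps by apply: (le_trans u1); move: teps BGt; lra.
have zeps : `|ze| <= eps by exact: le_trans ze1 teps.
have [q [p [qr pr e1 e2]]] := epsP x _ _ xr ueps zeps.
have rr : r / 2 < r by rewrite ltr_pdivrMr// ltr_pMr// ltr1n.
have uR : `|x + tau *: v - x| <= Rad.
  by rewrite addrAC subrr add0r (le_trans u1)//; move: tRad BGt; lra.
have zR : `|x + tau *: v + ze - x| <= Rad.
  rewrite -(addrA x) addrAC subrr add0r (le_trans (ler_normD _ _))//.
  by move: u1 ze1 tRad BGt; lra.
have qR : `|q - x| <= Rad by rewrite (le_trans qr)// (le_trans (ltW rr)).
have pR : `|p - x| <= Rad by rewrite (le_trans pr)// (le_trans (ltW rr)).
have nc := near_center xr Rad_rho.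
have pairs : transport_pairs M W r x (tau *: v) ze = [set (q, p)].
  apply/seteqP; split => [[q' p'] /= [[Mq' q'r] [Mp' p'r] e1' e2']|_ ->] /=.
    have q'R : `|q' - x| <= Rad by rewrite (le_trans (ltW q'r)).
    have p'R : `|p' - x| <= Rad by rewrite (le_trans (ltW p'r)).
    have E1 h : el dW p' q' (x + tau *: v) h = 0.
      by rewrite -(elE h (nc _ p'R) (nc _ q'R) (nc _ uR)); exact: e1'.
    have E2 h : el dW x q' (x + tau *: v + ze) h = 0.
      by rewrite -(elE h xr' (nc _ q'R) (nc _ zR)); exact: e2'.
    by have [-> ->] := transport_unique LS m4 Rad0 Rad_rho Rad_c xr uR zR qR pR q'R p'R e1 e2 E1 E2.
  split.
  - by split; [apply: rhoM; exact: nc|exact: le_lt_trans rr].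
  - by split; [apply: rhoM; exact: nc|exact: le_lt_trans rr].
  - by move=> h; rewrite -(e1 h); exact: (elE h (nc _ pR) (nc _ qR) (nc _ uR)).
  - by move=> h; rewrite -(e2 h); exact: (elE h xr' (nc _ qR) (nc _ zR)).
have -> : inv_transport M W r x (tau *: v) ze = p - x.
  rewrite /inv_transport; congr (_ - x).
  rewrite (@xget_unique _ 0 _ (q, p))//= => cp; rewrite pairs => E.
  by have : [set cp] cp by []; rewrite -E.
exact: (NP tau d q p t1 tK' dBG qR pR e1 e2).
Qed.

(** Only the values of xi at x and x + tau v occur, up to O(tau^2). Multiplied by tau, the error at
    x + tau v becomes a perturbation d of cubic size, while the error at x leaves O(tau) after
    division by tau^2. So xi may depend on tau, as an inner difference quotient does. *)
Lemma dcov_expansion (r B : R) : 0 < r -> r <= Rad -> 1 <= B ->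
  exists K' t0 : R, [/\ 0 <= K', 0 < t0 &
  forall x v xi xi0 xi1 tau, `|x - y| < rho / 2 ->
  `|v| <= B -> `|xi0| <= B -> `|xi1| <= B -> 0 < tau -> tau <= t0 ->
  `|xi (x + tau *: v) - (xi0 + tau *: xi1)| <= B * tau ^+ 2 ->
  `|xi x - xi0| <= B * tau ^+ 2 ->
  `|dcov M W r tau v xi x - (xi1 + christoffel iota g x xi0 v)| <= K' * tau].
Proof.
move=> r0 rRad B1; have [K' [t0 [K'0 t00 H]]] := inv_transport_expansion r0 rRad B1.
have B0 : 0 <= B by exact: le_trans B1.
exists (K' + B), t0; split => //; first by rewrite addr_ge0.
move=> x v xi xi0 xi1 tau xr vB x0B x1B tau0 tau_t0 Hp H0.
have [N /(_ tau)] := H x v xi0 xi1 xr vB x0B x1B.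
pose d := tau *: (xi (x + tau *: v) - (xi0 + tau *: xi1)).
rewrite gtr0_norm// => /(_ d tau_t0) [|+ _].
  rewrite normrZ gtr0_norm// [leRHS](_ : _ = tau * (B * tau ^+ 2)); last by ring.
  by rewrite ler_pM2l.
have -> : tau *: xi0 + (tau ^+ 2 *: xi1 + d) = tau *: xi (x + tau *: v).
  by rewrite /d -scalerA -!scalerDr addrA subrKC.
set Ga := christoffel iota g x xi0 v; set I := inv_transport _ _ _ _ _ _ => HP.
have t2 : tau ^+ 2 != 0 by rewrite expf_neq0// gt_eqF.
have -> : dcov M W r tau v xi x - (xi1 + Ga)
    = (tau ^+ 2)^-1 *: (I - (tau *: xi0 + tau ^+ 2 *: (xi1 + Ga)) - tau *: (xi x - xi0)).
  rewrite /dcov -/I -[xi1 + Ga in LHS](scalerK t2) -scalerBr; congr (_ *: _).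
  have vid (i s a e : V) : i - s - e = i - (a + e) - (s - a).
    rewrite -[LHS]addrA -opprD -[RHS]addrA -opprD; congr (_ - _).
    by rewrite [a + e]addrC -addrA subrKC addrC.
  by rewrite [tau *: (xi x - xi0)]scalerBr; exact: vid.
rewrite normrZ normfV normrX gtr0_norm// ler_pdivrMl ?exprn_gt0//.
rewrite (le_trans (ler_normB _ _))//.
rewrite [leRHS](_ : _ = K' * tau ^+ 3 + tau * (B * tau ^+ 2)); last by ring.
by rewrite lerD// normrZ gtr0_norm// ler_pM2l.
Qed.

(** xi0 stands for the value at x, which the central quotient skips. The quadratic part tau^2 xi2 is
    put into the perturbations, where the factors tau and - tau make it cancel in the sum. *)
Lemma dcov_central_expansion (r B : R) : (5 <= m)%N -> 0 < r -> r <= Rad -> 1 <= B ->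
  exists K' t0 : R, [/\ 0 <= K', 0 < t0 &
  forall x v xi xi0 xi1 xi2 tau, `|x - y| < rho / 2 ->
  `|v| <= B -> `|xi0| <= B -> `|xi1| <= B -> `|xi2| <= B -> 0 < tau -> tau <= t0 ->
  `|xi (x + tau *: v) - (xi0 + tau *: xi1 + tau ^+ 2 *: xi2)| <= B * tau ^+ 3 ->
  `|xi (x - tau *: v) - (xi0 - tau *: xi1 + tau ^+ 2 *: xi2)| <= B * tau ^+ 3 ->
  `|dcov_central M W r tau v xi x - (xi1 + christoffel iota g x xi0 v)|
    <= K' * tau ^+ 2].
Proof.
move=> m5 r0 rRad B1; have B21 : 1 <= 2 * B by rewrite mulr2n mulrDl mul1r ler_wpDr// (le_trans _ B1).
have [K' [t0 [K'0 t00 H]]] := inv_transport_expansion r0 rRad B21.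
have B0 : 0 <= B by exact: le_trans B1.
have BB : B <= 2 * B by rewrite mulr2n mulrDl mul1r lerDl.
exists (K' / c + 2 * B), (Num.min t0 1); split.
- by apply: addr_ge0 (divr_ge0 K'0 (ltW c0)) _; rewrite mulr_ge0.
- by rewrite lt_min t00 ltr01.
move=> x v xi xi0 xi1 xi2 tau xr vB x0B x1B x2B tau0.
rewrite le_min => /andP[tau_t0 tau_1] Hp Hm.
have xr' : `|x - y| < rho.
  by rewrite (lt_le_trans xr)// ler_pdivrMr// ler_pMr// ler1n.
have F := ls_form LS xr'.
have [N NP] := H x v xi0 xi1 xr (le_trans vB BB) (le_trans x0B BB) (le_trans x1B BB).
set ep := xi (x + tau *: v) - _ in Hp; set em := xi (x - tau *: v) - _ in Hm.
pose dp := tau *: (ep + tau ^+ 2 *: xi2).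
pose dm := - tau *: (em + tau ^+ 2 *: xi2).
have t3 : tau ^+ 3 <= tau ^+ 2 by rewrite exprS ler_piMl// exprn_ge0// ltW.
have bound e : `|e| <= B * tau ^+ 3 ->
    tau * `|e + tau ^+ 2 *: xi2| <= 2 * B * tau ^+ 3.
  move=> He; rewrite [leRHS](_ : _ = tau * (B * tau ^+ 2 + B * tau ^+ 2)); last by ring.
  rewrite ler_pM2l// (le_trans (ler_normD _ _))// lerD//.
    by rewrite (le_trans He)// ler_wpM2l.
  by rewrite normrZ normrX gtr0_norm// mulrC ler_wpM2r// exprn_ge0// ltW.
have ntau : `|- tau| = tau by rewrite normrN gtr0_norm.
have [||_ Pp] := NP tau dp.
- by rewrite gtr0_norm.
- by rewrite normrZ !gtr0_norm// bound.
have [||_ Pm] := NP (- tau) dm.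
- by rewrite ntau.
- by rewrite normrZ ntau bound.
have {Pp} := Pp m5; have {Pm} := Pm m5.
have -> : tau *: xi0 + (tau ^+ 2 *: xi1 + dp) = tau *: xi (x + tau *: v).
  rewrite -(subrKC (xi0 + tau *: xi1 + tau ^+ 2 *: xi2) (xi (x + tau *: v))) -/ep.
  rewrite /dp [ep + _]addrC !scalerDr !scalerA -!expr2 !addrA.
  by [].
have -> : - tau *: xi0 + ((- tau) ^+ 2 *: xi1 + dm) = - (tau *: xi (x - tau *: v)).
  rewrite -(subrKC (xi0 - tau *: xi1 + tau ^+ 2 *: xi2) (xi (x - tau *: v))) -/em.
  rewrite /dm [em + _]addrC sqrrN -[RHS]scaleNr !scalerDr.
  rewrite [- tau *: (- (tau *: xi1))]scalerN [- tau *: (tau *: xi1)]scaleNr opprK.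
  by rewrite [tau *: (tau *: xi1)]scalerA -expr2 !addrA.
rewrite scaleNr; set Ip := inv_transport M W r x (tau *: v) _.
set Im := inv_transport M W r x (- (tau *: v)) _.
set Ga := christoffel iota g x xi0 v.
rewrite sqrrN ntau gtr0_norm//.
move=> HPm HPp.
pose Pm := Im - (- tau *: xi0 + tau ^+ 2 *: (xi1 + Ga)).
pose Pp := Ip - (tau *: xi0 + tau ^+ 2 *: (xi1 + Ga)).
rewrite -/Pm in HPm; rewrite -/Pp in HPp.
have gD u u' h : dg (u + u') h x [::] = dg u h x [::] + dg u' h x [::].
  by rewrite (ls_dgD LS).
have gN u h : dg (- u) h x [::] = - dg u h x [::] by rewrite (ls_dgN LS).
have gsum p q a b h : dg (p + q - (a + b)) h x [::]
    = dg p h x [::] + dg q h x [::] - (dg a h x [::] + dg b h x [::]).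
  by rewrite gD gN !gD.
have E1 : `|Pp + Pm - (dp + dm)| <= K' * tau ^+ 4 / c.
  apply: (mform_norm_le F); first by rewrite mulr_ge0// exprn_ge0// ltW.
  move=> h; rewrite gsum; have := HPm h; have := HPp h.
  by rewrite (_ : (- tau) ^+ 3 = - tau ^+ 3); [exact: odd_part_cancel|ring].
(* Each perturbation is only cubic; the sum gains one order because xi2 has dropped out of it. *)
have E2 : `|dp + dm| <= 2 * B * tau ^+ 4.
  have -> : dp + dm = tau *: (ep - em).
    by rewrite /dp /dm scaleNr -scalerBr opprD addrACA subrr addr0.
  rewrite normrZ gtr0_norm// [leRHS](_ : _ = tau * (B * tau ^+ 3 + B * tau ^+ 3)); last by ring.
  by rewrite ler_pM2l// (le_trans (ler_normB _ _))// lerD.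
have t2 : 2 * tau ^+ 2 != 0 by rewrite mulf_neq0// expf_neq0// gt_eqF.
have -> : dcov_central M W r tau v xi x - (xi1 + Ga) = (2 * tau ^+ 2)^-1 *: (Pp + Pm).
  rewrite /dcov_central -/Ip -/Im -[xi1 + Ga in LHS](scalerK t2) -scalerBr; congr (_ *: _).
  exact: central_difference_split.
have t20 : 0 < 2 * tau ^+ 2 by rewrite mulr_gt0// exprn_gt0.
rewrite normrZ normfV gtr0_norm// ler_pdivrMl//.
rewrite -(subrK (dp + dm) (Pp + Pm)) (le_trans (ler_normD _ _))//.
rewrite (le_trans (lerD E1 E2))//.
have q0 : 0 <= K' / c * tau ^+ 4 by rewrite mulr_ge0 ?exprn_ge0 ?divr_ge0// ltW.
have q1 : 0 <= B * tau ^+ 4 by rewrite mulr_ge0 ?exprn_ge0// ltW.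
rewrite (_ : K' * tau ^+ 4 / c = K' / c * tau ^+ 4); last by ring.
rewrite [leRHS](_ : _ = 2 * (K' / c * tau ^+ 4) + 4 * (B * tau ^+ 4)); last by ring.
by rewrite (_ : 2 * B * tau ^+ 4 = 2 * (B * tau ^+ 4)); [exact: (le_double q0 q1)|ring].
Qed.
End transport.
End discrete_covariant_derivative.

(** * Covariant derivative along a line *)

(** Scalar Taylor for the tested map G(D, e); the factor C / c is the cost of passing to the form
    and back. *)
Lemma fjet_taylor (R : realType) (E : normedModType R) (V : completeNormedModType R)
    (n : nat) (x0 : E) (rho K c C : R) (D : E -> seq E -> V) (G : V -> V -> R)
    k x h s :
  metric_form c C G -> 0 <= K -> frechet_jet n x0 rho K D -> (size s + k <= n)%N ->
  `|x - x0| < rho -> `|x + h - x0| < rho ->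
  `|D (x + h) s - \sum_(j < k) (j`!%:R)^-1 *: D x (nseq j h ++ s)|
    <= K * C / c * `|h| ^+ k * nprod s.
Proof.
move=> F K0 JD sn xr xhr; have c0 := mform_c0 F; have C0 := mform_C0 F.
rewrite (_ : K * C / c * `|h| ^+ k * nprod s = K * C * `|h| ^+ k * nprod s / c); last by ring.
apply: (mform_norm_le F).
  by rewrite !mulr_ge0 ?exprn_ge0 ?nprod_ge0// ltW.
move=> e.
have Ce0 : 0 <= C * `|e| by rewrite mulr_ge0// ltW.
have JG : jet n x0 rho (K * (C * `|e|)) (fun x s => G (D x s) e).
  apply: (@jet_of_frechet _ _ _ _ _ _ _ _ D (fun u => G u e) JD Ce0) => [a u v|u].
    exact: (mform_lin F).
  by rewrite mulrAC; exact: (mform_le_norm F).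
have := jet_taylor JG sn xr xhr.
rewrite (mformBl F) (big_morph (fun u => G u e) (fun u v => mformDl F u v e) (mform0l F e)).
under [X in _ -> `|_ - X| <= _]eq_bigr do rewrite (mformZl F).
by move/le_trans; apply; rewrite [leLHS](_ : _ = K * C * `|h| ^+ k * nprod s * `|e|); last by ring.
Qed.

(** A curve of bilinear forms with a second-order Taylor polynomial whose remainder is controlled as
    a bilinear form. [Bj] is constrained at the indices 0, 1, 2 alone, hence the guards. It will
    describe g and the Christoffel form along a line. *)
Record bilinear_curve (R : realType) (V : normedModType R) (t0 k : R)
    (B : R -> V -> V -> R) (Bj : nat -> V -> V -> R) : Prop := BilinearCurve {
  bcurve_linl : forall j a u v r, (j < 3)%N ->
    Bj j (a *: u + v) r = a * Bj j u r + Bj j v r;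
  bcurve_linr : forall j a u v r, (j < 3)%N ->
    Bj j r (a *: u + v) = a * Bj j r u + Bj j r v;
  bcurve_bound : forall j u r, (j < 3)%N -> `|Bj j u r| <= k * `|u| * `|r|;
  bcurve_taylor : forall t u r, `|t| <= t0 ->
    `|B t u r - (Bj 0%N u r + t * Bj 1%N u r + t ^+ 2 * Bj 2%N u r)|
      <= k * `|t| ^+ 3 * `|u| * `|r| }.

Lemma bilinear_curve_apply (R : realType) (V : normedModType R) (t0 k L : R)
    (B : R -> V -> V -> R) (Bj : nat -> V -> V -> R) (a0 a1 a2 : V) (t : R) (r : V) :
  bilinear_curve t0 k B Bj -> 0 <= k -> `|a0| <= L -> `|a1| <= L -> `|a2| <= L ->
  `|t| <= t0 -> `|t| <= 1 ->
  `|B t (a0 + t *: a1 + t ^+ 2 *: a2) r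
    - (Bj 0%N a0 r + t * (Bj 1%N a0 r + Bj 0%N a1 r)
       + t ^+ 2 * (Bj 2%N a0 r + Bj 1%N a1 r + Bj 0%N a2 r))|
    <= 6 * k * L * `|t| ^+ 3 * `|r|.
Proof.
move=> BC k0 a0L a1L a2L tt0 t1; set S := a0 + _ + _.
have L0 : 0 <= L by exact: le_trans a0L.
have t2 : `|t| ^+ 2 <= 1 by rewrite exprn_ile1.
have SL : `|S| <= 3 * L.
  rewrite (_ : 3 * L = L + L + L); last by ring.
  rewrite (le_trans (ler_normD _ _))// lerD//.
    rewrite (le_trans (ler_normD _ _))// lerD// normrZ.
    by rewrite -[leRHS]mul1r ler_pM.
  by rewrite normrZ normrX -[leRHS]mul1r ler_pM// exprn_ge0.
have BS j : (j < 3)%N -> Bj j S r = Bj j a0 r + t * Bj j a1 r + t ^+ 2 * Bj j a2 r.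
  move=> j3; rewrite /S [a0 + _]addrC [_ + a0 + _]addrC.
  by rewrite !(bcurve_linl BC)//; ring.
have H1 := bcurve_taylor BC S r tt0; rewrite !BS// in H1.
have bnd j a : (j < 3)%N -> `|a| <= L -> `|Bj j a r| <= k * L * `|r|.
  by move=> j3 aL; rewrite (le_trans (bcurve_bound BC a r j3))// ler_wpM2r// ler_wpM2l.
(* These products of order t^3 and t^4 are truncated from the product of the two polynomials. They
   account for 3 of the factor 6; the other 3 is the Taylor remainder at a vector of norm at most 3
   L. *)
rewrite -(subrK (t ^+ 3 * (Bj 1%N a2 r + Bj 2%N a1 r + t * Bj 2%N a2 r))
  (_ - (Bj 0%N a0 r + _ + _))).
rewrite [X in `|X + _|](_ : _ = B t S r - (Bj 0%N a0 r + t * Bj 0%N a1 r + t ^+ 2 * Bj 0%N a2 r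
   + t * (Bj 1%N a0 r + t * Bj 1%N a1 r + t ^+ 2 * Bj 1%N a2 r)
   + t ^+ 2 * (Bj 2%N a0 r + t * Bj 2%N a1 r + t ^+ 2 * Bj 2%N a2 r))); last by ring.
rewrite (le_trans (ler_normD _ _))//.
rewrite (_ : 6 * k * L * `|t| ^+ 3 * `|r| = k * `|t| ^+ 3 * (3 * L) * `|r|
   + `|t| ^+ 3 * (k * L * `|r| + k * L * `|r| + k * L * `|r|)); last by ring.
apply: lerD.
  by rewrite (le_trans H1)// ler_wpM2r// ler_wpM2l// mulr_ge0// exprn_ge0.
rewrite normrM normrX ler_wpM2l ?exprn_ge0//.
rewrite (le_trans (ler_normD _ _))// lerD ?(le_trans (ler_normD _ _)) ?lerD ?bnd//.
by rewrite normrM -[leRHS]mul1r ler_pM// bnd.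
Qed.

(** The equation A Ga = T z is solved as a power series in t: b0, b1, b2 are Riesz representatives
    for the fixed form [Aj 0], obtained recursively, and coercivity of [A t] bounds what remains.
    This gives the regularity along a line of the Christoffel operator, which the metric defines
    only implicitly. *)
Lemma riesz_curve_expansion (R : realType) (V : completeNormedModType R)
    (c C t0 k kz : R)
    (A T : R -> V -> V -> R) (Aj Tj : nat -> V -> V -> R) (z Ga : R -> V) (a0 a1 a2 : V) :
  0 <= k -> 0 <= kz -> metric_form c C (Aj 0%N) -> bilinear_curve t0 k A Aj ->
  bilinear_curve t0 k T Tj ->
  (forall t, `|t| <= t0 -> metric_form c C (A t)) ->
  (forall t u v r, `|t| <= t0 -> T t (u + v) r = T t u r + T t v r) ->
  (forall t u r, `|t| <= t0 -> `|T t u r| <= k * `|u| * `|r|) ->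
  (forall t, `|t| <= t0 ->
    `|z t - (a0 + t *: a1 + t ^+ 2 *: a2)| <= kz * `|t| ^+ 3) ->
  (forall t r, `|t| <= t0 -> A t (Ga t) r = T t (z t) r) ->
  exists b0 b1 b2 k', 0 <= k' /\ forall t, `|t| <= t0 -> `|t| <= 1 ->
    `|Ga t - (b0 + t *: b1 + t ^+ 2 *: b2)| <= k' * `|t| ^+ 3.
Proof.
move=> k0 kz0 F0 BA BT FA TD Tb zE GaE.
have c0 := mform_c0 F0.
have nB (p q a b : R) : `|p| <= a -> `|q| <= b -> `|p + q| <= a + b.
  by move=> pa qb; rewrite (le_trans (ler_normD _ _))// lerD.
have nN (p q a b : R) : `|p| <= a -> `|q| <= b -> `|p - q| <= a + b.
  by move=> pa qb; rewrite (le_trans (ler_normB _ _))// lerD.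
have Tbj j u r : (j < 3)%N -> `|Tj j u r| <= k * `|u| * `|r| by exact: (bcurve_bound BT).
have Abj j u r : (j < 3)%N -> `|Aj j u r| <= k * `|u| * `|r| by exact: (bcurve_bound BA).
have [b0 b0E] : exists b, forall r, Aj 0%N b r = Tj 0%N a0 r.
  apply: (mform_riesz F0 (l := Tj 0%N a0) (eta := k * `|a0|)) => [a u v|r].
    exact: (bcurve_linr BT).
  exact: Tbj.
have [b1 b1E] : exists b, forall r, Aj 0%N b r = Tj 1%N a0 r + Tj 0%N a1 r - Aj 1%N b0 r.
  apply: (mform_riesz F0 (l := fun r => Tj 1%N a0 r + Tj 0%N a1 r - Aj 1%N b0 r)
    (eta := k * `|a0| + k * `|a1| + k * `|b0|)) => [a u v|r].
    by rewrite !(bcurve_linr BT)// (bcurve_linr BA)//; ring.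
  by rewrite !mulrDl; apply: nN; [apply: nB; exact: Tbj|exact: Abj].
have [b2 b2E] : exists b, forall r,
    Aj 0%N b r = Tj 2%N a0 r + Tj 1%N a1 r + Tj 0%N a2 r - (Aj 2%N b0 r + Aj 1%N b1 r).
  apply: (mform_riesz F0
    (l := fun r => Tj 2%N a0 r + Tj 1%N a1 r + Tj 0%N a2 r - (Aj 2%N b0 r + Aj 1%N b1 r))
    (eta := k * `|a0| + k * `|a1| + k * `|a2| + (k * `|b0| + k * `|b1|))) => [a u v|r].
    by rewrite !(bcurve_linr BT)// !(bcurve_linr BA)//; ring.
  rewrite !mulrDl; apply: (nN _ _ _ _); apply: (nB _ _ _ _); try exact: Tbj; try exact: Abj.
  by apply: nB; exact: Tbj.
pose L := Num.max (Num.max (Num.max `|a0| `|a1|) (Num.max `|a2| `|b0|)) (Num.max `|b1| `|b2|).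
have L0 : 0 <= L by rewrite !le_max normr_ge0.
pose k' := k * kz + 6 * k * L + 6 * k * L.
have k'0 : 0 <= k' by rewrite /k' !addr_ge0// !mulr_ge0.
exists b0, b1, b2, (k' / c); split; first by rewrite divr_ge0// ltW.
move=> t tt0 t1.
rewrite (_ : k' / c * `|t| ^+ 3 = k' * `|t| ^+ 3 / c); last by ring.
apply: (mform_norm_le (FA t tt0)); first by rewrite mulr_ge0// exprn_ge0.
move=> r; rewrite (mformBl (FA t tt0)) GaE//.
have {zE} := zE t tt0; set S := a0 + t *: a1 + _ => zE.
have [a0L a1L a2L] : [/\ `|a0| <= L, `|a1| <= L & `|a2| <= L].
  by split; rewrite !le_max lexx ?orbT.
have [b0L b1L b2L] : [/\ `|b0| <= L, `|b1| <= L & `|b2| <= L].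
  by split; rewrite !le_max lexx ?orbT.
have EA := bilinear_curve_apply r BA k0 b0L b1L b2L tt0 t1.
have ET := bilinear_curve_apply r BT k0 a0L a1L a2L tt0 t1.
rewrite -/S in ET.
rewrite b0E b1E b2E in EA.
have -> : T t (z t) r = T t (z t - S) r + T t S r by rewrite -TD// subrK.
have Ez : `|T t (z t - S) r| <= k * kz * `|t| ^+ 3 * `|r|.
  rewrite (le_trans (Tb _ _ _ tt0))// ler_wpM2r// -mulrA ler_wpM2l//.
move: EA ET Ez; rewrite /k'.
set A' := A t _ r; set T' := T t (z t - S) r; set q := T t S r.
set Q := Tj 0%N a0 r + _ + t ^+ 2 * (Tj 2%N a0 r + Tj 1%N a1 r + Tj 0%N a2 r).
rewrite (_ : Tj 0%N a0 r + _ + _ = Q); last by rewrite /Q; ring.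
clearbody A' T' q Q.
rewrite (_ : (k * kz + 6 * k * L + 6 * k * L) * `|t| ^+ 3 * `|r| =
  k * kz * `|t| ^+ 3 * `|r| + (6 * k * L * `|t| ^+ 3 * `|r|
  + 6 * k * L * `|t| ^+ 3 * `|r|)); last by ring.
move=> EA ET Ez; rewrite (_ : T' + q - A' = T' + ((q - Q) - (A' - Q))); last by ring.
exact: (nB _ _ _ _ Ez (nN _ _ _ _ ET EA)).
Qed.

Lemma nprod_nseq_cat (R : realType) (E : normedModType R) j (v : E) s :
  nprod (nseq j v ++ s) = `|v| ^+ j * nprod s.
Proof. by elim: j => [|j IH] /=; rewrite ?mul1r// nprod_cons IH exprS mulrA. Qed.

Lemma exprn_le_1D (R : realDomainType) (x : R) j n :
  0 <= x -> (j <= n)%N -> x ^+ j <= (1 + x) ^+ n.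
Proof.
move=> x0 jn; apply: (@le_trans _ _ ((1 + x) ^+ j)).
  by rewrite lerXn2r// ?nnegrE ?addr_ge0// lerDr.
by rewrite ler_weXn2l// lerDl.
Qed.

Lemma norm_addsub_le (R : realDomainType) (a b d e : R) :
  `|a| <= e -> `|b| <= e -> `|d| <= e -> `|a - b + d| <= 3 * e.
Proof.
move=> ae be de; rewrite (_ : 3 * e = e + e + e); last by ring.
by rewrite (le_trans (ler_normD _ _))// lerD// (le_trans (ler_normB _ _))// lerD.
Qed.

Lemma jet_line_taylor (R : realType) (E : normedModType R) (n : nat) (x0 : E)
    (rho K : R) (D : E -> seq E -> R) (v : E) (s : seq E) (t : R) :
  jet n x0 rho K D -> (size s + 3 <= n)%N -> 0 < rho -> `|t *: v| < rho ->
  `|D (x0 + t *: v) s - ((0`!%:R)^-1 * D x0 (nseq 0 v ++ s)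
     + t * ((1`!%:R)^-1 * D x0 (nseq 1 v ++ s))
     + t ^+ 2 * ((2`!%:R)^-1 * D x0 (nseq 2 v ++ s)))|
    <= K * `|v| ^+ 3 * `|t| ^+ 3 * nprod s.
Proof.
move=> JD sn rho0 tv.
have xr : `|x0 - x0| < rho by rewrite subrr normr0.
have xtr : `|x0 + t *: v - x0| < rho by rewrite addrAC subrr add0r.
have := jet_taylor JD sn xr xtr.
rewrite normrZ exprMn (_ : K * (`|t| ^+ 3 * `|v| ^+ 3) = K * `|v| ^+ 3 * `|t| ^+ 3); last by ring.
rewrite !big_ord_recl big_ord0 addr0 /= -/(nseq 1 (t *: v) ++ s) -/(nseq 2 (t *: v) ++ s).
have N j : (j < 3)%N -> D x0 (nseq j (t *: v) ++ s) = t ^+ j * D x0 (nseq j v ++ s).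
  move=> j3; apply: (jet_nseqZ JD (s1 := [::]) t v xr); move: sn j3; rewrite /=; lia.
have N1 := N 1%N isT; have N2 := N 2%N isT; rewrite /= in N1 N2.
rewrite N1 N2 /= expr1 [X in `|_ - X| <= _ -> _](_ : _ =
  (0`!%:R)^-1 * D x0 s + t * ((1`!%:R)^-1 * D x0 (v :: s))
     + t ^+ 2 * ((2`!%:R)^-1 * D x0 [:: v, v & s])) //.
by rewrite /bump /=; ring.
Qed.

Lemma fjetZ (R : realType) (E F : normedModType R) (n : nat) (x0 : E) (rho K : R)
    (D : E -> seq E -> F) x s1 s2 a u :
  frechet_jet n x0 rho K D -> `|x - x0| < rho -> (size s1 + size s2 < n)%N ->
  D x (s1 ++ (a *: u) :: s2) = a *: D x (s1 ++ u :: s2).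
Proof.
move=> JD xr sn; have D0 : D x (s1 ++ 0 :: s2) = 0.
  have := fjet_linear JD 1 0 0 xr sn; rewrite scaler0 addr0 scale1r => /eqP.
  by rewrite -subr_eq subrr => /eqP <-.
by have := fjet_linear JD a u 0 xr sn; rewrite D0 !addr0.
Qed.

Lemma derive_frechet_jet (R : realType) (E F : normedModType R) (n : nat) (x0 : E)
    (rho K : R) (D : E -> seq E -> F) (f : E -> F) x w :
  frechet_jet n x0 rho K D -> (0 < n)%N -> `|x - x0| < rho ->
  (forall x, `|x - x0| < rho -> D x [::] = f x) -> 'D_w f x = D x [:: w].
Proof.
move=> JD n0 xr D0; apply: (derive_frechet (L := fun h => D x [:: h])) => [e e0|a].
  have near_x := near_norm_lt xr; have dD := fjet_diff JD (s := [::]) xr n0 e0.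
  near=> x'; rewrite -!D0//; first by near: x'.
  by near: x'.
exact: (fjetZ (s1 := [::]) (s2 := [::]) a w JD xr).
Unshelve. all: by end_near. Qed.

Lemma derive_of_expansion (R : realType) (E F : normedModType R) (f : E -> F)
    (x v : E) (f1 : F) (k t0 : R) : 0 < t0 ->
  (forall t, `|t| <= t0 -> `|f (x + t *: v) - f x - t *: f1| <= k * `|t| ^+ 2) ->
  'D_v f x = f1.
Proof.
move=> t00 fE; rewrite derive_along_line.
rewrite (derive_frechet (L := fun t : R => t *: f1)) ?scale1r// => [e e0|a]; last first.
  by rewrite -[a%:A]/(a * 1) mulr1.
have k1 : 0 < `|k| + 1 by rewrite ltr_wpDl.
apply/nbhs_ballP; exists (Num.min t0 (e / (`|k| + 1))) => /=.
  by rewrite lt_min t00 divr_gt0.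
move=> t; rewrite -ball_normE /= sub0r normrN lt_min => /andP[tt0 te].
rewrite subr0 scale0r addr0 (le_trans (fE _ (ltW tt0)))//.
rewrite expr2 mulrA ler_wpM2r// (@le_trans _ _ ((`|k| + 1) * `|t|))//.
  by rewrite ler_wpM2r// (le_trans (ler_norm k))// lerDl.
by move: te; rewrite ltr_pdivlMr// mulrC => /ltW.
Qed.

Lemma fjet_line_taylor (R : realType) (E : normedModType R) (V : completeNormedModType R)
    (n : nat) (x0 : E) (rho K c C : R) (D : E -> seq E -> V) (G : V -> V -> R)
    (x v : E) (s : seq E) t :
  metric_form c C G -> 0 <= K -> frechet_jet n x0 rho K D -> (size s + 3 <= n)%N ->
  `|x - x0| < rho -> `|x + t *: v - x0| < rho ->
  `|D (x + t *: v) s - (D x s + t *: D x (v :: s) + t ^+ 2 *: (2^-1 *: D x [:: v, v & s]))|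
    <= K * C / c * `|v| ^+ 3 * nprod s * `|t| ^+ 3.
Proof.
move=> F K0 JD sn xr xtr; have := fjet_taylor F K0 JD sn xr xtr.
have D1 := fjetZ (s1 := [::]) (s2 := s) t v JD xr.
have D2 := fjetZ (s1 := [::]) (s2 := t *: v :: s) t v JD xr.
have D3 := fjetZ (s1 := [:: v]) (s2 := s) t v JD xr.
rewrite !big_ord_recl big_ord0 addr0 /= !fact0 invr1 !scale1r.
rewrite /= in D1 D2 D3; rewrite D1 ?D2 ?D3//; try by move: sn; lia.
have E2 q (u : V) : q *: (t *: (t *: u)) = t ^+ 2 *: (q *: u).
  by rewrite !scalerA; congr (_ *: _); ring.
rewrite E2 addrA normrZ => /le_trans; apply.
by rewrite le_eqVlt; apply/orP; left; apply/eqP; ring.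
Qed.

Lemma quadratic_split (R : comNzRingType) (V : lmodType R) (q t : R)
    (a a0 a1 a2 b b0 b1 b2 : V) :
  a + q *: b - (a0 + q *: b0 + t *: (a1 + q *: b1) + t ^+ 2 *: (a2 + q *: b2))
  = a - (a0 + t *: a1 + t ^+ 2 *: a2) + q *: (b - (b0 + t *: b1 + t ^+ 2 *: b2)).
Proof.
rewrite [q *: (b - _)]scalerBr addrACA -opprD; congr (_ - _).
have E s (u u' : V) : s *: (u + q *: u') = s *: u + q *: (s *: u').
  by rewrite scalerDr !scalerA [q * s]mulrC.
by rewrite !E !scalerDr (addrACA a0) [LHS]addrACA.
Qed.

Section covariant_expansion.
Variables (R : realType) (V Y : completeNormedModType R).
Variables (iota : V -> Y) (g : Y -> V -> V -> R^o) (m : nat) (y : V).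
Variables (rho K c C : R) (dW : V * V -> seq (V * V) -> R).
Variable (dg : V -> V -> V -> seq V -> R).
Hypothesis LS : local_structure m y rho K c C dW dg.
Hypothesis m4 : (4 <= m)%N.
Hypothesis dg0E : forall x a b, `|x - y| < rho -> dg a b x [::] = g (iota x) a b.
Hypothesis dg1E : forall x a b w, `|x - y| < rho ->
  'D_w (fun q => g (iota q) a b) x = dg a b x [:: w].
Variables (Z : V -> V) (rhoZ KZ : R) (DZ : V -> seq V -> V).
Hypotheses (rhoZ0 : 0 < rhoZ) (rhoZ_rho : rhoZ <= rho) (KZ0 : 0 <= KZ).
Hypothesis DZ0 : forall x, `|x - y| < rhoZ -> DZ x [::] = Z x.
Hypothesis JZ : frechet_jet 4 y rhoZ KZ DZ.

Let K0 : 0 <= K. Proof. exact: ls_K LS. Qed.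
Let rho0 : 0 < rho. Proof. exact: ls_rho LS. Qed.
Let yr : `|y - y| < rho. Proof. by rewrite subrr normr0. Qed.
Let c0 : 0 < c. Proof. exact: mform_c0 (ls_form LS yr). Qed.
Let C0 : 0 < C. Proof. exact: mform_C0 (ls_form LS yr). Qed.

(** The factor 3 (1 + |w|) serves to share the constant with [christoffel_form_curve], as
    [riesz_curve_expansion] takes one k for both curves. *)
Lemma metric_curve (v w : V) (t0 : R) : t0 * `|v| < rho ->
  bilinear_curve t0 (3 * K * (1 + `|v|) ^+ 3 * (1 + `|w|))
    (fun t u r => dg u r (y + t *: v) [::])
    (fun j u r => (j`!%:R)^-1 * dg u r y (nseq j v)).
Proof.
move=> t0v.
have v1 : 1 <= 1 + `|v| by rewrite lerDl.
have w1 : 1 <= 1 + `|w| by rewrite lerDl.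
have kE (q : R) : 0 <= q -> q <= (1 + `|v|) ^+ 3 -> K * q <= 3 * K * (1 + `|v|) ^+ 3 * (1 + `|w|).
  move=> q0 qv; rewrite -[leLHS]mulr1 ler_pM ?mulr_ge0//.
  by rewrite -[_ * _ * _]mulrA -[K * q]mul1r ler_pM ?mulr_ge0// ?ler1n// ler_wpM2l.
have vk j : (j <= 3)%N -> `|v| ^+ j <= (1 + `|v|) ^+ 3.
  by move=> j3; exact: exprn_le_1D.
have jm j : (j < 3)%N -> (size (nseq j v) <= m)%N.
  by rewrite size_nseq => j3; apply: leq_trans m4; exact: ltnW (ltnW _).
split.
- by move=> j a u u' r j3; rewrite (ls_dg_lin LS) ?jm//; ring.
- move=> j a u u' r j3; rewrite (dg_linr LS)// ?jm//; ring.
- move=> j u r j3; rewrite normrM ger0_norm ?invr_ge0// -[leRHS]mul1r ler_pM// ?invr_ge0//.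
    by rewrite invf_le1 ?ltr0n ?fact_gt0// ler1n fact_gt0.
  rewrite (le_trans (dg_bound LS _ _ yr (jm _ j3)))//.
  rewrite (_ : nprod _ = `|v| ^+ j); last by rewrite -(cats0 (nseq j v)) nprod_nseq_cat nprod0 mulr1.
  rewrite [leLHS](_ : _ = K * `|v| ^+ j * `|u| * `|r|); last by ring.
  by rewrite ler_wpM2r// ler_wpM2r// kE ?exprn_ge0// vk// ltnW.
move=> t u r tt0.
have tv : `|t *: v| < rho by rewrite normrZ (le_lt_trans _ t0v)// ler_wpM2r.
have := jet_line_taylor (ls_jetg LS u r) (s := [::]) (v := v) (t := t) (leq_trans _ m4) rho0 tv.
rewrite nprod0 mulr1 !cats0 => /(_ isT)/le_trans; apply.
rewrite [leLHS](_ : _ = K * `|v| ^+ 3 * (`|t| ^+ 3 * `|u| * `|r|)); last by ring.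
rewrite -[leRHS]mulrA -[leRHS]mulrA [X in _ <= _ * X]mulrA ler_wpM2r ?mulr_ge0 ?exprn_ge0//.
by rewrite kE ?exprn_ge0// vk.
Qed.

(** The Taylor estimate with cubic remainder is applied to first derivatives of g, which takes four
    derivatives of the metric; the factor 3 counts the terms of the Christoffel form. *)
Lemma christoffel_form_curve (v w : V) (t0 : R) : t0 * `|v| < rho ->
  bilinear_curve t0 (3 * K * (1 + `|v|) ^+ 3 * (1 + `|w|))
    (fun t u r => christoffel_form dg (y + t *: v) u w r)
    (fun j u r => (j`!%:R)^-1 * (dg u r y (nseq j v ++ [:: w])
       - dg u w y (nseq j v ++ [:: r]) + dg w r y (nseq j v ++ [:: u]))).
Proof.
move=> t0v.
have vk j : (j <= 3)%N -> `|v| ^+ j <= (1 + `|v|) ^+ 3.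
  by move=> j3; exact: exprn_le_1D.
have jm j a : (j < 3)%N -> (size (nseq j v ++ [:: a]) <= m)%N.
  by rewrite size_cat size_nseq addn1 => j3; apply: leq_trans m4; exact: ltnW.
have jl j a b q u u' : (j < 3)%N -> dg a b y (nseq j v ++ [:: q *: u + u'])
    = q * dg a b y (nseq j v ++ [:: u]) + dg a b y (nseq j v ++ [:: u']).
  move=> j3; apply: (jet_linear (ls_jetg LS a b)) => //.
  by rewrite size_nseq addn0 (leq_trans _ m4)// (leq_trans j3).
have w1 : `|w| <= 1 + `|w| by rewrite lerDr.
have kE (q : R) (u r : V) : 0 <= q -> q <= (1 + `|v|) ^+ 3 ->
    3 * (K * q * `|u| * `|r| * `|w|) <= 3 * K * (1 + `|v|) ^+ 3 * (1 + `|w|) * `|u| * `|r|.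
  move=> q0 qv.
  rewrite [leLHS](_ : _ = (3 * K) * (q * `|w|) * `|u| * `|r|); last by ring.
  rewrite ler_wpM2r// ler_wpM2r// -[leRHS]mulrA ler_wpM2l ?mulr_ge0//.
  by rewrite ler_pM.
split.
- by move=> j a u u' r j3; rewrite !(ls_dg_lin LS) ?jm// jl//; ring.
- by move=> j a u u' r j3; rewrite !(dg_linr LS) ?jm// jl//; ring.
- move=> j u r j3; rewrite normrM ger0_norm ?invr_ge0// -[leRHS]mul1r ler_pM// ?invr_ge0//.
    by rewrite invf_le1 ?ltr0n ?fact_gt0// ler1n fact_gt0.
  have := kE _ u r (exprn_ge0 j (normr_ge0 v)) (vk j (ltnW j3)).
  apply: le_trans.
  have b a d e : `|dg a d y (nseq j v ++ [:: e])| <= K * `|a| * `|d| * (`|v| ^+ j * `|e|).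
    rewrite (le_trans (dg_bound LS _ _ yr (jm _ _ j3)))//.
    by rewrite nprod_nseq_cat nprod_cons nprod0 mulr1.
  apply: norm_addsub_le; apply: (le_trans (b _ _ _)); rewrite le_eqVlt; apply/orP; left; apply/eqP; ring.
move=> t u r tt0.
have tv : `|t *: v| < rho by rewrite normrZ (le_lt_trans _ t0v)// ler_wpM2r.
have b a d e : let D s := dg a d y s in
    `|dg a d (y + t *: v) [:: e] - ((0`!%:R)^-1 * D (nseq 0 v ++ [:: e])
     + t * ((1`!%:R)^-1 * D (nseq 1 v ++ [:: e]))
     + t ^+ 2 * ((2`!%:R)^-1 * D (nseq 2 v ++ [:: e])))|
   <= K * `|v| ^+ 3 * `|t| ^+ 3 * (`|a| * `|d| * `|e|).
  have := jet_line_taylor (ls_jetg LS a d) (s := [:: e]) (v := v) (t := t) m4 rho0 tv.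
  move=> /le_trans; apply; rewrite nprod_cons nprod0 mulr1.
  by rewrite le_eqVlt; apply/orP; left; apply/eqP; ring.
rewrite [leRHS](_ : _ = 3 * K * (1 + `|v|) ^+ 3 * (1 + `|w|) * `|u| * `|r| * `|t| ^+ 3); last by ring.
apply: (@le_trans _ _ (3 * (K * `|v| ^+ 3 * `|u| * `|r| * `|w|) * `|t| ^+ 3)); last first.
  by rewrite ler_wpM2r ?exprn_ge0// kE ?exprn_ge0// vk.
rewrite -mulrA /christoffel_form.
have b1 := b u r w; have b2 := b u w r; have b3 := b w r u; move: b1 b2 b3 => /=.
move=> b1 b2 b3; apply: le_trans (norm_addsub_le (le_trans b1 _) (le_trans b2 _) (le_trans b3 _)).
- by rewrite le_eqVlt; apply/orP; left; apply/eqP; congr (`|_|); ring.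
- by rewrite le_eqVlt; apply/orP; left; apply/eqP; ring.
- by rewrite le_eqVlt; apply/orP; left; apply/eqP; ring.
- by rewrite le_eqVlt; apply/orP; left; apply/eqP; ring.
Qed.

(** The two parts of the covariant derivative are expanded separately: the directional derivative of
    Z through its jet of order 4, the Christoffel part by [riesz_curve_expansion]. *)
Lemma covariant_line_expansion (v w : V) : exists e1 e2 k t0, [/\ 0 <= k, 0 < t0 &
  forall t : R, `|t| <= t0 ->
  `|covariant iota g w Z (y + t *: v)
    - (covariant iota g w Z y + t *: e1 + t ^+ 2 *: e2)| <= k * `|t| ^+ 3].
Proof.
have v1 : 0 < 1 + `|v| by rewrite ltr_pwDl.
pose t0 := Num.min 1 (rhoZ / 2 / (1 + `|v|)).
have t00 : 0 < t0 by rewrite lt_min ltr01 !divr_gt0.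
have t01 (t : R) : `|t| <= t0 -> `|t| <= 1 by rewrite le_min => /andP[].
have t0v : t0 * `|v| < rhoZ.
  apply: (@le_lt_trans _ _ (rhoZ / 2)); last by rewrite ltr_pdivrMr// ltr_pMr// ltr1n.
  apply: (@le_trans _ _ (rhoZ / 2 / (1 + `|v|) * (1 + `|v|))); last by rewrite divfK// gt_eqF.
  rewrite ler_pM//; [exact: ltW|by rewrite ge_min lexx orbT|by rewrite lerDr].
have tvZ (t : R) : `|t| <= t0 -> `|t *: v| < rhoZ.
  by move=> tt0; rewrite normrZ (le_lt_trans _ t0v)// ler_wpM2r.
have tv (t : R) : `|t| <= t0 -> `|y + t *: v - y| < rho.
  by move=> tt0; rewrite addrAC subrr add0r (lt_le_trans (tvZ _ tt0)).
have F := ls_form LS yr.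
have t0v' := lt_le_trans t0v rhoZ_rho.
have BA := metric_curve w t0v'; have BT := christoffel_form_curve w t0v'.
have yrZ : `|y - y| < rhoZ by rewrite subrr normr0.
have tvZ' (t : R) : `|t| <= t0 -> `|y + t *: v - y| < rhoZ.
  by move=> tt0; rewrite addrAC subrr add0r tvZ.
have aE t tt0 := @fjet_line_taylor _ _ _ _ _ _ _ _ _ _ _ y v [::] t F KZ0 JZ isT yrZ (tvZ' t tt0).
have dE t tt0 := @fjet_line_taylor _ _ _ _ _ _ _ _ _ _ _ y v [:: w] t F KZ0 JZ isT yrZ (tvZ' t tt0).
set a1 := DZ y [:: v] in aE; set a2 := 2^-1 *: _ in aE.
set d1 := DZ y [:: v; w] in dE; set d2 := 2^-1 *: _ in dE.
set kA := 3 * K * _ * _ in BA BT.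
have kA0 : 0 <= kA by rewrite !mulr_ge0 ?exprn_ge0// addr_ge0.
set kz := KZ * C / c * _ * _ in aE.
have kz0 : 0 <= kz by rewrite !mulr_ge0 ?invr_ge0 ?exprn_ge0 ?nprod_ge0// ltW.
set kd := KZ * C / c * _ * _ in dE.
have kd0 : 0 <= kd by rewrite !mulr_ge0 ?invr_ge0 ?exprn_ge0 ?nprod_ge0// ltW.
(* Doubled to match [christoffel_form], which represents 2 g(Gamma, r). *)
pose Ga t := 2 *: christoffel iota g (y + t *: v) (Z (y + t *: v)) w.
have F0 : metric_form c C (fun u r => (0`!%:R)^-1 * dg u r y (nseq 0 v)).
  rewrite (_ : (fun u r => _) = (fun u r => dg u r y [::]))//.
  by apply/funext => u; apply/funext => r; rewrite fact0 invr1 mul1r.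
have TD (t : R) u u' r : `|t| <= t0 -> christoffel_form dg (y + t *: v) (u + u') w r =
    christoffel_form dg (y + t *: v) u w r + christoffel_form dg (y + t *: v) u' w r.
  move=> /tv xr; have m1 : (1 <= m)%N by exact: leq_trans m4.
  have := dg_last LS m4 w r 1 u u' xr; rewrite scale1r mul1r => E1.
  by rewrite /christoffel_form !(ls_dgD LS)// E1; ring.
have Tb (t : R) u r : `|t| <= t0 -> `|christoffel_form dg (y + t *: v) u w r| <= kA * `|u| * `|r|.
  move=> /tv xr; have m1 : (1 <= m)%N by exact: leq_trans m4.
  have b a d e : `|dg a d (y + t *: v) [:: e]| <= K * `|a| * `|d| * `|e|.
    by have := dg_bound LS a d (s := [:: e]) xr m1; rewrite nprod_cons nprod0 mulr1.
  have P : 3 * (K * `|u| * `|r| * `|w|) <= kA * `|u| * `|r|.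
    rewrite [leLHS](_ : _ = 3 * K * 1 * `|w| * `|u| * `|r|); last by ring.
    rewrite ler_wpM2r// ler_wpM2r// /kA ler_pM ?mulr_ge0//; last by rewrite lerDr.
    by rewrite ler_wpM2l ?mulr_ge0// exprn_ege1// lerDl.
  apply: le_trans P; apply: norm_addsub_le; first exact: b.
    by apply: (le_trans (b _ _ _)); rewrite mulrAC.
  by apply: (le_trans (b _ _ _)); rewrite le_eqVlt; apply/orP; left; apply/eqP; ring.
have zE (t : R) : `|t| <= t0 ->
    `|Z (y + t *: v) - (DZ y [::] + t *: a1 + t ^+ 2 *: a2)| <= kz * `|t| ^+ 3.
  move=> tt0; rewrite -DZ0; first exact: (aE _ tt0).
  exact: tvZ'.
have GaE (t : R) r : `|t| <= t0 -> dg (Ga t) r (y + t *: v) [::]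
    = christoffel_form dg (y + t *: v) (Z (y + t *: v)) w r.
  move=> tt0; rewrite /Ga (ls_dgZ LS)//; last exact: tv.
  exact: (christoffelP LS m4 dg0E dg1E _ _ (tv _ tt0)).
have [b0 [b1 [b2 [k [k0 bE]]]]] := riesz_curve_expansion kA0 kz0 F0 BA BT
  (fun t tt0 => ls_form LS (tv t tt0)) TD Tb zE GaE.
pose E0 := DZ y [:: w] + 2^-1 *: b0.
pose E1 := d1 + 2^-1 *: b1; pose E2 := d2 + 2^-1 *: b2.
have cE (t : R) : `|t| <= t0 -> `|covariant iota g w Z (y + t *: v)
    - (E0 + t *: E1 + t ^+ 2 *: E2)| <= (kd + k) * `|t| ^+ 3.
  move=> tt0; have xr := tv _ tt0.
  have xrZ : `|y + t *: v - y| < rhoZ by rewrite addrAC subrr add0r tvZ.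
  rewrite (covariantE LS dg0E)// (derive_frechet_jet w JZ)//.
  have -> : christoffel iota g (y + t *: v) (Z (y + t *: v)) w = 2^-1 *: Ga t.
    by rewrite scalerA mulVf// scale1r.
  have -> : DZ (y + t *: v) [:: w] + 2^-1 *: Ga t - (E0 + t *: E1 + t ^+ 2 *: E2)
     = DZ (y + t *: v) [:: w] - (DZ y [:: w] + t *: d1 + t ^+ 2 *: d2)
       + 2^-1 *: (Ga t - (b0 + t *: b1 + t ^+ 2 *: b2)).
    exact: quadratic_split.
  rewrite (le_trans (ler_normD _ _))// mulrDl lerD//; first exact: (dE _ tt0).
  rewrite normrZ (le_trans _ (bE _ tt0 (t01 _ tt0)))//.
  by rewrite ler_piMl// ger0_norm ?invr_ge0// invf_le1// ler1n.
(* The error bound vanishes at t = 0, so the constant coefficient is exact. *)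
have E0E : covariant iota g w Z y = E0.
  have t0n : `|0 : R| <= t0 by rewrite normr0 ltW.
  have := cE 0 t0n; rewrite normr0 !expr0n /= mulr0 !scale0r !addr0 normr_le0 subr_eq0.
  by move/eqP.
exists E1, E2, (kd + k), t0; split => //; first exact: addr_ge0.
by rewrite E0E.
Qed.
End covariant_expansion.

(** * Curvature *)

Lemma near_right_le (R : realType) (t0 : R) (P : R -> Prop) : 0 < t0 ->
  (forall t, 0 < t -> t <= t0 -> P t) -> \forall t \near (0 : R)^'+, P t.
Proof.
move=> t00 H; near=> t; apply: H; first by near: t; exact: nbhs_right_gt.
by near: t; exact: nbhs_right_le.
Unshelve. all: by end_near. Qed.

Lemma powR_le_exprn (R : realType) (a b : R) (k n : nat) : 0 < a -> a <= 1 ->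
  n%:R <= b *+ k -> (a `^ b) ^+ k <= a ^+ n.
Proof.
move=> a0 a1 nb; have a01 : 0 < a <= 1 by rewrite a0.
rewrite -!powR_mulrn ?powR_ge0 ?(ltW a0)// -powRrM ger_powR//.
by rewrite mulr_natr.
Qed.

Section discrete_curvature.
Variables (R : realType) (V Y : completeNormedModType R).
Variables (iota : V -> Y) (M : set V).
Variables (g : Y -> V -> V -> R^o) (W : V -> V -> R^o) (m : nat) (y : V).
Variables (rho K c C : R) (dW : V * V -> seq (V * V) -> R).
Variable (dg : V -> V -> V -> seq V -> R).
Hypothesis LS : local_structure m y rho K c C dW dg.
Hypothesis m4 : (4 <= m)%N.
Hypothesis rhoM : forall x, `|x - y| < rho -> M x.
Hypothesis dWE : forall p q psi, `|p - y| < rho -> `|q - y| < rho ->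
  'd (fun q => W p q) q psi = dW (p, q) [:: (0, psi)] /\
  'd (fun p => W p q) p psi = dW (p, q) [:: (psi, 0)].
Hypothesis dg0E : forall x a b, `|x - y| < rho -> dg a b x [::] = g (iota x) a b.
Hypothesis dg1E : forall x a b w, `|x - y| < rho ->
  'D_w (fun q => g (iota q) a b) x = dg a b x [:: w].
Variables (Z : V -> V) (rhoZ KZ : R) (DZ : V -> seq V -> V).
Hypotheses (rhoZ0 : 0 < rhoZ) (rhoZ_rho : rhoZ <= rho) (KZ0 : 0 <= KZ).
Hypothesis DZ0 : forall x, `|x - y| < rhoZ -> DZ x [::] = Z x.
Hypothesis JZ : frechet_jet 4 y rhoZ KZ DZ.
Variable Rad : R.
Hypotheses (Rad0 : 0 < Rad) (Rad_rho : Rad <= rho / 2) (Rad_c : 3 * K * Rad <= c).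

Let yr : `|y - y| < rho. Proof. by rewrite subrr normr0 (ls_rho LS). Qed.
Let F := ls_form LS yr.

Lemma half_ball x : `|x - y| < rhoZ / 2 -> `|x - y| < rhoZ.
Proof.
by move=> xr; rewrite (lt_le_trans xr)// ler_pdivrMr// ler_pMr// ler1n.
Qed.

Lemma half_ball_shift x w t : `|x - y| < rhoZ / 2 ->
  `|t| <= rhoZ / 2 / (1 + `|w|) -> `|x + t *: w - y| < rhoZ.
Proof.
move=> xr; have w1 : 0 < 1 + `|w| by rewrite ltr_pwDl.
rewrite ler_pdivlMr// => tw; rewrite addrAC (le_lt_trans (ler_normD _ _))//.
rewrite [ltRHS]splitr ltr_leD// normrZ (le_trans _ tw)// ler_wpM2l//.
by rewrite lerDr.
Qed.

Lemma field_expansion w : exists B s0, [/\ 1 <= B, 0 < s0, s0 <= 1, `|w| <= B &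
  forall x t, `|x - y| < rhoZ / 2 -> `|t| <= s0 ->
  [/\ `|Z x| <= B, `|DZ x [:: w]| <= B, `|2^-1 *: DZ x [:: w; w]| <= B &
   `|Z (x + t *: w) - (Z x + t *: DZ x [:: w] + t ^+ 2 *: (2^-1 *: DZ x [:: w; w]))|
     <= B * `|t| ^+ 3]].
Proof.
have w1 : 0 < 1 + `|w| by rewrite ltr_pwDl.
pose B := Num.max (Num.max (Num.max 1 `|w|) (Num.max (KZ * 1) (KZ * `|w|)))
  (Num.max (KZ * (`|w| * `|w|)) (KZ * C / c * `|w| ^+ 3 * 1)).
exists B, (Num.min 1 (rhoZ / 2 / (1 + `|w|))); split.
- by rewrite !le_max lexx.
- by rewrite lt_min ltr01 !divr_gt0.
- by rewrite ge_min lexx.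
- by rewrite !le_max lexx ?orbT.
move=> x t xr; rewrite le_min => /andP[t1 tw].
have xrZ := half_ball xr; have xtr := half_ball_shift xr tw.
split.
- rewrite -DZ0// (le_trans (fjet_bound JZ xrZ _))// nprod0.
  by rewrite !le_max lexx ?orbT.
- rewrite (le_trans (fjet_bound JZ xrZ _))// nprod_cons nprod0 mulr1.
  by rewrite !le_max lexx ?orbT.
- rewrite normrZ (@le_trans _ _ `|DZ x [:: w; w]|)//.
    by rewrite ler_piMl// ger0_norm ?invr_ge0// invf_le1// ler1n.
  rewrite (le_trans (fjet_bound JZ xrZ _))// !nprod_cons nprod0 mulr1.
  by rewrite !le_max lexx ?orbT.
have := fjet_line_taylor (s := [::]) F KZ0 JZ isT xrZ xtr.
rewrite !DZ0// nprod0 => /le_trans; apply.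
by rewrite ler_wpM2r ?exprn_ge0// !le_max lexx ?orbT.
Qed.

Lemma covariant_jetE w x : `|x - y| < rhoZ ->
  covariant iota g w Z x = DZ x [:: w] + christoffel iota g x (Z x) w.
Proof.
move=> xr; rewrite (covariantE LS dg0E)//; last exact: lt_le_trans rhoZ_rho.
by rewrite (derive_frechet_jet w JZ).
Qed.

(** Uniformity in x is what the outer quotient asks for: it evaluates the inner one at y and at y +
    tau v. *)
Lemma dcov_uniform r w : 0 < r -> r <= Rad ->
  exists k s0, [/\ 0 <= k, 0 < s0 & forall x s, `|x - y| < rhoZ / 2 ->
    0 < s -> s <= s0 ->
    `|dcov M W r s w Z x - covariant iota g w Z x| <= k * s].
Proof.
move=> r0 rRad; have [B [s0 [B1 s00 s01 wB ZE]]] := field_expansion w.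
have B0 : 0 <= B by exact: le_trans B1.
have B12 : 1 <= 2 * B by rewrite mulr2n mulrDl mul1r ler_wpDr.
have BB : B <= 2 * B by rewrite mulr2n mulrDl mul1r lerDl.
have [k [t0 [k0 t00 kP]]] :=
  dcov_expansion LS m4 rhoM dWE dg0E dg1E Rad0 Rad_rho Rad_c r0 rRad B12.
exists k, (Num.min t0 s0); split; rewrite ?lt_min ?t00//.
move=> x s xr sp; rewrite le_min => /andP[st0 ss0].
have ns : `|s| = s by rewrite gtr0_norm.
have [|ZB D1B D2B D3B] := ZE x s xr; first by rewrite ns.
rewrite covariant_jetE; last exact: half_ball.
have s1 := le_trans ss0 s01.
apply: kP; rewrite ?(le_trans wB)// ?(le_trans ZB)// ?(le_trans D1B)//.
- by rewrite (lt_le_trans xr)// ler_pM2r.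
- set D2 := 2^-1 *: _ in D2B D3B.
  have E (a b e : V) : a - b = a - (b + e) + e by rewrite opprD addrA subrK.
  rewrite [X in `|X|](E _ _ (s ^+ 2 *: D2)) (le_trans (ler_normD _ _))// mulr2n mulrDl mul1r mulrDl lerD//.
    rewrite (le_trans D3B)// ns ler_wpM2l// exprS ler_piMl// exprn_ge0//.
    exact: ltW.
  by rewrite normrZ normrX ns mulrC ler_wpM2r// exprn_ge0// ltW.
by rewrite subrr normr0; apply: mulr_ge0; [exact: le_trans BB|rewrite exprn_ge0// ltW].
Qed.

Lemma dcov_central_uniform r w : (5 <= m)%N -> 0 < r -> r <= Rad ->
  exists k s0, [/\ 0 <= k, 0 < s0 & forall x s, `|x - y| < rhoZ / 2 ->
    0 < s -> s <= s0 ->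
    `|dcov_central M W r s w Z x - covariant iota g w Z x| <= k * s ^+ 2].
Proof.
move=> m5 r0 rRad; have [B [s0 [B1 s00 s01 wB ZE]]] := field_expansion w.
have [k [t0 [k0 t00 kP]]] :=
  dcov_central_expansion LS m4 rhoM dWE dg0E dg1E Rad0 Rad_rho Rad_c m5 r0 rRad B1.
exists k, (Num.min t0 s0); split; rewrite ?lt_min ?t00//.
move=> x s xr sp; rewrite le_min => /andP[st0 ss0].
have ns : `|s| = s by rewrite gtr0_norm.
have [|ZB D1B D2B D3B] := ZE x s xr; first by rewrite ns.
have [|_ _ _] := ZE x (- s) xr; first by rewrite normrN ns.
rewrite sqrrN normrN !scaleNr ns => D4B; rewrite ns in D3B.
rewrite covariant_jetE; last exact: half_ball.
apply: (kP x w Z (Z x) (DZ x [:: w]) _ s _ wB ZB D1B D2B sp st0 D3B D4B).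
by rewrite (lt_le_trans xr)// ler_pM2r.
Qed.

Let yrZ : `|y - y| < rhoZ / 2. Proof. by rewrite subrr normr0 divr_gt0. Qed.

Lemma line_half_ball v t : `|t| <= rhoZ / 4 / (1 + `|v|) -> `|y + t *: v - y| < rhoZ / 2.
Proof.
have v1 : 0 < 1 + `|v| by rewrite ltr_pwDl.
rewrite ler_pdivlMr// => tv; rewrite addrAC subrr add0r.
have : rhoZ / 4 < rhoZ / 2 by rewrite ltr_pM2l// ltf_pV2 ?posrE// ltr_nat.
by apply: le_lt_trans; rewrite normrZ (le_trans _ tv)// ler_wpM2l// lerDr.
Qed.

(** Supplies the polynomial that the outer quotient requires of the field D_w Z along v; e1 is its
    directional derivative, which identifies the limit as D_v D_w Z. The bound on t keeps y + t v in
    the half ball where the inner estimate is uniform. *)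
Lemma covariant2E v w : exists e1 e2 k t0, [/\ 0 <= k, 0 < t0, t0 <= 1,
  covariant iota g v (covariant iota g w Z) y
    = e1 + christoffel iota g y (covariant iota g w Z y) v &
  forall t : R, `|t| <= t0 -> `|y + t *: v - y| < rhoZ / 2 /\
  `|covariant iota g w Z (y + t *: v)
    - (covariant iota g w Z y + t *: e1 + t ^+ 2 *: e2)| <= k * `|t| ^+ 3].
Proof.
have v1 : 0 < 1 + `|v| by rewrite ltr_pwDl.
have [e1 [e2 [k [t0 [k0 t00 eE]]]]] :=
  covariant_line_expansion LS m4 dg0E dg1E rhoZ0 rhoZ_rho KZ0 DZ0 JZ v w.
exists e1, e2, k, (Num.min t0 (Num.min 1 (rhoZ / 4 / (1 + `|v|)))); split => //.
- by rewrite !lt_min t00 ltr01 !divr_gt0.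
- by rewrite !ge_min lexx orbT.
- rewrite (covariantE LS dg0E _ _ yr); congr (_ + _).
  have t10 : 0 < Num.min t0 1 by rewrite lt_min t00 ltr01.
  apply: (derive_of_expansion (k := k + `|e2|) t10) => t.
  rewrite le_min => /andP[tt0 t1].
  have E (a b f h : V) : a - b - f = a - (b + f + h) + h by rewrite !opprD !addrA subrK.
  rewrite [X in `|X|](E _ _ _ (t ^+ 2 *: e2)) (le_trans (ler_normD _ _))//.
  rewrite mulrDl lerD//; last by rewrite normrZ normrX mulrC.
  rewrite (le_trans (eE _ tt0))// ler_wpM2l// exprS ler_piMl//; exact: exprn_ge0.
move=> t; rewrite !le_min => /and3P[tt0 t1 tv]; split; last exact: eE.
exact: line_half_ball.
Qed.

Lemma dcov2_expansion r beta v w : 2 <= beta -> 0 < r -> r <= Rad ->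
  exists k, \forall tau \near (0 : R)^'+,
    `|dcov M W r tau v (dcov M W r (tau `^ beta) w Z) y
      - covariant iota g v (covariant iota g w Z) y| <= k * tau.
Proof.
move=> b2 r0 rRad.
have [ki [si [ki0 si0 iP]]] := dcov_uniform w r0 rRad.
have [e1 [e2 [ke [te [ke0 te0 te1 -> eP]]]]] := covariant2E v w.
set eta := covariant iota g w Z in iP eP *.
(* The inner constants are fixed before B, on which the outer constant depends; the quadratic
   coefficient e2 counts as an error of order t^2 here. *)
pose B := Num.max (Num.max (Num.max 1 `|v|) (Num.max `|eta y| `|e1|)) (ki + ke + `|e2|).
have B1 : 1 <= B by rewrite !le_max lexx.
have [k [to [k0 to0 oP]]] :=
  dcov_expansion LS m4 rhoM dWE dg0E dg1E Rad0 Rad_rho Rad_c r0 rRad B1.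
exists k; apply: (@near_right_le _ (Num.min (Num.min to si) te)).
  by rewrite !lt_min to0 si0.
move=> t tp; rewrite !le_min => /andP[/andP[tto tsi] tte].
have nt : `|t| = t by rewrite gtr0_norm.
have t1 := le_trans tte te1.
have t2 : t ^+ 2 <= t by rewrite expr2 ler_piMl// ltW.
set s := t `^ beta.
have sp : 0 < s by exact: powR_gt0.
(* The outer quotient divides the inner error ki s by t, so s = O(t^2) leaves an error O(t). *)
have st2 : s <= t ^+ 2 by exact: (@powR_le_exprn _ _ _ 1).
have ss : s <= si by rewrite (le_trans st2)// (le_trans t2).
have kB : ki + ke + `|e2| <= B by rewrite !le_max lexx !orbT.
have kiB : ki <= B by rewrite (le_trans _ kB)// -addrA lerDl addr_ge0.
have [|xt eE] := eP t; first by rewrite nt.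
rewrite nt in eE.
apply: (oP y v _ (eta y) e1) => //.
- by rewrite (lt_le_trans yrZ)// ler_pM2r.
- by rewrite !le_max lexx ?orbT.
- by rewrite !le_max lexx ?orbT.
- by rewrite !le_max lexx ?orbT.
- have E (p a b f h : V) : p - (a + b) = (p - f) + ((f - (a + b + h)) + h).
    by rewrite -[LHS](subrKA f) (opprD (a + b)) (addrA f) subrK.
  rewrite [X in `|X|](E _ _ _ (eta (y + t *: v)) (t ^+ 2 *: e2)).
  apply: (@le_trans _ _ ((ki + ke + `|e2|) * t ^+ 2)); last first.
    by rewrite ler_wpM2r// exprn_ge0// ltW.
  rewrite -(addrA ki) mulrDl (le_trans (ler_normD _ _))// lerD//.
    by rewrite (le_trans (iP _ _ xt sp ss))// ler_wpM2l.
  rewrite mulrDl (le_trans (ler_normD _ _))// lerD//.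
    rewrite (le_trans eE)// ler_wpM2l// exprS ler_piMl//; exact: exprn_ge0 (ltW tp).
  by rewrite normrZ normrX nt mulrC.
by rewrite (le_trans (iP _ _ yrZ sp ss))// ler_pM// ltW.
Qed.

Lemma dcov_central2_expansion r beta v w : (5 <= m)%N -> 3 / 2 <= beta ->
  0 < r -> r <= Rad ->
  exists k, \forall tau \near (0 : R)^'+,
    `|dcov_central M W r tau v (dcov_central M W r (tau `^ beta) w Z) y
      - covariant iota g v (covariant iota g w Z) y| <= k * tau ^+ 2.
Proof.
move=> m5 b2 r0 rRad.
have [ki [si [ki0 si0 iP]]] := dcov_central_uniform w m5 r0 rRad.
have [e1 [e2 [ke [te [ke0 te0 te1 -> eP]]]]] := covariant2E v w.
set eta := covariant iota g w Z in iP eP *.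
pose B := Num.max (Num.max (Num.max 1 `|v|) (Num.max `|eta y| `|e1|))
  (Num.max `|e2| (ki + ke)).
have B1 : 1 <= B by rewrite !le_max lexx.
have [k [to [k0 to0 oP]]] :=
  dcov_central_expansion LS m4 rhoM dWE dg0E dg1E Rad0 Rad_rho Rad_c m5 r0 rRad B1.
exists k; apply: (@near_right_le _ (Num.min (Num.min to si) te)).
  by rewrite !lt_min to0 si0.
move=> t tp; rewrite !le_min => /andP[/andP[tto tsi] tte].
have nt : `|t| = t by rewrite gtr0_norm.
have t1 := le_trans tte te1.
set s := t `^ beta.
have sp : 0 < s by exact: powR_gt0.
(* The inner error ki s^2 is divided by t once more, so the order t^3, that is 2 beta >= 3, leaves
   O(t^2). *)
have s2 : s ^+ 2 <= t ^+ 3.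
  by apply: powR_le_exprn => //; rewrite -(mulr_natr beta) -ler_pdivrMr.
have ss : s <= si.
  rewrite (le_trans _ tsi)//; apply: (@powR_le_exprn _ _ _ 1 1) => //.
  by rewrite mulr1n (le_trans _ b2)// ler_pdivlMr// mul1r ler_nat.
have kB : ki + ke <= B by rewrite !le_max lexx !orbT.
have half (u : R) (e : V) : `|y + u *: v - y| < rhoZ / 2 -> `|u| = t ->
    `|eta (y + u *: v) - e| <= ke * `|u| ^+ 3 ->
    `|dcov_central M W r s w Z (y + u *: v) - e| <= B * t ^+ 3.
  move=> ur nu uE; rewrite -(subrKA (eta (y + u *: v))).
  rewrite (le_trans (ler_normD _ _))// (@le_trans _ _ ((ki + ke) * t ^+ 3))//; last first.
    by rewrite ler_wpM2r// exprn_ge0// ltW.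
  rewrite mulrDl lerD//; last by rewrite -nu.
  by rewrite (le_trans (iP _ _ ur sp ss))// ler_wpM2l.
have [|xt eE] := eP t; first by rewrite nt.
have [|xmt emE] := eP (- t); first by rewrite normrN nt.
apply: (oP y v _ (eta y) e1 e2) => //.
- by rewrite (lt_le_trans yrZ)// ler_pM2r.
- by rewrite !le_max lexx ?orbT.
- by rewrite !le_max lexx ?orbT.
- by rewrite !le_max lexx ?orbT.
- by rewrite !le_max lexx ?orbT.
- exact: half.
have := half (- t) _ xmt _ emE; rewrite normrN nt sqrrN !scaleNr; exact.
Qed.
End discrete_curvature.

Theorem theorem5p1 (R : realType) (V Y : completeNormedModType R)
    (iota : {linear V -> Y}) (M : set V)
    (g : Y -> V -> V -> R^o) (W : V -> V -> R^o)
    (m : nat) (beta : R) (y v w z : V) (Z : V -> V)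
    (V_separable : separable_space V)
    (V_reflexive : reflexive_space V)
    (iota_compact : compact_embedding iota)
    (M_closure : exists U : set V,
       [/\ open U, path_connected U & M = weak_closure U])
    (g_metric : riemannian_metric iota M g)
    (g_C3 : Cn_on 3 [set: (Y * V * V)%type]
       (fun q : Y * V * V => g q.1.1 q.1.2 q.2))
    (W_lsc : weakly_lsc (extend_by_infty iota M W))
    (W_consistent : locally_consistent iota M g W)
    (W_Cm : Cn_on m (M `*` M) (fun q : V * V => W q.1 q.2))
    (g_Cm : Cn_on m (M `*` [set: V] `*` [set: V])
       (fun q : V * V * V => g (iota q.1.1) q.1.2 q.2))
    (y_int : M° y)
    (Z_smooth : smooth_on M Z)
    (Z_y : Z y = z) :
  ((4 <= m)%N -> 2 <= beta ->
     \forall r \near (0 : R)^'+, exists C : R, \forall tau \near (0 : R)^'+,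
       `| dcurvature M W r beta tau y v w Z - curvature iota g y v w Z |
       <= C * tau) /\
  ((5 <= m)%N -> 3 / 2 <= beta ->
     \forall r \near (0 : R)^'+, exists C : R, \forall tau \near (0 : R)^'+,
       `| dcurvature_central M W r beta tau y v w Z
          - curvature iota g y v w Z |
       <= C * tau ^+ 2).
Proof.
(* One radius Rad serves all directions v', w', so that it fits both orders of differentiation and
   is fixed before tau. *)
have step : (4 <= m)%N -> exists2 Rad : R, 0 < Rad & forall r v' w',
    0 < r -> r <= Rad ->
    (2 <= beta -> exists k, \forall tau \near (0 : R)^'+,
      `|dcov M W r tau v' (dcov M W r (tau `^ beta) w' Z) y
        - covariant iota g v' (covariant iota g w' Z) y| <= k * tau) /\
    ((5 <= m)%N -> 3 / 2 <= beta -> exists k, \forall tau \near (0 : R)^'+,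
      `|dcov_central M W r tau v' (dcov_central M W r (tau `^ beta) w' Z) y
        - covariant iota g v' (covariant iota g w' Z) y| <= k * tau ^+ 2).
  move=> m4.
  have [dW [dg [rho [K [c [C [LS rhoM dWE dg0E dg1E]]]]]]] :=
    local_structure_exists g_metric W_consistent W_Cm g_Cm y_int m4.
  have rho0 := ls_rho LS; have K0 := ls_K LS.
  have c0 : 0 < c.
    by apply: (mform_c0 (ls_form LS (x := y) _)); rewrite subrr normr0.
  have [DZ [rho1 [KZ [rho10 KZ0 _ DZ0 JZ]]]] := Cn_on_frechet_jet (Z_smooth 4%N) y_int.
  pose rhoZ := Num.min rho1 rho.
  have rhoZ1 x : `|x - y| < rhoZ -> `|x - y| < rho1 by rewrite lt_min => /andP[].
  have rhoZ0 : 0 < rhoZ by rewrite lt_min rho10.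
  have rhoZ_rho : rhoZ <= rho by rewrite ge_min lexx orbT.
  have JZ' : frechet_jet 4 y rhoZ KZ DZ.
    split => [x s1 s2 a u u' /rhoZ1|x s /rhoZ1|x s /rhoZ1]; first exact: (fjet_linear JZ).
      exact: (fjet_bound JZ).
    exact: (fjet_diff JZ).
  have DZ0' x : `|x - y| < rhoZ -> DZ x [::] = Z x by move=> /rhoZ1; exact: DZ0.
  have K1 : 0 < 3 * K + 1 by rewrite ltr_wpDl// mulr_ge0.
  pose Rad := Num.min (rho / 2) (c / (3 * K + 1)).
  have Rad0 : 0 < Rad by rewrite lt_min !divr_gt0.
  have Rad_rho : Rad <= rho / 2 by rewrite ge_min lexx.
  have Rad_c : 3 * K * Rad <= c.
    apply: (@le_trans _ _ ((3 * K + 1) * Rad)); first by rewrite ler_wpM2r ?(ltW Rad0)// lerDl.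
    by rewrite -ler_pdivlMl// mulrC ge_min lexx orbT.
  exists Rad => // r v' w' r0 rRad; split => [b2|m5 b2].
    exact: (dcov2_expansion LS m4 rhoM dWE dg0E dg1E rhoZ0 rhoZ_rho KZ0 DZ0' JZ'
      Rad0 Rad_rho Rad_c v' w' b2 r0 rRad).
  exact: (dcov_central2_expansion LS m4 rhoM dWE dg0E dg1E rhoZ0 rhoZ_rho KZ0 DZ0' JZ'
    Rad0 Rad_rho Rad_c v' w' m5 b2 r0 rRad).
(* Each order of differentiation is compared with its own second covariant derivative, and the two
   errors are added. *)
have swap (a b a' b' : V) : a - b - (a' - b') = a - a' - (b - b').
  by rewrite !opprB addrACA [RHS]addrACA [- b - a']addrC.
split => [m4 b2|m5 b2].
  have [Rad Rad0 RadP] := step m4; apply: (near_right_le Rad0) => r r0 rRad.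
  have [/(_ b2)[k1 P1] _] := RadP r v w r0 rRad.
  have [/(_ b2)[k2 P2] _] := RadP r w v r0 rRad.
  exists (k1 + k2); apply: filterS2 P1 P2 => t P1 P2.
  rewrite /dcurvature /curvature swap mulrDl.
  by rewrite (le_trans (ler_normB _ _))// lerD.
have [Rad Rad0 RadP] := step (ltnW m5); apply: (near_right_le Rad0) => r r0 rRad.
have [_ /(_ m5 b2)[k1 P1]] := RadP r v w r0 rRad.
have [_ /(_ m5 b2)[k2 P2]] := RadP r w v r0 rRad.
exists (k1 + k2); apply: filterS2 P1 P2 => t P1 P2.
rewrite /dcurvature_central /curvature swap mulrDl.
by rewrite (le_trans (ler_normB _ _))// lerD.
Qed.
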